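(* Let $K$ be a field, let $\mathcal{T}$ be a sheaf of commutative $K$-algebras on a finite poset $P$ (with the Alexandrov topology), and let $I$ be an ideal of the ring $H^0(P,\mathcal{T})$. For $x\in P$ let $d_x$ denote the Krull dimension of the stalk $\mathcal{T}_x$ of $\mathcal{T}$ at $x$. Assume that: (i) $H^0(P,\mathcal{T})$ is a Noetherian ring and $H^i(P,\mathcal{T})=0$ for every $i>0$; (ii) $H^i_I(\mathcal{T}_x)=0$ for every $x\in P$ and every $i\neq d_x$; (iii) if $x<y$ in $P$, then $d_x<d_y$. Then for every $i$ there is an isomorphism of $K$-modules $$H^i_I(H^0(P,\mathcal{T}))\cong\bigoplus_{x\in P}\widetilde H^{\,i-d_x-1}((x,1_{\widehat P});K)\otimes_K H^{d_x}_I(\mathcal{T}_x).$$ If moreover $\mathcal{T}$ is a sheaf of $\mathbb{Z}^d$-graded $K$-algebras and $I$ is a graded ideal, then this isomorphism is an isomorphism of $\mathbb{Z}^d$-graded $K$-modules (where the reduced cohomology groups are placed in degree $0$).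
   Context: A poset $P$ is regarded as a topological space with the Alexandrov topology, whose open sets are the lower subsets (order ideals): $U$ is open iff $y\in U$ and $x\le y$ imply $x\in U$. $H^i(P,\mathcal{T})$ denotes sheaf cohomology; $H^0(P,\mathcal{T})$ is the ring of global sections. The stalk at $x$ is $\mathcal{T}_x=\mathcal{T}(\{z\in P: z\le x\})$, and it is a module over $H^0(P,\mathcal{T})$ via the restriction homomorphism $H^0(P,\mathcal{T})\to\mathcal{T}_x$. For an ideal $I$ of a Noetherian commutative ring $R$ and an $R$-module $M$, $H^i_I(M)=\operatorname{colim}_n\operatorname{Ext}^i_R(R/I^n,M)$ is local cohomology. $(x,1_{\widehat P})=\{y\in P: x<y\}$ as a sub-poset of $P$. $\widetilde H^{j}(Q;K)$ for a poset $Q$ denotes the reduced simplicial cohomology with coefficients in $K$ of the order complex $\Delta(Q)$ (the simplicial complex of finite chains of $Q$); for $Q=\emptyset$ it is $K$ in degree $j=-1$ and $0$ otherwise. *)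

(* Defs.v *)
From HB Require Import structures.
From mathcomp Require Import all_boot all_order all_algebra.
From mathcomp Require Import generic_quotient ring_quotient.
From mathcomp Require Import boolp functions constructive_ereal.
From mathcomp Require Import freeg.

Set Implicit Arguments.
Unset Strict Implicit.
Unset Printing Implicit Defensive.

Import Order.TTheory GRing.Theory Num.Theory.
Local Open Scope ring_scope.
Local Open Scope quotient_scope.

Section Submodules.
Variables (R : pzRingType) (V : lmodType R).

Section OfProp.
Variables (P : V -> Prop) (P0 : P 0).
Hypothesis Plin : forall a u v, P u -> P v -> P (a *: u + v).
Let Pb : {pred V} := fun v => `[< P v >].
Fact submod_of_subproof : submod_closed Pb.
Proof.
split; first exact/asboolP.
by move=> a u v /asboolP Pu /asboolP Pv; apply/asboolP/Plin.
Qed.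
Definition submod_of : submodClosed V :=
  HB.pack Pb (GRing.isSubmodClosed.Build R V Pb submod_of_subproof).
Lemma in_submod_of v : (v \in submod_of) = `[< P v >]. Proof. by []. Qed.
End OfProp.

Section Sub.
Variable S : submodClosed V.
Record subm := Subm { subm_val : V; subm_valP : subm_val \in S }.
HB.instance Definition _ := [isSub for subm_val].
HB.instance Definition _ := [Choice of subm by <:].
HB.instance Definition _ := [SubChoice_isSubLmodule of subm by <:].
End Sub.

Section Quot.
Variable S : submodClosed V.
Fact submod_zmod_closed : zmod_closed (S : {pred V}).
Proof. exact/GRing.submod_closedB/GRing.submodClosedP. Qed.
Definition submod_zmod : zmodClosed V :=
  HB.pack (GRing.SubmodClosed.sort S)
    (GRing.isZmodClosed.Build V (GRing.SubmodClosed.sort S)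
       submod_zmod_closed).
Definition quotm : Type := Quotient.quot submod_zmod.
HB.instance Definition _ := GRing.Zmodule.on quotm.

Definition pim (v : V) : quotm := \pi_(Quotient.quot submod_zmod) v.
Definition reprm (q : quotm) : V := repr (q : Quotient.quot submod_zmod).

Lemma reprmK : cancel reprm pim.
Proof. exact: reprK. Qed.

Lemma pim_eq u v : (pim u == pim v) = (u - v \in S).
Proof. exact/esym/(Quotient.idealrBE submod_zmod). Qed.

Fact pim_add : {morph pim : u v / u + v}.
Proof. by move=> u v; rewrite /pim [LHS]raddfD. Qed.

Definition scalem (a : R) (q : quotm) : quotm := pim (a *: reprm q).

Fact scalemE a v : scalem a (pim v) = pim (a *: v).
Proof.
by apply/eqP; rewrite pim_eq -scalerBr rpredZ // -pim_eq reprmK.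
Qed.

Fact scalemA a b q : scalem a (scalem b q) = scalem (a * b) q.
Proof. by rewrite -(reprmK q) !scalemE scalerA. Qed.
Fact scale1m : left_id 1 scalem.
Proof. by move=> q; rewrite -(reprmK q) scalemE scale1r. Qed.
Fact scalemDr : right_distributive scalem +%R.
Proof.
move=> a p q; rewrite -(reprmK p) -(reprmK q) -pim_add !scalemE.
by rewrite scalerDr pim_add.
Qed.
Fact scalemDl q : {morph scalem^~ q : a b / a + b}.
Proof. by move=> a b; rewrite -(reprmK q) !scalemE scalerDl pim_add. Qed.

HB.instance Definition _ :=
  GRing.Zmodule_isLmodule.Build R quotm scalemA scale1m scalemDr scalemDl.

Fact pim_linear : linear pim.
Proof. by move=> a u v; rewrite pim_add -scalemE. Qed.
HB.instance Definition _ := GRing.isLinear.Build R V quotm _ pim pim_linear.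
End Quot.
End Submodules.

Section LinearSubmodules.
Variables (R : pzRingType) (U V : lmodType R).

Fact zerom_lin (a : R) (u v : V) : u = 0 -> v = 0 -> a *: u + v = 0.
Proof. by move=> -> ->; rewrite scaler0 addr0. Qed.
Definition zerom : submodClosed V := submod_of (erefl 0) zerom_lin.

Fact spanm0 (S : V -> Prop) (M : submodClosed V) :
  (forall u, S u -> u \in M) -> 0 \in M.
Proof. by move=> _; exact: rpred0. Qed.
Fact spanm_lin (S : V -> Prop) (a : R) (u v : V) :
  (forall M : submodClosed V, (forall u, S u -> u \in M) -> u \in M) ->
  (forall M : submodClosed V, (forall u, S u -> u \in M) -> v \in M) ->
  forall M : submodClosed V, (forall u, S u -> u \in M) -> a *: u + v \in M.
Proof.
by move=> Su Sv M SM; rewrite rpredD ?rpredZ ?Su ?Sv.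
Qed.
Definition spanm (S : V -> Prop) : submodClosed V :=
  submod_of (@spanm0 S) (@spanm_lin S).

Variable f : {linear U -> V}.

Fact kerm_lin (a : R) u v : f u = 0 -> f v = 0 -> f (a *: u + v) = 0.
Proof. by move=> fu fv; rewrite linearP fu fv scaler0 addr0. Qed.
Definition kerm : submodClosed U := submod_of (linear0 f) kerm_lin.

Fact imm0 : exists u, 0 = f u. Proof. by exists 0; rewrite linear0. Qed.
Fact imm_lin (a : R) v w :
  (exists u, v = f u) -> (exists u, w = f u) -> exists u, a *: v + w = f u.
Proof. by move=> [u ->] [t ->]; exists (a *: u + t); rewrite linearP. Qed.
Definition imm : submodClosed V := submod_of imm0 imm_lin.

Variable B : submodClosed V.
Fact preimm0 : f 0 \in B. Proof. by rewrite linear0 rpred0. Qed.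
Fact preimm_lin (a : R) u v : f u \in B -> f v \in B -> f (a *: u + v) \in B.
Proof. by move=> fu fv; rewrite linearP rpredD ?rpredZ. Qed.
Definition preimm : submodClosed U := submod_of preimm0 preimm_lin.
End LinearSubmodules.
Arguments zerom {R V}.

Section Subquotients.
Variables (R : pzRingType) (V : lmodType R).

(* [subquot Z B] is Z / (Z :&: B); in all uses below B is contained in Z. *)
Definition subquot (Z B : submodClosed V) : lmodType R :=
  quotm (preimm (val : {linear subm Z -> V}) B).

Definition subclass (Z B : submodClosed V) : {linear subm Z -> subquot Z B} :=
  pim _.

Definition subrepr (Z B : submodClosed V) (q : subquot Z B) : subm Z :=
  reprm q.
End Subquotients.

Section SubquotientMap.
Variables (R : pzRingType) (V V' : lmodType R) (f : {linear V -> V'}).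
Variables (Z B : submodClosed V) (Z' B' : submodClosed V').
Hypothesis fZ : forall v, v \in Z -> f v \in Z'.
Hypothesis fB : forall v, v \in B -> f v \in B'.

Let sqmap (q : subquot Z B) : subquot Z' B' :=
  subclass Z' B' (Subm (fZ (subm_valP (subrepr q)))).

Fact sqmapE z :
  sqmap (subclass Z B z) = subclass Z' B' (Subm (fZ (subm_valP z))).
Proof.
apply/eqP; rewrite pim_eq; apply/asboolP; rewrite raddfB /= -raddfB fB //.
have /eqP := reprmK (subclass Z B z).
by rewrite pim_eq => /asboolP.
Qed.

Fact sqmap_linear : linear sqmap.
Proof.
move=> a p q; rewrite -[p]reprmK -[q]reprmK -linearP.
rewrite !(sqmapE _) -linearP; congr (subclass _ _ _).
by apply: val_inj; rewrite /= !linearP.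
Qed.

Definition subquot_map : {linear subquot Z B -> subquot Z' B'} :=
  HB.pack sqmap (GRing.isLinear.Build R _ _ _ sqmap sqmap_linear).

Lemma subquot_mapE z :
  subquot_map (subclass Z B z) = subclass Z' B' (Subm (fZ (subm_valP z))).
Proof. exact: sqmapE. Qed.
End SubquotientMap.

Section Complexes.
Variable R : pzRingType.

Record cochain := Cochain {
  cobj :> nat -> lmodType R;
  cdiff : forall n, {linear cobj n -> cobj n.+1};
  cdiffK : forall n u, cdiff n.+1 (cdiff n u) = 0 }.

Definition cocyc (C : cochain) n : submodClosed (C n) := kerm (cdiff C n).
Definition cobound (C : cochain) n : submodClosed (C n) :=
  if n is m.+1 then imm (cdiff C m) else zerom.

Definition zeromod : lmodType R := 'rV[R]_0.

Definition cohom (C : cochain) (i : int) : lmodType R :=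
  if i is Posz n then subquot (cocyc C n) (cobound C n) else zeromod.

Definition trivial_mod (V : lmodType R) := forall v : V, v = 0.

(* The classes that have a cocycle satisfying [hC] as representative. *)
Definition cohom_rep (C : cochain) (hC : forall n, C n -> Prop) (i : int) :
    cohom C i -> Prop :=
  match i with
  | Posz n => fun e => exists2 z : subm (cocyc C n), subclass _ _ z = e &
                                                      hC n (val z)
  | Negz _ => fun _ => True
  end.

Section Map.
Variables (C D : cochain) (f : forall n, {linear C n -> D n}).
Hypothesis fd : forall n u, f n.+1 (cdiff C n u) = cdiff D n (f n u).

Fact cochain_map_cocyc n v : v \in cocyc C n -> f n v \in cocyc D n.
Proof. by move/asboolP=> dv; apply/asboolP; rewrite -fd dv linear0. Qed.
Fact cochain_map_cobound n v : v \in cobound C n -> f n v \in cobound D n.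
Proof.
case: n v => [|n] v /asboolP vB; apply/asboolP; first by rewrite vB linear0.
by case: vB => u ->; exists (f n u); rewrite fd.
Qed.

Definition cohom_map (i : int) : {linear cohom C i -> cohom D i} :=
  match i with
  | Posz n => subquot_map (@cochain_map_cocyc n) (@cochain_map_cobound n)
  | Negz _ => idfun
  end.
End Map.
End Complexes.

Section Hom.
Variable R : comPzRingType.

Section HomModule.
Variables U V : lmodType R.
Implicit Types f g h : {linear U -> V}.

HB.instance Definition _ := gen_eqMixin {linear U -> V}.
HB.instance Definition _ := gen_choiceMixin {linear U -> V}.

Lemma hom_ext f g : f =1 g -> f = g.
Proof.
move=> fg; have {fg} : (f : U -> V) = g by apply: funext.
case: f g => f [[a] [b]] [g [[c] [d]]] /= fg; subst g.
by congr (GRing.Linear.Pack (GRing.Linear.Class _ _)); congr (_ _);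
  exact: Prop_irrelevance.
Qed.

Fact add_hom_linear f g : linear (fun u => f u + g u).
Proof. by move=> a u v; rewrite !linearP scalerDr addrACA. Qed.
Definition add_hom f g : {linear U -> V} :=
  HB.pack (fun u => f u + g u) (GRing.isLinear.Build R U V _ _ (add_hom_linear f g)).

Fact opp_hom_linear f : linear (fun u => - f u).
Proof. by move=> a u v; rewrite linearP opprD scalerN. Qed.
Definition opp_hom f : {linear U -> V} :=
  HB.pack (fun u => - f u) (GRing.isLinear.Build R U V _ _ (opp_hom_linear f)).

Fact zero_hom_linear : linear (fun _ : U => 0 : V).
Proof. by move=> a u v; rewrite scaler0 addr0. Qed.
Definition zero_hom : {linear U -> V} :=
  HB.pack (fun _ : U => 0 : V) (GRing.isLinear.Build R U V _ _ zero_hom_linear).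

Fact scale_hom_linear a f : linear (fun u => a *: f u).
Proof.
by move=> b u v; rewrite linearP scalerDr !scalerA [a * b]mulrC.
Qed.
Definition scale_hom a f : {linear U -> V} :=
  HB.pack (fun u => a *: f u) (GRing.isLinear.Build R U V _ _ (scale_hom_linear a f)).

Fact add_homA : associative add_hom.
Proof. by move=> f g h; apply: hom_ext => u /=; rewrite addrA. Qed.
Fact add_homC : commutative add_hom.
Proof. by move=> f g; apply: hom_ext => u /=; rewrite addrC. Qed.
Fact add0_hom : left_id zero_hom add_hom.
Proof. by move=> f; apply: hom_ext => u /=; rewrite add0r. Qed.
Fact addN_hom : left_inverse zero_hom opp_hom add_hom.
Proof. by move=> f; apply: hom_ext => u /=; rewrite addNr. Qed.
HB.instance Definition _ :=
  GRing.isZmodule.Build {linear U -> V} add_homA add_homC add0_hom addN_hom.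

Fact scale_homA a b f : scale_hom a (scale_hom b f) = scale_hom (a * b) f.
Proof. by apply: hom_ext => u /=; rewrite scalerA. Qed.
Fact scale1_hom : left_id 1 scale_hom.
Proof. by move=> f; apply: hom_ext => u /=; rewrite scale1r. Qed.
Fact scale_homDr : right_distributive scale_hom +%R.
Proof. by move=> a f g; apply: hom_ext => u /=; rewrite scalerDr. Qed.
Fact scale_homDl f : {morph scale_hom^~ f : a b / a + b}.
Proof. by move=> a b; apply: hom_ext => u /=; rewrite scalerDl. Qed.
HB.instance Definition _ := GRing.Zmodule_isLmodule.Build R {linear U -> V}
  scale_homA scale1_hom scale_homDr scale_homDl.
End HomModule.

Definition precomp (U U' V : lmodType R) (g : {linear U' -> U})
  (f : {linear U -> V}) : {linear U' -> V} := f \o g.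
Fact precomp_linear (U U' V : lmodType R) (g : {linear U' -> U}) : linear (@precomp U U' V g).
Proof. by move=> a f h; apply: hom_ext. Qed.
HB.instance Definition _ (U U' V : lmodType R) (g : {linear U' -> U}) := GRing.isLinear.Build R
  {linear U -> V} {linear U' -> V} _ _ (@precomp_linear U U' V g).
End Hom.

Section Resolutions.
Variable R : comPzRingType.

Definition projective (F : lmodType R) :=
  forall (U V : lmodType R) (p : {linear U -> V}) (f : {linear F -> V}),
    (forall v, exists u, p u = v) ->
    exists g : {linear F -> U}, forall u, p (g u) = f u.

Record proj_res (N : lmodType R) := ProjRes {
  pobj :> nat -> lmodType R;
  pdiff : forall k, {linear pobj k.+1 -> pobj k};
  paug : {linear pobj 0 -> N};
  pobj_proj : forall k, projective (pobj k);
  pdiffK : forall k u, pdiff k (pdiff k.+1 u) = 0;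
  paugK : forall u, paug (pdiff 0 u) = 0;
  paug_surj : forall w, exists u, paug u = w;
  paug_exact : forall u, paug u = 0 -> exists v, u = pdiff 0 v;
  pdiff_exact : forall k u, pdiff k u = 0 -> exists v, u = pdiff k.+1 v }.

Section HomComplex.
Variables (N : lmodType R) (F : proj_res N) (M : lmodType R).
Fact Hom_diffK k (f : {linear F k -> M}) :
  precomp (pdiff F k.+1) (precomp (pdiff F k) f) = 0.
Proof. by apply: hom_ext => u /=; rewrite pdiffK linear0. Qed.
Definition Hom_cochain : cochain R :=
  @Cochain R (fun k => {linear F k -> M}) (fun k => precomp (pdiff F k)) Hom_diffK.
End HomComplex.

Definition Ext N (F : proj_res N) (M : lmodType R) (i : int) : lmodType R :=
  cohom (Hom_cochain F M) i.

Fact Hom_cochain_mapP N N' (F : proj_res N) (F' : proj_res N') M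
    (g : forall k, {linear F' k -> F k}) :
  (forall k u, pdiff F k (g k.+1 u) = g k (pdiff F' k u)) ->
  forall k (f : Hom_cochain F M k),
    precomp (g k.+1) (cdiff (Hom_cochain F M) k f) =
    cdiff (Hom_cochain F' M) k (precomp (g k) f).
Proof. by move=> gd k f; apply: hom_ext => u /=; rewrite gd. Qed.

Definition Ext_map N N' (F : proj_res N) (F' : proj_res N') M
    (g : forall k, {linear F' k -> F k})
    (gd : forall k u, pdiff F k (g k.+1 u) = g k (pdiff F' k u)) i :
    {linear Ext F M i -> Ext F' M i} :=
  @cohom_map R (Hom_cochain F M) (Hom_cochain F' M) (fun k => precomp (g k))
    (Hom_cochain_mapP (M := M) gd) i.
End Resolutions.

Section Products.
Variables (R : pzRingType) (J : Type) (V : J -> lmodType R).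
Definition prodm := forall j, V j.
HB.instance Definition _ := gen_eqMixin prodm.
HB.instance Definition _ := gen_choiceMixin prodm.
Implicit Types f g : prodm.
Let add f g : prodm := fun j => f j + g j.
Let opp f : prodm := fun j => - f j.
Let zero : prodm := fun j => 0.
Let scale a f : prodm := fun j => a *: f j.
Fact prodm_addA : associative add.
Proof. by move=> f g h; apply: functional_extensionality_dep => j; apply: addrA. Qed.
Fact prodm_addC : commutative add.
Proof. by move=> f g; apply: functional_extensionality_dep => j; apply: addrC. Qed.
Fact prodm_add0 : left_id zero add.
Proof. by move=> f; apply: functional_extensionality_dep => j; apply: add0r. Qed.
Fact prodm_addN : left_inverse zero opp add.
Proof. by move=> f; apply: functional_extensionality_dep => j; apply: addNr. Qed.
HB.instance Definition _ :=
  GRing.isZmodule.Build prodm prodm_addA prodm_addC prodm_add0 prodm_addN.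
Fact prodm_scaleA a b f : scale a (scale b f) = scale (a * b) f.
Proof. by apply: functional_extensionality_dep => j; apply: scalerA. Qed.
Fact prodm_scale1 : left_id 1 scale.
Proof. by move=> f; apply: functional_extensionality_dep => j; apply: scale1r. Qed.
Fact prodm_scaleDr : right_distributive scale +%R.
Proof. by move=> a f g; apply: functional_extensionality_dep => j; apply: scalerDr. Qed.
Fact prodm_scaleDl f : {morph scale^~ f : a b / a + b}.
Proof. by move=> a b; apply: functional_extensionality_dep => j; apply: scalerDl. Qed.
HB.instance Definition _ := GRing.Zmodule_isLmodule.Build R prodm
  prodm_scaleA prodm_scale1 prodm_scaleDr prodm_scaleDl.
End Products.

(* The colimit of E 0 -> E 1 -> ...: sequences that are eventually compatible
   with the transition maps, modulo those that eventually vanish. The class of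
   e in E n is that of the sequence 0, ..., 0, e, t n e, t n.+1 (t n e), ... *)
Section Colimits.
Variables (R : pzRingType) (E : nat -> lmodType R).
Variable t : forall n, {linear E n -> E n.+1}.

Definition ev_compat (e : prodm E) :=
  exists m, forall n, (m <= n)%N -> e n.+1 = t n (e n).
Definition ev_zero (e : prodm E) := exists m, forall n, (m <= n)%N -> e n = 0.

Fact ev_compat0 : ev_compat 0.
Proof. by exists 0 => n _; rewrite [RHS]linear0. Qed.
Fact ev_compat_lin a e e' :
  ev_compat e -> ev_compat e' -> ev_compat (a *: e + e').
Proof.
move=> [m em] [m' em']; exists (maxn m m') => n; rewrite geq_max => /andP[mn m'n].
by rewrite [RHS]linearP -em // -em'.
Qed.
Fact ev_zero0 : ev_zero 0. Proof. by exists 0. Qed.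
Fact ev_zero_lin a e e' : ev_zero e -> ev_zero e' -> ev_zero (a *: e + e').
Proof.
move=> [m em] [m' em']; exists (maxn m m') => n; rewrite geq_max => /andP[mn m'n].
have -> : (a *: e + e') n = a *: e n + e' n by [].
by rewrite em // em' // scaler0 addr0.
Qed.
Definition compat_seq : submodClosed (prodm E) := submod_of ev_compat0 ev_compat_lin.
Definition null_seq : submodClosed (prodm E) := submod_of ev_zero0 ev_zero_lin.
Definition colim : lmodType R := subquot compat_seq null_seq.

(* The elements represented by a sequence with all its terms in [hE]. *)
Definition colim_rep (hE : forall n, E n -> Prop) (c : colim) :=
  exists2 e : subm compat_seq, subclass _ _ e = c & forall n, hE n (val e n).
End Colimits.

Section LocalCohomology.
Variable R : comPzRingType.

Definition ideal := submodClosed (R : pzRingType)^o.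

Definition ideal_mul (I J : ideal) : ideal :=
  spanm (fun c : R^o => exists a b : R, [/\ (a : R^o) \in I, (b : R^o) \in J & c = a * b]).

Definition ideal_pow (I : ideal) (n : nat) : ideal :=
  iter n (ideal_mul I) (spanm (fun _ => True)).

Definition noetherian := forall J : ideal,
  exists s : seq R, forall a : R^o, (a \in J) = (a \in spanm (fun b : R^o => b \in s)).

(* Projective resolutions of the R / I^n, with liftings of the projections
   R / I^(n+1) -> R / I^n. Up to isomorphism, the local cohomology below does
   not depend on this choice, which is kept as a parameter. *)
Record ext_tower (I : ideal) := ExtTower {
  tres :> forall n, proj_res (quotm (ideal_pow I n));
  tlift : forall n k, {linear tres n.+1 k -> tres n k};
  tlift_diff : forall n k u,
    pdiff (tres n) k (tlift n k.+1 u) = tlift n k (pdiff (tres n.+1) k u);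
  tlift_aug : forall n u (a : R^o),
    paug (tres n.+1) u = pim _ a -> paug (tres n) (tlift n 0 u) = pim _ a }.

(* H^i_I(M) = colim_n Ext^i_R(R / I^n, M), zero for i < 0 *)
Definition loc_cohom (I : ideal) (F : ext_tower I) (M : lmodType R) (i : int) :
    lmodType R :=
  colim (fun n => Ext_map M (@tlift_diff I F n) i).
End LocalCohomology.

Section KrullDimension.
Variable A : comPzRingType.

Definition prime_ideal (p : ideal A) :=
  (1 : A^o) \notin p /\
  forall a b : A, (a * b : A^o) \in p -> (a : A^o) \in p \/ (b : A^o) \in p.

Definition prime_chain (n : nat) := exists p : nat -> ideal A,
  (forall i, (i <= n)%N -> prime_ideal (p i)) /\
  (forall i, (i < n)%N -> {subset p i <= p i.+1} /\ ~ {subset p i.+1 <= p i}).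

(* Least upper bound of the lengths of the chains of primes: -oo for the zero
   ring, +oo if there are chains of any length. *)
Definition is_krull_dim (d : \bar int) :=
  (forall n, prime_chain n -> (n%:Z%:E <= d)%O) /\
  (forall e : \bar int, (forall n, prime_chain n -> (n%:Z%:E <= e)%O) -> (d <= e)%O).
End KrullDimension.

(* Restriction of scalars along f *)
Definition restrict (A B : pzRingType) (f : {rmorphism A -> B})
  (M : lmodType B) : Type := M.

Section Restriction.
Variables (A B : pzRingType) (f : {rmorphism A -> B}) (M : lmodType B).
HB.instance Definition _ := GRing.Zmodule.copy (restrict f M) M.
Let scale (a : A) (u : restrict f M) : restrict f M := f a *: (u : M).
Fact restrict_scaleA a b u : scale a (scale b u) = scale (a * b) u.
Proof. by rewrite /scale scalerA rmorphM. Qed.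
Fact restrict_scale1 : left_id 1 scale.
Proof. by move=> u; rewrite /scale rmorph1 scale1r. Qed.
Fact restrict_scaleDr : right_distributive scale +%R.
Proof. by move=> a u v; rewrite /scale [LHS]scalerDr. Qed.
Fact restrict_scaleDl u : {morph scale^~ u : a b / a + b}.
Proof. by move=> a b; rewrite /scale rmorphD [LHS]scalerDl. Qed.
HB.instance Definition _ := GRing.Zmodule_isLmodule.Build A (restrict f M)
  restrict_scaleA restrict_scale1 restrict_scaleDr restrict_scaleDl.
End Restriction.

(* A commutative K-algebra, given by its structure map. MathComp's [comAlgType]
   excludes the zero ring, which is the ring of sections on the empty set. *)
Record kalg (K : fieldType) := KAlg {
  kring :> comPzRingType;
  kstr : {rmorphism K -> kring} }.

Definition kmod (K : fieldType) (A : kalg K) (M : lmodType A) : lmodType K :=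
  restrict (kstr A) M.

Section Opens.
Variables (disp : Order.disp_t) (P : finPOrderType disp).

Record opens := Opens {
  oset :> {set P};
  oset_lower : [forall y in oset, forall x, (x <= y)%O ==> (x \in oset)] }.

Lemma opensP (U : {set P}) :
  reflect (forall x y, y \in U -> (x <= y)%O -> x \in U)
          [forall y in U, forall x, (x <= y)%O ==> (x \in U)].
Proof.
apply: (iffP forall_inP) => [UP x y yU | UP y yU].
  by move/forallP/(_ x)/implyP: (UP y yU); apply.
by apply/forallP => x; apply/implyP; apply: UP.
Qed.

Fact whole_lower : [forall y in [set: P], forall x, (x <= y)%O ==> (x \in [set: P])].
Proof. by apply/opensP => x y _ _; rewrite inE. Qed.
Definition whole : opens := Opens whole_lower.

Fact down_lower (z : P) : [forall y in [set x : P | (x <= z)%O], forall x,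
  (x <= y)%O ==> (x \in [set x : P | (x <= z)%O])].
Proof. by apply/opensP => x y; rewrite !inE => yz xy; apply: le_trans yz. Qed.
Definition down (z : P) : opens := Opens (down_lower z).

Fact openI_lower (U V : opens) : [forall y in U :&: V, forall x,
  (x <= y)%O ==> (x \in U :&: V)].
Proof.
apply/opensP => x y; rewrite !inE => /andP[yU yV] xy.
by rewrite (opensP _ (oset_lower U) x y) ?(opensP _ (oset_lower V) x y).
Qed.
Definition openI (U V : opens) : opens := Opens (openI_lower U V).
End Opens.
Arguments whole {disp} P.

Section Sheaves.
Variables (disp : Order.disp_t) (P : finPOrderType disp) (K : fieldType).

Record presheaf := Presheaf {
  sec :> opens P -> lmodType K;
  res : forall U V : opens P, V \subset U -> {linear sec U -> sec V};
  res_id : forall (U : opens P) (UU : U \subset U) s, res UU s = s;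
  res_comp : forall (U V W : opens P) (VU : V \subset U) (WV : W \subset V)
    (WU : W \subset U) s, res WV (res VU s) = res WU s }.

Definition is_sheaf (F : presheaf) :=
  forall (U : opens P) (J : Type) (V : J -> opens P) (VU : forall j, V j \subset U),
    (forall x, x \in U -> exists j, x \in V j) ->
  forall s : (forall j, F (V j)),
    (forall j k, res F (subsetIl (V j) (V k) : openI (V j) (V k) \subset V j) (s j) =
                 res F (subsetIr (V j) (V k) : openI (V j) (V k) \subset V k) (s k)) ->
  exists! t : F U, forall j, res F (VU j) t = s j.

Record sheaf := Sheaf { sheaf_presheaf :> presheaf; sheafP : is_sheaf sheaf_presheaf }.

(* Sheaves of K-vector spaces: [sheaf_hom] and [injective_sheaf] refer to
   this category, in which the monomorphisms are the maps that are injective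
   on all sections. *)
Record sheaf_hom (F G : presheaf) := SheafHom {
  shom :> forall U, {linear F U -> G U};
  shom_res : forall (U V : opens P) (VU : V \subset U) s, shom V (res F VU s) = res G VU (shom U s) }.

Definition injective_sheaf (J : sheaf) :=
  forall (A B : sheaf) (m : sheaf_hom A B) (f : sheaf_hom A J),
    (forall U, injective (m U)) ->
    exists g : sheaf_hom B J, forall U s, g U (m U s) = f U s.

(* Exactness is required on the stalks, that is on the sections on the
   minimal open neighbourhoods [down x]. *)
Record inj_res (F : presheaf) := InjRes {
  iobj :> nat -> sheaf;
  iaug : sheaf_hom F (iobj 0);
  idiff : forall k, sheaf_hom (iobj k) (iobj k.+1);
  iobj_inj : forall k, injective_sheaf (iobj k);
  iaugK : forall U s, idiff 0 U (iaug U s) = 0;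
  idiffK : forall k U s, idiff k.+1 U (idiff k U s) = 0;
  iaug_inj : forall x, injective (iaug (down x));
  iaug_exact : forall x s, idiff 0 (down x) s = 0 -> exists t, s = iaug (down x) t;
  idiff_exact : forall k x s, idiff k.+1 (down x) s = 0 ->
    exists t, s = idiff k (down x) t }.

Section GlobalSections.
Variables (F : presheaf) (J : inj_res F).
Definition global_cochain : cochain K :=
  @Cochain K (fun k => J k (whole P)) (fun k => idiff J k (whole P))
    (fun k => @idiffK F J k (whole P)).
(* The sheaf cohomology H^i(P, F), computed with the injective resolution J *)
Definition sheaf_cohom (i : int) : lmodType K := cohom global_cochain i.
End GlobalSections.

Record alg_presheaf := AlgPresheaf {
  asec :> opens P -> kalg K;
  ares : forall U V : opens P, V \subset U -> {rmorphism asec U -> asec V};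
  ares_str : forall (U V : opens P) (VU : V \subset U) a, ares VU (kstr (asec U) a) = kstr (asec V) a;
  ares_id : forall (U : opens P) (UU : U \subset U) s, ares UU s = s;
  ares_comp : forall (U V W : opens P) (VU : V \subset U) (WV : W \subset V)
    (WU : W \subset U) s, ares WV (ares VU s) = ares WU s }.

Section Underlying.
Variable T : alg_presheaf.
Definition usec (U : opens P) : lmodType K := kmod (A := T U) (T U : pzRingType)^o.
Section Res.
Variables (U V : opens P) (VU : V \subset U).
Fact ures_linear : linear (ares T VU : usec U -> usec V).
Proof.
move=> a u v; rewrite [LHS]rmorphD; congr (_ + _).
by rewrite [LHS]rmorphM ares_str.
Qed.
Definition ures : {linear usec U -> usec V} :=
  HB.pack (ares T VU : usec U -> usec V)
    (GRing.isLinear.Build K (usec U) (usec V) _ _ ures_linear).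
End Res.
Definition mod_presheaf : presheaf :=
  @Presheaf usec ures (@ares_id T) (@ares_comp T).
End Underlying.

Record alg_sheaf := AlgSheaf {
  alg_sheaf_presheaf :> alg_presheaf;
  alg_sheafP : is_sheaf (mod_presheaf alg_sheaf_presheaf) }.

(* The stalk T_x = T({z | z <= x}) as a module over the global sections *)
Definition stalk_mod (T : alg_presheaf) (x : P) : lmodType (T (whole P)) :=
  restrict (ares T (subsetT (down x) : down x \subset whole P))
    (T (down x) : pzRingType)^o.
End Sheaves.

Section OrderComplex.
Variables (disp : Order.disp_t) (P : finPOrderType disp) (K : fieldType).
Variable Q : {set P}.

Definition is_face (n : nat) (S : {set P}) :=
  [&& S \subset Q, #|S| == n & [forall s in S, forall t in S, (s <= t)%O || (t <= s)%O]].

(* The faces of the order complex of Q with n vertices *)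
Definition face n := {S : {set P} | is_face n S}.

Definition fcochain n : lmodType K := {ffun face n -> K^o}.

Definition fval n (f : fcochain n) (S : {set P}) : K := oapp f 0 (insub S).

(* The vertices of a face are ordered by the order of P. *)
Definition fpos (S : {set P}) (s : P) := #|[set t in S | (t < s)%O]|.

Definition fdiff n (f : fcochain n) : fcochain n.+1 :=
  [ffun S : face n.+1 => \sum_(s in val S) (-1) ^+ fpos (val S) s * fval f (val S :\ s)].

Fact fval_diff n (f : fcochain n) S : is_face n.+1 S ->
  fval (fdiff f) S = \sum_(s in S) (-1) ^+ fpos S s * fval f (S :\ s).
Proof. by move=> FS; rewrite {1}/fval insubT /= ffunE. Qed.

Fact is_faceD1 n (S : {set P}) s : is_face n.+1 S -> s \in S -> is_face n (S :\ s).
Proof.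
case/and3P=> SQ Sn /forall_inP Sc sS; apply/and3P; split.
- exact: subset_trans (subD1set _ _) SQ.
- by move: Sn; rewrite (cardsD1 s S) sS.
- apply/forall_inP => t; rewrite !inE => /andP[_ tS].
  apply/forall_inP => u; rewrite !inE => /andP[_ uS].
  by have /forall_inP := Sc _ tS; apply.
Qed.

Fact fpos_D1 (S : {set P}) s t : (s < t)%O -> fpos (S :\ t) s = fpos S s.
Proof.
move=> st; apply: eq_card => u; rewrite !inE.
by case: (eqVneq u t) => //= ->; rewrite (lt_gtF st) andbF.
Qed.

Fact fpos_D1_gt (S : {set P}) s t : s \in S -> (s < t)%O ->
  fpos S t = (fpos (S :\ s) t).+1.
Proof.
move=> sS st; rewrite /fpos (cardsD1 s) !inE sS st add1n; congr _.+1.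
by apply: eq_card => u; rewrite !inE andbA.
Qed.

Lemma fdiffK n (f : fcochain n) : fdiff (fdiff f) = 0.
Proof.
apply/ffunP => -[S FS]; rewrite !ffunE /=.
pose G s t := (-1) ^+ fpos S s * ((-1) ^+ fpos (S :\ s) t * fval f (S :\ s :\ t)).
transitivity (\sum_(s in S) \sum_(t in S | t != s) G s t).
  apply: eq_bigr => s sS; rewrite fval_diff ?is_faceD1 // mulr_sumr.
  by apply: eq_bigl => t; rewrite !inE andbC.
have Sc s t : s \in S -> t \in S -> t != s -> (s < t)%O = ~~ (t < s)%O.
  case/and3P: FS => _ _ /forall_inP Sc sS tS ts.
  have /forall_inP/(_ _ tS) := Sc _ sS.
  rewrite !lt_neqAle ts eq_sym ts /=.
  case/orP=> le1; first by rewrite le1; apply/esym/negP => le2;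
    move: ts; rewrite eq_le le1 le2.
  by rewrite le1; apply/negP => le2; move: ts; rewrite eq_le le1 le2.
transitivity (\sum_(s in S) \sum_(t in S | (t < s)%O) (G s t + G t s)).
  under [RHS]eq_bigr do rewrite big_split /=.
  rewrite big_split /= [X in _ = _ + X](exchange_big_dep (mem S)) /=; last first.
    by move=> s t _ /andP[].
  rewrite -big_split /=; apply: eq_bigr => s sS.
  rewrite (bigID (fun t => (t < s)%O)) /=; congr (_ + _); apply: eq_bigl => t.
    by rewrite -andbA; case: (boolP (t \in S)) => //= tS; case: (eqVneq t s) => //= ->;
       rewrite ltxx.
  rewrite sS /= -andbA; case: (boolP (t \in S)) => //= tS.
  by case: (eqVneq t s) => [->|ts] /=; rewrite ?ltxx // Sc.
apply: big1 => s sS; apply: big1 => t /andP[tS ts].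
rewrite /G (fpos_D1 S ts) (fpos_D1_gt tS ts).
have -> : S :\ t :\ s = S :\ s :\ t by apply/setP => u; rewrite !inE andbCA.
by rewrite exprS !mulN1r !mulNr !mulrA [_ ^+ fpos _ s * _]mulrC addNr.
Qed.

Fact fdiff_linear n : linear (@fdiff n).
Proof.
have fvalP a f g S : @fval n (a *: f + g) S = a * fval f S + fval g S.
  by rewrite /fval; case: insub => [F|] /=; rewrite ?ffunE ?mulr0 ?addr0.
move=> a f g; apply/ffunP => S; rewrite !ffunE /= [X in _ = X + _]mulr_sumr -big_split.
by apply: eq_bigr => s _; rewrite fvalP mulrDr mulrCA.
Qed.
HB.instance Definition _ n := GRing.isLinear.Build K (fcochain n) (fcochain n.+1)
  _ (@fdiff n) (@fdiff_linear n).

(* The augmented cochain complex, in degree n the faces of dimension n - 1;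
   in degree 0 there is the empty face. *)
Definition aug_cochain : cochain K := @Cochain K fcochain (fun n => @fdiff n) fdiffK.

(* Reduced cohomology of the order complex of Q *)
Definition red_cohom (j : int) : lmodType K := cohom aug_cochain (j + 1).
End OrderComplex.

Section Tensor.
Variables (K : fieldType) (V W : lmodType K).

Definition tensor_rel (r : {freeg (V * W) / K}) :=
  [\/ exists v v' w, r = << (v + v', w) >> - << (v, w) >> - << (v', w) >>,
      exists v w w', r = << (v, w + w') >> - << (v, w) >> - << (v, w') >>,
      exists a v w, r = << (a *: v, w) >> - a *: << (v, w) >>
    | exists a v w, r = << (v, a *: w) >> - a *: << (v, w) >>].

Definition tensor : lmodType K := quotm (spanm tensor_rel).

Definition tens (v : V) (w : W) : tensor := pim _ (<< (v, w) >> : {freeg (V * W) / K}).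
End Tensor.

Section Gradings.
Variable d : nat.
Notation deg := ('rV[int]_d).

(* V is the internal direct sum of the additive subgroups grad a. *)
Record grading (V : zmodType) := Grading {
  grad :> deg -> V -> Prop;
  grad0 : forall a, grad a 0;
  gradB : forall a u v, grad a u -> grad a v -> grad a (u - v);
  grad_sum : forall v, exists (s : seq deg) (c : deg -> V),
    (forall a, grad a (c a)) /\ v = \sum_(a <- s) c a;
  grad_indep : forall (s : seq deg) (c : deg -> V), uniq s ->
    (forall a, grad a (c a)) -> \sum_(a <- s) c a = 0 -> forall a, a \in s -> c a = 0 }.

Record alg_grading (K : fieldType) (A : kalg K) := AlgGrading {
  alg_grad :> grading A;
  alg_gradZ : forall a (k : K) u, alg_grad a u -> alg_grad a (kstr A k * u);
  alg_gradM : forall a b u v, alg_grad a u -> alg_grad b v -> alg_grad (a + b) (u * v) }.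

Definition graded_ideal (A : comPzRingType) (G : grading A) (I : ideal A) :=
  forall u : A, (u : A^o) \in I -> exists (s : seq deg) (c : deg -> A),
    [/\ forall a, G a (c a), forall a, (c a : A^o) \in I & u = \sum_(a <- s) c a].

Record sheaf_grading (disp : Order.disp_t) (P : finPOrderType disp) (K : fieldType)
    (T : alg_presheaf P K) := SheafGrading {
  sheaf_grad :> forall U, alg_grading (T U);
  sheaf_grad_res : forall (U V : opens P) (VU : V \subset U) a s,
    sheaf_grad U a s -> sheaf_grad V a (ares T VU s) }.

Section Cohomology.
Variables (A : comPzRingType) (GA : grading A) (I : ideal A) (F : ext_tower I).

(* Resolutions of the graded modules A / I^n by finitely generated graded
   projective modules, with maps of degree 0. Finite generation makes
   Hom(F n k, M) the direct sum of its graded components. *)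
Record tower_grading := TowerGrading {
  tower_grad :> forall n k, grading (F n k);
  tower_gradZ : forall n k a b r u, GA a r -> tower_grad n k b u ->
    tower_grad n k (a + b) (r *: u);
  tower_fg : forall n k, exists s : seq (F n k), forall u,
    u \in spanm (fun v => v \in s);
  tower_grad_diff : forall n k a u, tower_grad n k.+1 a u ->
    tower_grad n k a (pdiff (F n) k u);
  tower_grad_aug : forall n a u, tower_grad n 0 a u ->
    exists2 r : A, GA a r & paug (F n) u = pim _ (r : A^o);
  tower_grad_lift : forall n k a u, tower_grad n.+1 k a u ->
    tower_grad n k a (tlift F n k u) }.

Variables (GF : tower_grading) (M : lmodType A) (GM : deg -> M -> Prop).

Definition hom_deg (a : deg) n k (f : {linear F n k -> M}) :=
  forall b u, GF n k b u -> GM (a + b) (f u).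

(* The component of degree a of H^i_I(M) *)
Definition loc_cohom_deg (a : deg) (i : int) : loc_cohom F M i -> Prop :=
  colim_rep (fun n => @cohom_rep _ (Hom_cochain (F n) M) (fun k => @hom_deg a n k) i).
End Cohomology.
End Gradings.

Section Summands.
Variables (disp : Order.disp_t) (P : finPOrderType disp) (K : fieldType).
Variables (T : alg_presheaf P K) (I : ideal (T (whole P))) (F : ext_tower I).

Definition above (x : P) : {set P} := [set y | (x < y)%O].

(* The contribution of x, with e the dimension of the stalk at x. If e is
   infinite, or -oo (zero stalk), there is no H^e_I and the contribution is 0. *)
Definition summand (x : P) (i : int) (e : \bar int) : lmodType K :=
  match e with
  | r%:E => tensor (red_cohom K (above x) (i - r - 1))
                   (kmod (loc_cohom F (stalk_mod T x) r))
  | _ => zeromod K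
  end.

Definition summand_deg (d : nat) (G : sheaf_grading d T)
    (GF : tower_grading (G (whole P)) F) (a : 'rV[int]_d) (x : P) (i : int)
    (e : \bar int) : summand x i e -> Prop :=
  match e with
  | r%:E => fun u => u \in spanm (fun t =>
      exists (v : red_cohom K (above x) (i - r - 1))
             (w : kmod (loc_cohom F (stalk_mod T x) r)),
        @loc_cohom_deg d _ _ I F GF (stalk_mod T x) (G (down x)) a r w /\
        t = tens v w)
  | _ => fun _ => True
  end.
End Summands.

(* Main.v *)
(* Write [R] for the ring of global sections, [M_x] for the stalks and [d_x] for
   their dimensions. Products over chains of skyscraper sheaves give an injective
   resolution of the sheaf, so that its acyclicity makes the row

     R -> prod_x M_x -> prod_(x < y) M_x -> prod_(x < y < z) M_x -> ...

   exact. The functor [colim_n Hom(F_n q, -)] is exact, and applying it for all [q]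
   gives a double complex with exact rows, whose columns compute the local
   cohomology of [R] and of the stalks.

   Over the field [K], the complex of [M_x] is quasi-isomorphic to a subcomplex
   [Gp x] that vanishes below degree [d_x] and maps onto [H^(d_x)(M_x)] placed in
   degree [d_x]. Since [d] is strictly increasing, the transition maps respect
   these subcomplexes and induce zero on the quotients. Hence the local cohomology
   of [R] is that of a complex that splits as the sum over [x] of the augmented
   cochains of the order complex of [(x, 1)] with coefficients in [H^(d_x)(M_x)],
   shifted by [d_x + 1].

   The isomorphism is the linear relation defined by the total complex. The
   complements used over [K] are stable under a system of commuting projections,
   which in the graded case are the projections of the Hom modules onto their
   components; the isomorphism then commutes with these. *)

Require Import Defs.
From HB Require Import structures.
From mathcomp Require Import all_boot all_order all_algebra.
From mathcomp Require Import constructive_ereal.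
From mathcomp Require Import boolp freeg.
From mathcomp Require classical_sets.

Set Implicit Arguments.
Unset Strict Implicit.
Unset Printing Implicit Defensive.

Import Order.TTheory GRing.Theory Num.Theory.
Local Open Scope ring_scope.

(** * Linear relations and equivariant complements *)

(** The global sections are placed at a top element added to [P], the minimum of the empty chain; a
    row then consists of families [e] with [e S] in the module at the minimum of [S]. Exact rows
    make the total complex of all columns exact, the column of global sections included. The
    subcomplex [Gp] is taken to be zero in that column. Modulo [Gp] the columns over [P] are
    acyclic, so the quotient has the cohomology of the top column, and the isomorphism is the
    connecting map: a cocycle on the empty chain is extended to a family [g] whose total coboundary
    has values in [Gp], and this coboundary gives the image. A component at [x |: S] in column
    degree [d_x] has total degree [d_x + |S| + 1]; for the image of [H^i] this must be [i + 1], so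
    that [S] has [i - d_x] vertices and dimension [i - d_x - 1]. The extension [g] is far from
    unique, which is why the map is obtained from a relation and not from a formula. *)

Lemma in_submod (R : pzRingType) (V : lmodType R) (P : V -> Prop) (P0 : P 0)
    (Plin : forall a u v, P u -> P v -> P (a *: u + v)) v :
  reflect (P v) (v \in submod_of P0 Plin).
Proof. exact: asboolP. Qed.

Lemma submodN (R : pzRingType) (V : lmodType R) (S : submodClosed V) v :
  (- v \in S) = (v \in S).
Proof.
suff N u : u \in S -> - u \in S by apply/idP/idP => /N //; rewrite opprK.
by move=> Su; rewrite -scaleN1r rpredZ.
Qed.

Lemma submodB (R : pzRingType) (V : lmodType R) (S : submodClosed V) u v :
  u \in S -> v \in S -> u - v \in S.
Proof. by move=> Su Sv; rewrite rpredD // submodN. Qed.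

Lemma bijP (A B : Type) (f : A -> B) :
  injective f -> (forall b, exists a, f a = b) -> bijective f.
Proof.
move=> fI fS; have [g gK] := choice fS.
by exists g => // a; apply: fI.
Qed.

Definition mklin (R : pzRingType) (U V : lmodType R) (f : U -> V)
  (flin : linear f) : {linear U -> V} :=
  HB.pack f (GRing.isLinear.Build R U V _ f flin).

Section LinearRelations.
Variables (K : pzRingType) (V W : lmodType K) (r : V -> W -> Prop).
Hypothesis r_lin : forall k v w v' w',
  r v w -> r v' w' -> r (k *: v + v') (k *: w + w').
Hypothesis r_total : forall v, exists w, r v w.
Hypothesis r_fun0 : forall w, r 0 w -> w = 0.

Lemma linrel_fun v w w' : r v w -> r v w' -> w = w'.
Proof.
move=> vw vw'; apply/eqP; rewrite -subr_eq0; apply/eqP/r_fun0.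
by have := r_lin (-1) vw' vw; rewrite !scaleN1r addNr addrC.
Qed.

(** The values may be chosen freely, since [linrel_fun] shows that there is only one choice;
    linearity follows for the same reason. Maps defined through representatives, on colimits as on
    cohomology, are all obtained in this way. *)
Lemma fun_of_linrel : exists f : {linear V -> W}, forall v, r v (f v).
Proof.
have [f fP] := choice r_total.
have flin : linear f.
  by move=> k u v; apply: (linrel_fun (fP _)); apply: r_lin.
by exists (mklin flin).
Qed.

Lemma bij_of_linrel :
    (forall w, exists v, r v w) -> (forall v, r v 0 -> v = 0) ->
  exists2 f : {linear V -> W}, bijective f & forall v, r v (f v).
Proof.
move=> r_surj r_inj; have [f fP] := fun_of_linrel; exists f => //.
apply: bijP => [u v fuv | w].
  apply/eqP; rewrite -subr_eq0; apply/eqP/r_inj.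
  by have := fP (u - v); rewrite linearB fuv subrr.
by have [v vw] := r_surj w; exists v; apply: linrel_fun vw.
Qed.
End LinearRelations.

Section ProjectionSystems.
Variables (K : fieldType) (D : eqType).

(* An algebraic shadow of a grading: [p a] plays the role of the projection
   onto the component of degree [a], and every vector lies in the subspace
   spanned by its components. *)
Definition proj_system (V : lmodType K) (p : D -> {linear V -> V}) :=
  (forall a b v, p b (p a v) = if a == b then p a v else 0) /\
  (forall (S : submodClosed V) v, (forall a, p a v \in S) -> v \in S).

Definition stable (V : lmodType K) (p : D -> {linear V -> V}) (S : submodClosed V) :=
  forall a v, v \in S -> p a v \in S.

Section Complement.
Variables (V : lmodType K) (p : D -> {linear V -> V}) (B : submodClosed V).
Hypothesis pV : proj_system p.

(** Zorn's lemma for unions also asks about the empty chain, whose union is the empty set. Adding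
    zero by hand makes that set admissible. *)
Let with0 (X : V -> Prop) v := v = 0 \/ X v.
Let admissible (X : V -> Prop) :=
  [/\ forall k u v, with0 X u -> with0 X v -> with0 X (k *: u + v),
      forall a v, with0 X v -> with0 X (p a v)
    & forall v, with0 X v -> v \in B -> v = 0].

(** The complement is a maximal admissible subspace. If some component [w = p a v] were not in
    [B + C], adjoining the line of [w] would give a larger one: every [p b] fixes or kills [w], so
    the line is stable. By the second half of [proj_system], treating components is enough. *)
Lemma stable_complement : exists C : submodClosed V,
  [/\ stable p C, forall v, v \in B -> v \in C -> v = 0
    & forall v, exists b c, [/\ b \in B, c \in C & v = b + c]].
Proof.
have [|A [[Alin Ap AB] Amax]] := @classical_sets.Zorn_bigcup V admissible.
  move=> F Fadm Ftot; split.
  - move=> k u v [->|[X FX Xu]] [->|[Y FY Yv]].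
    + by left; rewrite scaler0 addr0.
    + by right; exists Y; rewrite // scaler0 add0r.
    + have [Xlin _ _] := Fadm _ FX.
      have [] := Xlin k u 0 (or_intror Xu) (or_introl erefl); first by left.
      by right; exists X.
    + have [Z FZ [Zu Zv]] : exists2 Z, F Z & Z u /\ Z v.
        by have [XY|YX] := Ftot X Y FX FY; [exists Y | exists X] => //; split=> //;
           [apply: XY | apply: YX].
      have [Zlin _ _] := Fadm _ FZ.
      have [] := Zlin k u v (or_intror Zu) (or_intror Zv); first by left.
      by right; exists Z.
  - move=> a v [->|[X FX Xv]]; first by left; rewrite linear0.
    have [_ Xp _] := Fadm _ FX.
    by have [->|Xpv] := Xp a v (or_intror Xv); [left | right; exists X].
  - move=> v [-> //|[X FX Xv]].
    by have [_ _ XB] := Fadm _ FX; apply: XB; right.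
pose C := submod_of (or_introl erefl : with0 A 0) Alin.
have Cp : stable p C by move=> a v /in_submod Cv; apply/in_submod/Ap.
have sum0 : exists b c, [/\ b \in B, c \in C & 0 = b + c].
  by exists 0, 0; rewrite !rpred0 addr0.
have sum_lin k u v :
    (exists b c, [/\ b \in B, c \in C & u = b + c]) ->
    (exists b c, [/\ b \in B, c \in C & v = b + c]) ->
  exists b c, [/\ b \in B, c \in C & k *: u + v = b + c].
  move=> [b [c [Bb Cc ->]]] [b' [c' [Bb' Cc' ->]]].
  exists (k *: b + b'), (k *: c + c').
  by rewrite !rpredD ?rpredZ // scalerDr addrACA.
exists C; split=> // [v Bv /in_submod Cv | v]; first exact: AB.
apply/(in_submod sum0 sum_lin)/pV.2 => a; apply/in_submod.
apply: contrapT => nBC; set w := p a v in nBC.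
have wfix b : p b w = w \/ p b w = 0.
  by rewrite /w pV.1; case: eqP; [left | right].
pose A' u := exists c k, c \in C /\ u = c + k *: w.
have A'0 : A' 0 by exists 0, 0; rewrite rpred0 scale0r addr0.
have w0A' u : with0 A' u -> A' u by case=> [->|].
apply: (Amax A'); last first; first split.
- move=> k u v0 /w0A' [c [l [Cc ->]]] /w0A' [c' [l' [Cc' ->]]].
  right; exists (k *: c + c'), (k * l + l').
  by rewrite rpredD ?rpredZ // !scalerDr scalerA scalerDl addrACA.
- move=> b u /w0A' [c [l [Cc ->]]]; right; rewrite linearD linearZ /=.
  have [->|->] := wfix b; first by exists (p b c), l; rewrite Cp.
  by exists (p b c), 0; rewrite Cp // scale0r scaler0.
- move=> u /w0A' [c [l [Cc ->]]] Bu.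
  have [l0|l0] := eqVneq l 0.
    by move: Cc Bu => /in_submod Ac; rewrite l0 scale0r addr0 => /(AB _ Ac).
  case: nBC; exists (l^-1 *: (c + l *: w)), (- (l^-1) *: c).
  rewrite !rpredZ //; split=> //.
  by rewrite scaleNr scalerDr addrAC subrr add0r scalerA mulVf // scale1r.
split=> [u Au|A'A].
  by exists u, 0; rewrite scale0r addr0; split=> //; apply/in_submod; right.
apply: nBC; exists 0, w; rewrite rpred0 add0r; split=> //.
apply/in_submod; right; apply: A'A; exists 0, 1.
by rewrite rpred0 add0r scale1r.
Qed.
End Complement.

(** [g w] is the unique [v] in a stable complement of the kernel such that [w - f v] lies in a
    stable complement of the image. Uniqueness makes [g] commute with the projections. *)
Lemma equiv_pseudo_inverse (V W : lmodType K) (pV : D -> {linear V -> V})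
    (pW : D -> {linear W -> W}) (f : {linear V -> W}) :
    proj_system pV -> proj_system pW -> (forall a v, f (pV a v) = pW a (f v)) ->
  exists g : {linear W -> V},
    (forall v, f (g (f v)) = f v) /\ (forall a w, g (pW a w) = pV a (g w)).
Proof.
move=> psV psW fp.
have [C [Cp Cker Csum]] := stable_complement (kerm f) psV.
have [E [Ep Eim Esum]] := stable_complement (imm f) psW.
pose r w v := v \in C /\ w - f v \in E.
have r_lin k w v w' v' : r w v -> r w' v' -> r (k *: w + w') (k *: v + v').
  move=> [Cv Ev] [Cv' Ev']; split; first by rewrite rpredD ?rpredZ.
  by rewrite linearP opprD addrACA -scalerBr rpredD ?rpredZ.
have r_fun0 v : r 0 v -> v = 0.
  move=> [Cv]; rewrite sub0r submodN => Efv; apply: Cker => //.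
  by apply/in_submod/Eim => //; apply/in_submod; exists v.
have r_total w : exists v, r w v.
  have [_ [e [/in_submod [v ->] Ee ->]]] := Esum w.
  have [b [c [/in_submod fb Cc ->]]] := Csum v; exists c; split=> //.
  by rewrite linearD fb add0r addrAC subrr add0r.
have [g gP] := fun_of_linrel r_lin r_total r_fun0.
exists g; split=> [v | a w].
  have [_ E0] := gP (f v); apply/esym/eqP; rewrite -subr_eq0; apply/eqP/Eim => //.
  by apply/in_submod; exists (v - g (f v)); rewrite linearB.
have [Cg Eg] := gP w; apply: (linrel_fun r_lin r_fun0 (gP _)).
by split; [exact: Cp | rewrite fp -linearB; exact: Ep].
Qed.
End ProjectionSystems.

(** The ungraded case is the graded one with the identity as its only projection. *)
Lemma proj_system_id (K : fieldType) (V : lmodType K) :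
  @proj_system K unit V (fun _ => idfun).
Proof. by split=> [[] [] v | S v /(_ tt)]. Qed.

Lemma pseudo_inverse (K : fieldType) (V W : lmodType K) (f : {linear V -> W}) :
  exists g : {linear W -> V}, forall v, f (g (f v)) = f v.
Proof.
have [//|g [gP _]] := equiv_pseudo_inverse (f := f) (proj_system_id V) (proj_system_id W).
by exists g.
Qed.

(** * Sequential colimits *)

Lemma fin_stage (I : finType) (Q : I -> nat -> Prop) :
    (forall i n m, Q i n -> (n <= m)%N -> Q i m) -> (forall i, exists n, Q i n) ->
  exists n, forall i, Q i n.
Proof.
move=> Qmono /choice[f fQ]; exists (\max_i f i)%N => i.
by apply: Qmono (fQ i) _; apply: leq_bigmax.
Qed.

Section Colimits.
Variables (R : pzRingType) (E : nat -> lmodType R).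
Variable t : forall n, {linear E n -> E n.+1}.

Let cast n m (u : E n) : E m :=
  if n =P m is ReflectT e then ecast k (E k) e u else 0.

Let castE n u : cast n u = u.
Proof. by rewrite /cast; case: eqP => // e; rewrite (eq_axiomK e). Qed.

Let cast_linear n m : linear (@cast n m).
Proof.
move=> a u v; rewrite /cast; case: eqP => [e|_]; last by rewrite scaler0 addr0.
by case: m / e.
Qed.

(* Only meaningful for [n <= m]. *)
Fixpoint raise_fun n m (u : E n) : E m :=
  if m is m'.+1 then
    if n == m'.+1 then cast m'.+1 u else t m' (raise_fun m' u)
  else cast 0 u.

Fact raise_linear n m : linear (@raise_fun n m).
Proof.
elim: m => [|m IHm] a u v /=; first exact: cast_linear.
by case: ifP => _; [apply: cast_linear | rewrite IHm linearP].
Qed.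

Definition raise n m : {linear E n -> E m} := mklin (@raise_linear n m).

Lemma raise_id n u : raise n n u = u.
Proof. by case: n u => [|n] u /=; rewrite ?eqxx castE. Qed.

Lemma raiseS n m u : (n <= m)%N -> raise n m.+1 u = t m (raise n m u).
Proof. by move=> nm /=; rewrite ltn_eqF. Qed.

Lemma raise_trans n m k u : (n <= m)%N -> (m <= k)%N ->
  raise m k (raise n m u) = raise n k u.
Proof.
move=> nm; elim: k => [|k IHk]; first by rewrite leqn0 => /eqP->; rewrite raise_id.
rewrite leq_eqVlt => /orP[/eqP<-|mk]; first by rewrite raise_id.
by rewrite raiseS // IHk // raiseS // (leq_trans nm).
Qed.

(** The default [0] before stage [n] is homogeneous of every degree; this matters because
    homogeneous elements of a colimit are represented by sequences that are homogeneous at all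
    stages. *)
Lemma raise_gt n m u : (m < n)%N -> raise n m u = 0.
Proof.
move=> mn; elim: m mn => [|m IHm] mn /=.
  by rewrite /cast; case: eqP => // n0; subst n.
by rewrite (gtn_eqF mn) [raise_fun m u](IHm (ltnW mn)) linear0.
Qed.

Fact raise_compat n u : (fun m => raise n m u : E m) \in compat_seq t.
Proof. by apply/asboolP; exists n => m nm; rewrite raiseS. Qed.

Fact cin_linear n :
  linear (fun u => subclass (compat_seq t) (null_seq E) (Subm (raise_compat (n:=n) u)) : colim t).
Proof.
move=> a u v; rewrite -linearP; congr (subclass _ _ _).
apply: val_inj; apply: functional_extensionality_dep => m /=.
exact: (linearP (raise n m)).
Qed.
Definition cin n : {linear E n -> colim t} := mklin (@cin_linear n).

Lemma subclass_eqP (V : lmodType R) (Z B : submodClosed V) (z z' : subm Z) :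
  subclass Z B z = subclass Z B z' <-> val z - val z' \in B.
Proof.
split=> [/eqP|zz']; first by rewrite pim_eq => /asboolP; rewrite raddfB.
by apply/eqP; rewrite pim_eq; apply/asboolP; rewrite raddfB.
Qed.

Lemma subclass_surj (V : lmodType R) (Z B : submodClosed V) (c : subquot Z B) :
  exists z, c = subclass Z B z.
Proof. by exists (reprm c); rewrite [RHS]reprmK. Qed.

Lemma subclass_eq0 (V : lmodType R) (Z B : submodClosed V) (z : subm Z) :
  subclass Z B z = 0 <-> val z \in B.
Proof. by rewrite -(linear0 (subclass Z B)) subclass_eqP subr0. Qed.

Lemma cin_tail (e : subm (compat_seq t)) m :
  (forall n, (m <= n)%N -> val e n.+1 = t n (val e n)) ->
  forall n, (m <= n)%N -> subclass _ _ e = cin n (val e n).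
Proof.
move=> em n mn; apply/subclass_eqP/asboolP; exists n => k.
have -> : (\val e - ((fun k => raise n k (\val e n)) : prodm E)) k =
  \val e k - raise n k (\val e n) by [].
elim: k => [|k IHk].
  by rewrite leqn0 => /eqP n0; subst n; rewrite raise_id subrr.
rewrite leq_eqVlt => /orP[/eqP<-|nk]; first by rewrite raise_id subrr.
by rewrite em ?(leq_trans mn) // raiseS // -linearB IHk // linear0.
Qed.

Lemma colim_cin (c : colim t) : exists n u, c = cin n u.
Proof.
have [e ->] := subclass_surj c.
have /asboolP[m em] := subm_valP e.
by exists m, (val e m); rewrite (cin_tail em (leqnn m)).
Qed.

Lemma cin_raise n m u : (n <= m)%N -> cin m (raise n m u) = cin n u.
Proof.
move=> nm; apply/subclass_eqP/asboolP; exists m => k mk /=.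
by rewrite [LHS](_ : _ = raise m k (raise n m u) - raise n k u) // raise_trans // subrr.
Qed.

Lemma cin_eq0 n u : cin n u = 0 ->
  exists m, (n <= m)%N /\ forall k, (m <= k)%N -> raise n k u = 0.
Proof.
move/subclass_eq0/asboolP => [m um]; exists (maxn n m); split; first exact: leq_maxl.
by move=> k; rewrite geq_max => /andP[_]; apply: um.
Qed.
End Colimits.

Section ColimitMap.
Variables (R : pzRingType) (E E' : nat -> lmodType R).
Variables (t : forall n, {linear E n -> E n.+1}).
Variables (t' : forall n, {linear E' n -> E' n.+1}).
Variables (phi : forall n, {linear E n -> E' n}).
Hypothesis phit : forall n u, phi n.+1 (t n u) = t' n (phi n u).

Lemma raise_map n m u : (n <= m)%N -> phi m (raise t n m u) = raise t' n m (phi n u).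
Proof.
elim: m => [|m IHm]; first by rewrite leqn0 => /eqP n0; subst n; rewrite !raise_id.
rewrite leq_eqVlt => /orP[/eqP<-|nm]; first by rewrite !raise_id.
by rewrite !raiseS // phit IHm.
Qed.

Let r (c : colim t) (c' : colim t') :=
  exists n u, c = cin t n u /\ c' = cin t' n (phi n u).

Fact colim_map_ex : exists f : {linear colim t -> colim t'},
  forall n u, f (cin t n u) = cin t' n (phi n u).
Proof.
have r_lin k v w v' w' : r v w -> r v' w' -> r (k *: v + v') (k *: w + w').
  move=> [n [u [-> ->]]] [n' [u' [-> ->]]].
  exists (maxn n n'), (k *: raise t n _ u + raise t n' _ u').
  by rewrite !linearP !raise_map ?cin_raise ?leq_maxl ?leq_maxr.
have r_total v : exists w, r v w.
  by have [n [u ->]] := colim_cin v; exists (cin t' n (phi n u)), n, u.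
have r_fun0 w : r 0 w -> w = 0.
  move=> [n [u [/esym/cin_eq0[m [nm um]] ->]]].
  by rewrite -(cin_raise t' _ nm) -raise_map // um // !linear0.
have [f fP] := fun_of_linrel r_lin r_total r_fun0; exists f => n u.
by apply: (linrel_fun r_lin r_fun0 (fP _)); exists n, u.
Qed.
Definition colim_map : {linear colim t -> colim t'} := sval (cid colim_map_ex).
Lemma colim_map_cin n u : colim_map (cin t n u) = cin t' n (phi n u).
Proof. exact: (svalP (cid colim_map_ex)). Qed.
End ColimitMap.

(** * Families indexed by chains *)

Section Chains.
Variables (disp : Order.disp_t) (P : finPOrderType disp).
Implicit Types (S : {set P}) (o : option P).

Definition chain S := [forall s in S, forall t in S, (s <= t)%O || (t <= s)%O].

(* The minimum of a chain; [None] stands for a top element added to [P], which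
   is the minimum of the empty chain. *)
Definition mn S : option P := [pick s in S | [forall t in S, (s <= t)%O]].

Definition ole o o' : bool :=
  match o, o' with
  | _, None => true
  | Some x, Some y => (x <= y)%O
  | None, Some _ => false
  end.

Lemma chainP S : reflect {in S &, forall s t, (s <= t)%O || (t <= s)%O} (chain S).
Proof.
apply: (iffP forall_inP) => [Sc s t sS tS | Sc s sS].
  by move/forall_inP: (Sc s sS); apply.
by apply/forall_inP => t tS; apply: Sc.
Qed.

Lemma chainS S S' : S' \subset S -> chain S -> chain S'.
Proof.
move=> /subsetP SS' /chainP Sc; apply/chainP => s t sS tS.
by apply: Sc; apply: SS'.
Qed.

Lemma chainD1 S s : chain S -> chain (S :\ s).
Proof. exact/chainS/subD1set. Qed.

Lemma chain0 : chain set0.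
Proof. by apply/chainP => s t; rewrite inE. Qed.

Lemma chain1 x : chain [set x].
Proof. by apply/chainP => s t; rewrite !inE => /eqP-> /eqP->; rewrite lexx. Qed.

Lemma mnP S x : reflect (x \in S /\ {in S, forall t, (x <= t)%O}) (mn S == Some x).
Proof.
rewrite /mn; case: pickP => [y /andP[yS /forall_inP yt] | no].
  apply: (iffP eqP) => [[<-] // | [xS xt]]; congr Some.
  by apply: le_anti; rewrite yt ?xt.
apply: (iffP eqP) => // -[xS xt]; move: (no x); rewrite xS /=.
by move/negbT/negP; case; apply/forall_inP.
Qed.

Lemma mn_eq S x : x \in S -> {in S, forall t, (x <= t)%O} -> mn S = Some x.
Proof. by move=> xS xt; apply/eqP/mnP. Qed.

Lemma mn0 : mn set0 = None.
Proof. by rewrite /mn; case: pickP => // x; rewrite inE. Qed.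

Lemma mn1 x : mn [set x] = Some x.
Proof. by apply: mn_eq => [|t]; rewrite inE // => /eqP->. Qed.

(** An element of [S] with the fewest predecessors in [S] is the minimum: an element strictly below
    it would have fewer. *)
Lemma mn_chain S : chain S -> S != set0 -> exists x, mn S = Some x.
Proof.
move=> /chainP Sc /set0Pn[z zS].
pose x := [arg min_(y < z in S) #|[set t in S | (t < y)%O]|]%N.
have [xS xmin] : x \in S /\ {in S, forall y,
    (#|[set t in S | (t < x)%O]| <= #|[set t in S | (t < y)%O]|)%N}.
  by rewrite /x; case: arg_minnP.
exists x; apply: mn_eq => // t tS.
have /orP[//|tx] := Sc _ _ xS tS; rewrite le_eqVlt -implyNb; apply/implyP => xt.
have {}tx : (t < x)%O by rewrite lt_neqAle eq_sym xt.
suff : (#|[set u in S | (u < t)%O]| < #|[set u in S | (u < x)%O]|)%N.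
  by rewrite ltnNge xmin.
apply/proper_card/properP; split.
  by apply/subsetP => u; rewrite !inE => /andP[-> /lt_trans]; apply.
by exists t; rewrite !inE ?tS ?tx ?ltxx ?andbF.
Qed.

Lemma mn_None S : chain S -> mn S = None -> S = set0.
Proof.
move=> Sc SN; apply/eqP; case: eqVneq => // /(mn_chain Sc)[x].
by rewrite SN.
Qed.

Lemma ole_refl o : ole o o. Proof. by case: o => /=. Qed.

Lemma ole_None o : ole o None. Proof. by case: o. Qed.

Lemma ole_mn S S' : chain S -> S' \subset S -> ole (mn S) (mn S').
Proof.
move=> Sc SS'; case: (eqVneq S' set0) => [->|S'0]; first by rewrite mn0 ole_None.
have [y Ey] := mn_chain (chainS SS' Sc) S'0.
have [/(subsetP SS') yS _] : y \in S' /\ {in S', forall t, (y <= t)%O}.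
  by apply/mnP/eqP.
have [|x Ex] := mn_chain Sc; first by apply/set0Pn; exists y.
have [_ xle] : x \in S /\ {in S, forall t, (x <= t)%O} by apply/mnP/eqP.
by rewrite Ex Ey /= xle.
Qed.

Lemma chain_face S : chain S -> is_face [set: P] #|S| S.
Proof. by move=> Sc; rewrite /is_face subsetT eqxx. Qed.

(** The signed number of ways to reach [S'] by deleting two vertices in succession. It is read off
    from [fdiffK] over the rationals, applied to the indicator cochain of [S']. As an identity of
    integers it can then be used with any scalars. *)
Lemma sign_cancel S (c := fun S' => \sum_(s in S) \sum_(t in S :\ s)
    ((-1) ^+ fpos S s * (-1) ^+ fpos (S :\ s) t *+ (S :\ s :\ t == S') : int)) :
  chain S -> forall S', c S' = 0.
Proof.
move=> Sc S'; apply/eqP; rewrite -(intr_eq0 rat); apply/eqP.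
case: (ltnP 1 #|S|) => [S1|S1]; last first.
  rewrite /c big1 ?rmorph0 // => s sS; apply: big1 => t.
  have : #|S :\ s| = 0%N by move: S1; rewrite (cardsD1 s S) sS ltnS leqn0 => /eqP.
  by move/cards0_eq => ->; rewrite inE.
have := chain_face Sc; case def_n: #|S| S1 => [|[|n]] // _ FS.
pose f : fcochain rat setT n := [ffun S'' => (val S'' == S')%:R].
have := congr1 (fun g => fval g S) (fdiffK f).
rewrite fval_diff // [RHS](_ : _ = 0); last by rewrite /fval insubT /= ffunE.
move=> E0; rewrite -[RHS]E0 /c rmorph_sum; apply: eq_bigr => s sS.
rewrite fval_diff ?is_faceD1 // mulr_sumr rmorph_sum; apply: eq_bigr => t tS.
have FSst : is_face setT n (S :\ s :\ t) by apply: (is_faceD1 _ tS); apply: is_faceD1.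
rewrite [fval f _]/fval insubT /= ffunE /= mulrA mulr_natr.
by rewrite rmorphMn rmorphM /= !rmorphXn /= rmorphN1.
Qed.

(** * Coboundaries with coefficients at the minimum of a chain *)

Section Delta.
Variables (R : pzRingType) (G : option P -> lmodType R).
Variable rho : forall o o', {linear G o' -> G o}.

(* Only the components [e S (mn S)] with [S] a chain are meaningful. *)
Definition fam := prodm (fun S : {set P} => prodm G).

(** Only the deletion of the minimum changes the coefficient module. The target index [o] is free,
    although only [o = mn S] matters, so that no transport along equalities of minima is needed. *)
Definition delta (e : fam) S o : G o :=
  \sum_(s in S) (-1) ^+ fpos S s *: rho o (mn (S :\ s)) (e (S :\ s) (mn (S :\ s))).

Lemma delta_ext e e' S o :
    (forall s, s \in S -> e (S :\ s) (mn (S :\ s)) = e' (S :\ s) (mn (S :\ s))) ->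
  delta e S o = delta e' S o.
Proof. by move=> ee'; apply: eq_bigr => s sS; rewrite ee'. Qed.

Lemma delta_linear S o : linear (fun e : fam => delta e S o).
Proof.
move=> a u v; rewrite scaler_sumr -big_split /=; apply: eq_bigr => s _.
by rewrite [X in rho _ _ X]/= linearP scalerDr !scalerA commr_sign.
Qed.

Lemma delta0 e : delta e set0 None = 0.
Proof. by rewrite /delta big_set0. Qed.
End Delta.

Section DeltaDelta.
Variables (K : comPzRingType) (G : option P -> lmodType K).
Variable rho : forall o o', {linear G o' -> G o}.
Hypothesis rho_comp : forall o o' o'' u, ole o o' -> ole o' o'' ->
  rho o o' (rho o' o'' u) = rho o o'' u.

(** By [rho_comp] the contribution of a double deletion depends only on the remaining chain, up to
    sign; grouping by that chain leaves the coefficients of [sign_cancel]. *)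
Lemma delta_delta (e : fam G) S : chain S ->
  delta rho (fun S o => delta rho e S o) S (mn S) = 0.
Proof.
move=> Sc; pose F S' := rho (mn S) (mn S') (e S' (mn S')).
pose sg S s : int := (-1) ^+ fpos S s.
transitivity (\sum_(s in S) \sum_(t in S :\ s) F (S :\ s :\ t) *~ (sg S s * sg (S :\ s) t)).
  apply: eq_bigr => s sS; rewrite linear_sum scaler_sumr; apply: eq_bigr => t tS.
  rewrite linearZ /= rho_comp ?ole_mn ?chainD1 ?subD1set // -/(F _) scalerA.
  by rewrite -scaler_int rmorphM /= !rmorphXn /= rmorphN1.
transitivity (\sum_(S' : {set P}) F S' *~ (\sum_(s in S) \sum_(t in S :\ s)
    (sg S s * sg (S :\ s) t *+ (S :\ s :\ t == S')))); last first.
  by apply: big1 => S' _; rewrite (sign_cancel Sc) mulr0z.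
under [RHS]eq_bigr => S' _.
  rewrite mulrz_sumr; under eq_bigr => s _ do rewrite mulrz_sumr; over.
rewrite exchange_big /=; apply: eq_bigr => s sS.
rewrite exchange_big /=; apply: eq_bigr => t tS.
rewrite (bigD1 (S :\ s :\ t)) //= eqxx mulr1n big1 ?addr0 // => S' ne.
by rewrite eq_sym (negPf ne) mulr0n mulr0z.
Qed.
End DeltaDelta.
End Chains.

Definition fullm (R : pzRingType) (V : lmodType R) : submodClosed V :=
  spanm (fun _ : V => True).

Lemma in_fullm (R : pzRingType) (V : lmodType R) (v : V) : v \in fullm V.
Proof. by apply/asboolP => M; apply. Qed.

(** * Total complexes of chain-indexed columns *)

Section Total.
Variables (disp : Order.disp_t) (P : finPOrderType disp) (K : comPzRingType).
Variables (G : option P -> lmodType K) (rho : forall o o', {linear G o' -> G o}).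
Variable d : forall o, {linear G o -> G o}.
Hypothesis rho_comp : forall o o' o'' u, ole o o' -> ole o' o'' ->
  rho o o' (rho o' o'' u) = rho o o'' u.
Hypothesis ddK : forall o u, d o (d o u) = 0.
Hypothesis rho_d : forall o o' u, ole o o' -> rho o o' (d o' u) = d o (rho o o' u).

Implicit Types (e g : fam G) (S : {set P}) (o : option P).

(** The sign makes the two parts anticommute. Here [G o] is a single module with a differential; in
    the application it is the product of all degrees of a column. *)
Definition tot e : fam G :=
  fun S o => (-1) ^+ #|S| *: d o (e S o) + delta rho e S o.

Fact tot_linear : linear tot.
Proof.
move=> a u v; apply: functional_extensionality_dep => S.
apply: functional_extensionality_dep => o.
have -> : (a *: tot u + tot v) S o = a *: tot u S o + tot v S o by [].
rewrite /tot delta_linear; have -> : (a *: u + v) S o = a *: u S o + v S o by [].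
by rewrite linearP !scalerDr addrACA !scalerA commr_sign.
Qed.
HB.instance Definition _ := GRing.isLinear.Build K (fam G) (fam G) _ tot tot_linear.

Lemma tot_set0 e : tot e set0 None = d None (e set0 None).
Proof. by rewrite /tot delta0 addr0 cards0 expr0 scale1r. Qed.

Lemma tot_tot e S : chain S -> tot (tot e) S (mn S) = 0.
Proof.
move=> Sc; rewrite {1}/tot {1}/tot linearD linearZ /= ddK scaler0 add0r.
have -> : delta rho (tot e) S (mn S) =
    (-1) ^+ #|S|.-1 *: d (mn S) (delta rho e S (mn S)).
  rewrite -[RHS]addr0 -(delta_delta rho_comp e Sc) linear_sum scaler_sumr.
  rewrite -big_split /=; apply: eq_bigr => s sS.
  rewrite linearD scalerDr; congr (_ + _).
  rewrite !linearZ /= rho_d ?ole_mn ?subD1set // [#|S|](cardsD1 s) sS /=.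
  by rewrite !scalerA commr_sign.
case: (eqVneq S set0) => [->|S0].
  by rewrite /delta big_set0 linear0 !scaler0 addr0.
by rewrite -card_gt0 in S0; rewrite -{1}(prednK S0) exprS mulN1r scaleNr addNr.
Qed.

(* Peeling off the largest chains first. *)
Lemma tot_exact :
    (forall n e, (forall S, chain S -> #|S| = n.+1 -> delta rho e S (mn S) = 0) ->
      exists g, forall S, chain S -> #|S| = n -> e S (mn S) = delta rho g S (mn S)) ->
  forall e, (forall S, chain S -> tot e S (mn S) = 0) ->
  exists g, forall S, chain S -> e S (mn S) = tot g S (mn S).
Proof.
move=> row e De.
have [k ek] : exists k, forall S, chain S -> (k <= #|S|)%N -> e S (mn S) = 0.
  by exists #|P|.+1 => S _; rewrite ltnNge max_card.
elim: k e De ek => [|k IHk] e De ek.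
  by exists 0 => S Sc; rewrite ek // (linear0 tot).
(* On chains with [k + 1] elements [e] vanishes, so that there the total cocycle condition is the
   row condition for the layer of size [k]. *)
have [S Sc Sk|g' g'P] := row k e.
  have := De S Sc.
  by rewrite /tot ek ?Sk // linear0 scaler0 add0r.
pose g1 : fam G := fun S o => if #|S|.+1 == k then g' S o else 0.
have g1P S : chain S -> #|S| = k -> delta rho g1 S (mn S) = e S (mn S).
  move=> Sc Sk; rewrite g'P //; apply: delta_ext => // s sS.
  by rewrite /g1; move: Sk; rewrite (cardsD1 s) sS add1n => ->; rewrite eqxx.
have [S Sc|S Sc kS|g2 g2P] := IHk (e - tot g1).
- have -> : tot (e - tot g1) S (mn S) = tot e S (mn S) - tot (tot g1) S (mn S).
    by rewrite (linearB tot).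
  by rewrite De // tot_tot // subr0.
- have -> : (e - tot g1) S (mn S) = e S (mn S) - tot g1 S (mn S) by [].
  rewrite /tot /g1 gtn_eqF ?ltnS // linear0 scaler0 add0r.
  move: kS; rewrite leq_eqVlt => /orP[/eqP kS|kS]; first by rewrite g1P // subrr.
  rewrite ek // sub0r /delta big1 ?oppr0 // => s sS.
  rewrite ifN ?linear0 ?scaler0 //; apply: contraTneq kS => kS.
  by rewrite -leqNgt -kS [in X in (X <= _)%N](cardsD1 s) sS.
exists (g1 + g2) => S Sc; rewrite (linearD tot).
have -> : (tot g1 + tot g2) S (mn S) = tot g1 S (mn S) + tot g2 S (mn S) by [].
by rewrite -g2P // addrC [X in X + _](_ : _ = e S (mn S) - tot g1 S (mn S)) // subrK.
Qed.

(* Peeling off the smallest chains first. *)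
Lemma tot_exact_subquot (A B : forall o, submodClosed (G o)) (e : fam G) :
    (forall o u, u \in B o -> u \in A o) ->
    (forall o u, u \in A o -> d o u \in A o) ->
    (forall o u, u \in B o -> d o u \in B o) ->
    (forall o o' u, ole o o' -> u \in A o' -> rho o o' u \in A o) ->
    (forall o o' u, ole o o' -> u \in B o' -> rho o o' u \in B o) ->
    (forall x u, u \in A (Some x) -> d _ u \in B (Some x) ->
      exists2 v, v \in A (Some x) & u - d _ v \in B (Some x)) ->
    (forall S, chain S -> e S (mn S) \in A (mn S)) ->
    (forall S, chain S -> tot e S (mn S) \in B (mn S)) ->
    e set0 None \in B None ->
  exists g : fam G, [/\ g set0 None = 0, forall S, chain S -> g S (mn S) \in A (mn S)
    & forall S, chain S -> e S (mn S) - tot g S (mn S) \in B (mn S)].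
Proof.
move=> BA dA dB rhoA rhoB acyc.
have deltaA (f : fam G) S : chain S -> (forall S, chain S -> f S (mn S) \in A (mn S)) ->
    delta rho f S (mn S) \in A (mn S).
  move=> Sc fA; apply: rpred_sum => s sS; apply: rpredZ.
  by apply: rhoA; rewrite ?fA ?chainD1 // ole_mn ?subD1set.
(* [k] counts the layers still to be corrected: [e] lies in [B] on chains with fewer than
   [#|P| + 2 - k] elements. For [k = #|P| + 1] these are just the empty chain, where no acyclicity
   is available; for [k = 0] they are all chains. *)
suff H k : forall e : fam G, (forall S, chain S -> e S (mn S) \in A (mn S)) ->
    (forall S, chain S -> tot e S (mn S) \in B (mn S)) ->
    (forall S, chain S -> (#|S| < #|P|.+2 - k)%N -> e S (mn S) \in B (mn S)) ->
    (k <= #|P|.+1)%N ->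
  exists g : fam G, [/\ g set0 None = 0, forall S, chain S -> g S (mn S) \in A (mn S)
    & forall S, chain S -> e S (mn S) - tot g S (mn S) \in B (mn S)].
  move=> eA De e0; apply: (H #|P|.+1) => // S Sc.
  by rewrite subSnn ltnS leqn0 => /eqP/cards0_eq->; rewrite mn0.
elim: k => [|k IHk] {}e eA De eB kP.
  exists 0; split=> // S Sc; first exact: rpred0.
  rewrite (linear0 tot) [X in X \in _](_ : _ = e S (mn S)); last exact: subr0.
  by rewrite eB // subn0 ltnS (leq_trans (max_card _)).
pose m := (#|P|.+1 - k)%N.
have m_gt0 : (0 < m)%N by rewrite subn_gt0.
have mE : (#|P|.+2 - k.+1 = m)%N by rewrite subSS.
have vP S : exists v : prodm G, chain S -> #|S| = m ->
    v (mn S) \in A (mn S) /\ e S (mn S) - d (mn S) (v (mn S)) \in B (mn S).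
  have [Sc|] := boolP (chain S); last by exists 0.
  have [Sm|/eqP Sm] := eqVneq #|S| m; last by exists 0.
  have [|x Ex] := mn_chain Sc; first by rewrite -card_gt0 Sm.
  have := eA S Sc; have := De S Sc; rewrite /tot Ex => DeS eAS.
  have deB : d (Some x) (e S (Some x)) \in B (Some x).
    rewrite -[X in X \in _](signrZK #|S|) rpredZ //.
    rewrite -[X in X \in _](addrK (delta rho e S (Some x))) submodB // -Ex.
    apply: rpred_sum => s sS; apply/rpredZ/rhoB; first by rewrite ole_mn ?subD1set.
    by apply: eB; rewrite ?chainD1 // mE -Sm [in X in (_ < X)%N](cardsD1 s) sS.
  have [v vA vB] := acyc x _ eAS deB.
  exists (fun o => if o =P Some x is ReflectT E then ecast i (G i) (esym E) v else 0).
  by case: eqP => // E; rewrite (eq_axiomK E).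
have [v {}vP] := choice vP.
(* The sign cancels the one in [tot], and [m > 0] keeps [g1] zero on the empty chain. *)
pose g1 : fam G := fun S o => if #|S| == m then (-1) ^+ #|S| *: v S o else 0.
have g1A S : chain S -> g1 S (mn S) \in A (mn S).
  rewrite /g1; case: eqP => [Sm Sc|]; last by rewrite rpred0.
  by rewrite rpredZ //; case: (vP S Sc Sm).
have Dg1A S : chain S -> tot g1 S (mn S) \in A (mn S).
  by move=> Sc; rewrite rpredD ?rpredZ ?dA ?g1A // deltaA.
have [||||g2 [g20 g2A g2P]] := IHk (e - tot g1).
- by move=> S Sc; apply: submodB; [apply: eA | apply: Dg1A].
- move=> S Sc; have -> : tot (e - tot g1) S (mn S) = tot e S (mn S) - tot (tot g1) S (mn S).
    by rewrite (linearB tot).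
  by rewrite tot_tot // subr0 De.
- move=> S Sc; rewrite (subSn (ltnW kP)) -/m ltnS => Sm.
  have -> : (e - tot g1) S (mn S) = e S (mn S) - tot g1 S (mn S) by [].
  have -> : tot g1 S (mn S) = (-1) ^+ #|S| *: d (mn S) (g1 S (mn S)).
    rewrite [LHS]/tot [X in _ + X]big1 ?addr0 // => s sS; rewrite /g1.
    rewrite ifN ?linear0 ?scaler0 //; apply: contraTneq Sm => Sm.
    by rewrite -ltnNge -Sm [in X in (_ < X)%N](cardsD1 s) sS.
  rewrite /g1; move: Sm; rewrite leq_eqVlt => /orP[/eqP Sm|Sm].
    by rewrite Sm eqxx [d _ _]linearZ /= signrZK; case: (vP S Sc Sm).
  by rewrite ltn_eqF // linear0 scaler0 subr0 eB // mE.
- exact: ltnW.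
exists (g1 + g2); split.
- have -> : (g1 + g2) set0 None = g1 set0 None + g2 set0 None by [].
  by rewrite g20 /g1 cards0 ltn_eqF // addr0.
- move=> S Sc; have -> : (g1 + g2) S (mn S) = g1 S (mn S) + g2 S (mn S) by [].
  by rewrite rpredD ?g1A ?g2A.
- move=> S Sc; rewrite (linearD tot).
  have -> : e S (mn S) - (tot g1 + tot g2) S (mn S) =
    (e - tot g1) S (mn S) - tot g2 S (mn S) by rewrite opprD addrA.
  exact: g2P.
Qed.
End Total.

(** * The connecting map of the exact total complex *)

Section Core.
Variables (disp : Order.disp_t) (P : finPOrderType disp) (K : comPzRingType).
Variables (G : option P -> lmodType K) (rho : forall o o', {linear G o' -> G o}).
Variable d : forall o, {linear G o -> G o}.
Hypothesis rho_id : forall o u, rho o o u = u.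
Hypothesis rho_comp : forall o o' o'' u, ole o o' -> ole o' o'' ->
  rho o o' (rho o' o'' u) = rho o o'' u.
Hypothesis ddK : forall o u, d o (d o u) = 0.
Hypothesis rho_d : forall o o' u, ole o o' -> rho o o' (d o' u) = d o (rho o o' u).
Hypothesis rows_exact : forall n (e : fam G),
  (forall S, chain S -> #|S| = n.+1 -> delta rho e S (mn S) = 0) ->
  exists g, forall S, chain S -> #|S| = n -> e S (mn S) = delta rho g S (mn S).
Variables (Gp : forall o, submodClosed (G o)) (M : P -> lmodType K).
Variable s : forall x, {linear G (Some x) -> M x}.
Hypothesis Gp0 : forall u, u \in Gp None -> u = 0.
Hypothesis Gp_d : forall o u, u \in Gp o -> d o u \in Gp o.
Hypothesis Gp_rho : forall x y u, (x < y)%O -> u \in Gp (Some y) ->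
  rho (Some x) (Some y) u \in Gp (Some x).
Hypothesis Gp_qis : forall x u, d (Some x) u \in Gp (Some x) ->
  exists v, u - d _ v \in Gp (Some x).
Hypothesis s_d : forall x u, u \in Gp (Some x) -> s x (d _ u) = 0.
Hypothesis s_rho : forall x y u, (x < y)%O -> u \in Gp (Some y) ->
  s x (rho (Some x) (Some y) u) = 0.
Hypothesis s_inj : forall x u, u \in Gp (Some x) -> d _ u = 0 -> s x u = 0 ->
  exists2 v, v \in Gp (Some x) & u = d _ v.
Hypothesis s_surj : forall x m, exists z, [/\ z \in Gp (Some x), d _ z = 0 & s x z = m].

Notation D := (tot rho d).
Implicit Types (x y : P) (S : {set P}) (e g : fam G).

Definition upper_chain x S := chain S && (S \subset above x).

Lemma upper_notin x S : upper_chain x S -> x \notin S.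
Proof.
by move=> /andP[_ /subsetP Sx]; apply/negP => /Sx; rewrite inE ltxx.
Qed.

Lemma upper_chainD1 x S t : upper_chain x S -> upper_chain x (S :\ t).
Proof.
move=> /andP[Sc Sx]; rewrite /upper_chain chainD1 //=.
exact: subset_trans (subD1set _ _) Sx.
Qed.

Lemma upper_mn x S : upper_chain x S -> mn (x |: S) = Some x.
Proof.
move=> /andP[_ /subsetP Sx]; apply: mn_eq; first exact: setU11.
by move=> t /setU1P[-> //|/Sx]; rewrite inE => /ltW.
Qed.

Lemma upper_chainU x S : upper_chain x S -> chain (x |: S).
Proof.
move=> /andP[/chainP Sc /subsetP Sx]; apply/chainP => u v.
have lex t : t \in S -> (x <= t)%O by move=> /Sx; rewrite inE => /ltW.
by move=> /setU1P[->|uS] /setU1P[->|vS]; rewrite ?lexx ?lex ?orbT //; apply: Sc.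
Qed.

Lemma chain_mnD1 x S : chain S -> mn S = Some x -> x |: (S :\ x) = S.
Proof. by move=> Sc /eqP/mnP[xS _]; rewrite setD1K. Qed.

Lemma chain_upper x S : chain S -> mn S = Some x -> upper_chain x (S :\ x).
Proof.
move=> Sc /eqP/mnP[xS xle]; rewrite /upper_chain chainD1 //=.
by apply/subsetP => t; rewrite !inE lt_def => /andP[-> /xle ->].
Qed.

Definition mdelta (M' : lmodType K) (t : {set P} -> M') S : M' :=
  \sum_(y in S) (-1) ^+ fpos S y *: t (S :\ y).

(** The cocycles of the total complex modulo [Gp]. On the empty chain, where [Gp] is zero, this says
    that [g set0 None] is a cocycle of the top column. *)
Definition good g := forall S, chain S -> D g S (mn S) \in Gp (mn S).

(** The chains with minimum [x] are the [x |: S] for upper chains [S], so [low e x] is an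
    [M x]-valued cochain on the order complex of the elements above [x]. *)
Definition low (e : fam G) x S : M x := s x (e (x |: S) (Some x)).

(** Deleting [x] leaves either a chain with a minimum strictly above [x], whose contribution is
    killed by [s_rho], or the empty chain, where [Gp] is zero. The other deletions keep the minimum
    [x]; since [x] precedes all of [S], each position is shifted by one, whence the sign. *)
Lemma low_delta e x S : upper_chain x S ->
    (forall S, chain S -> e S (mn S) \in Gp (mn S)) ->
  s x (delta rho e (x |: S) (Some x)) = - mdelta (low e x) S.
Proof.
move=> xS eG; have [Sc /subsetP Sx] := andP xS.
have xNS := upper_notin xS.
rewrite /delta big_setU1 //= linearD linearZ /= setU1K //.
rewrite [X in _ *: X](_ : _ = 0).
  rewrite scaler0 add0r linear_sum -sumrN; apply: eq_bigr => t tS.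
  have xt : (x < t)%O by move: (Sx _ tS); rewrite inE.
  have tx : x != t by rewrite lt_eqF.
  have -> : (x |: S) :\ t = x |: S :\ t 
    by apply/setP => u; rewrite !inE; case: (eqVneq u x) => [->|//]; rewrite tx.
  rewrite upper_mn ?upper_chainD1 // rho_id linearZ /= (fpos_D1_gt _ xt) ?setU11 //.
  by rewrite setU1K // exprS mulN1r scaleNr.
case E: (mn S) (eG S Sc) => [y|] eS; last by rewrite (Gp0 eS) !linear0.
have [yS _] : y \in S /\ {in S, forall t, (y <= t)%O} by apply/mnP/eqP.
by apply: s_rho => //; move: (Sx _ yS); rewrite inE.
Qed.

Lemma low_tot e x S : upper_chain x S ->
    (forall S, chain S -> e S (mn S) \in Gp (mn S)) ->
  low (D e) x S = - mdelta (low e x) S.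
Proof.
move=> xS eG; rewrite /low /tot linearD linearZ /= low_delta // s_d ?scaler0 ?add0r //.
by have := eG _ (upper_chainU xS); rewrite upper_mn.
Qed.

Let Gp_ole o o' u : ole o o' -> u \in Gp o' -> rho o o' u \in Gp o.
Proof.
case: o o' u => [x|] [y|] u //=; last 2 first.
- by move=> _ /Gp0->; rewrite linear0 rpred0.
- by rewrite rho_id.
rewrite le_eqVlt => /orP[/eqP xy|]; last exact: Gp_rho.
by subst y; rewrite rho_id.
Qed.

Lemma tot_Gp e : (forall S, chain S -> e S (mn S) \in Gp (mn S)) -> good e.
Proof.
move=> eG S Sc; rewrite rpredD ?rpredZ ?Gp_d ?eG //.
apply: rpred_sum => t tS; apply/rpredZ/Gp_ole; rewrite ?eG ?chainD1 //.
by rewrite ole_mn // subD1set.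
Qed.

Let Lx_lin x a u v :
  u \in Gp (Some x) /\ s x u = 0 -> v \in Gp (Some x) /\ s x v = 0 ->
  a *: u + v \in Gp (Some x) /\ s x (a *: u + v) = 0.
Proof.
by move=> [uG su] [vG sv]; rewrite rpredD ?rpredZ // linearP su sv scaler0 addr0.
Qed.

(** The kernel of [s] on [Gp], an acyclic subcomplex of each column. It is the difference between
    [Gp] and the simplicial cochains with values in the [M x]. *)
Let L o : submodClosed (G o) :=
  if o is Some x
  then submod_of (conj (rpred0 (Gp (Some x))) (linear0 (s x))) (@Lx_lin x)
  else zerom.

Let LP x u : reflect (u \in Gp (Some x) /\ s x u = 0) (u \in L (Some x)).
Proof. exact: in_submod. Qed.

Let L0 u : u \in L None -> u = 0. Proof. by move=> /in_submod. Qed.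

Let tot_L e : (forall S, chain S -> e S (mn S) \in L (mn S)) ->
    (forall S, chain S -> D e S (mn S) = 0) ->
  exists l : fam G, [/\ l set0 None = 0, forall S, chain S -> l S (mn S) \in L (mn S)
    & forall S, chain S -> e S (mn S) = D l S (mn S)].
Proof.
move=> eL De.
have [|||||||||g [g0 gL gP]] :=
  tot_exact_subquot rho_comp ddK rho_d (A := L) (B := fun _ => zerom) (e := e).
- by move=> o u /in_submod->; apply: rpred0.
- case=> [x|] u; last by move=> /L0->; rewrite linear0 rpred0.
  by move=> /LP[uG su]; apply/LP; rewrite Gp_d // s_d.
- by move=> o u /in_submod->; rewrite linear0 rpred0.
- case=> [x|] [y|] u //=; last 2 first.
  + by move=> _ /L0->; rewrite linear0; exact: (rpred0 (L (Some x))).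
  + by rewrite rho_id.
  rewrite le_eqVlt => /orP[/eqP xy|xy]; first by subst y; rewrite rho_id.
  by move=> /LP[uG _]; apply/LP; rewrite Gp_rho // s_rho.
- by move=> o o' u _ /in_submod->; rewrite linear0 rpred0.
- move=> x u /LP[uG su] /in_submod du.
  (* The primitive [v] in [Gp] need not be killed by [s]; subtracting a cocycle with the same image
     under [s] corrects this. *)
  have [v vG ->] := s_inj uG du su; have [z [zG dz sz]] := s_surj (s x v).
  exists (v - z); first by apply/LP; rewrite submodB // linearB /= sz subrr.
  by apply/in_submod; rewrite linearB /= dz subr0 subrr.
- exact: eL.
- by move=> S Sc; rewrite De ?rpred0.
- by have := eL _ (chain0 P); rewrite mn0 => /L0->; apply: rpred0.
exists g; split=> // S Sc; apply/eqP; rewrite -subr_eq0; apply/eqP.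
by have /in_submod := gP S Sc.
Qed.

(** By [Gp_qis] the columns over [P] are acyclic modulo [Gp]. The top column is not, hence the
    condition on the empty chain. *)
Let tot_mod_Gp e : good e -> e set0 None = 0 ->
  exists2 k : fam G, k set0 None = 0 &
    forall S, chain S -> e S (mn S) - D k S (mn S) \in Gp (mn S).
Proof.
move=> eG e0.
have [|||||||||g [g0 gL gP]] :=
  tot_exact_subquot rho_comp ddK rho_d (A := fun o => fullm (G o)) (B := Gp) (e := e);
  try by move=> *; rewrite ?in_fullm.
- exact: Gp_d.
- exact: Gp_ole.
- by move=> x u _ /Gp_qis[v uv]; exists v; rewrite ?in_fullm.
- exact: eG.
- by rewrite e0 rpred0.
by exists g.
Qed.

Let lift_low (t : forall x, {set P} -> M x) : exists e : fam G,
  [/\ forall S, chain S -> e S (mn S) \in Gp (mn S), e set0 None = 0,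
      forall S o, d o (e S o) = 0 & forall x S, upper_chain x S -> low e x S = t x S].
Proof.
have liftP (xm : {x & M x}) : exists z : G (Some (tag xm)),
  [/\ z \in Gp _, d _ z = 0 & s _ z = tagged xm] by apply: s_surj.
pose lft x (m : M x) : G (Some x) := sval (cid (liftP (Tagged M m))).
have lftP x (m : M x) : [/\ lft x m \in Gp (Some x), d _ (lft x m) = 0 & s x (lft x m) = m].
  exact: (svalP (cid (liftP (Tagged M m)))).
exists (fun S o => if o is Some x as o return G o then lft x (t x (S :\ x)) else 0).
split=> //.
- by move=> S _; case: (mn S) => [x|]; [case: (lftP x (t x (S :\ x))) | rewrite rpred0].
- by move=> S [x|]; [case: (lftP x (t x (S :\ x))) | rewrite linear0].
move=> x S xS; rewrite /low setU1K ?upper_notin //.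
by case: (lftP x (t x S)).
Qed.

Let sub_fam e g S o : (e - g) S o = e S o - g S o. Proof. by []. Qed.

Let totB e g S o : D (e - g) S o = D e S o - D g S o.
Proof. by rewrite (linearB D). Qed.

(** Placed on the empty chain, the cocycle [u] has a total coboundary that vanishes there. By
    [tot_mod_Gp] this coboundary can be moved into [Gp] without changing the component on the empty
    chain. *)
Lemma core_total u : d None u = 0 -> exists2 g : fam G, good g & g set0 None = u.
Proof.
move=> du; pose e : fam G := fun S o =>
  if (S == set0) then if o is None as o return G o then u else 0 else 0.
have De0 : D e set0 None = 0 by rewrite tot_set0 /e eqxx.
have [S Sc||k k0 kP] := tot_mod_Gp (e := D e); rewrite ?De0 //.
  by rewrite tot_tot // rpred0.
exists (e - k); last by rewrite sub_fam k0 subr0 /e eqxx.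
by move=> S Sc; rewrite totB kP.
Qed.

(** For a lift [e] of the cocycle [t], [low_tot] puts [D e] into [L]. Acyclicity of [L] gives [l]
    such that [e - l] is a total cocycle with the same low part, and exactness of the total complex
    makes it some [D g]. *)
Lemma core_surj (t : forall x, {set P} -> M x) :
    (forall x S, upper_chain x S -> mdelta (t x) S = 0) ->
  exists2 g : fam G, good g & forall x S, upper_chain x S -> low (D g) x S = t x S.
Proof.
move=> dt; have [e [eG e0 de et]] := lift_low t.
have mt x S : upper_chain x S -> mdelta (low e x) S = mdelta (t x) S.
  by move=> xS; apply: eq_bigr => y yS; rewrite et ?upper_chainD1.
have [S Sc|S Sc|l [l0 lL lP]] := tot_L (e := D e).
- have := tot_Gp eG Sc; case E: (mn S) => [x|] DeS.
    apply/LP; split=> //.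
    have := low_tot (chain_upper Sc E) eG.
    by rewrite /low (chain_mnD1 Sc E) mt ?dt ?oppr0 ?(chain_upper Sc E).
  by rewrite (mn_None Sc E) tot_set0 e0 linear0 rpred0.
- by rewrite tot_tot.
have [S Sc|g gP] := tot_exact rho_comp ddK rho_d rows_exact (e := e - l).
  by rewrite totB lP // subrr.
exists g => [S Sc|x S xS].
  rewrite -gP // sub_fam submodB ?eG //.
  have := lL S Sc; case: (mn S) => [x|]; first by case/LP.
  by move=> /L0->; rewrite rpred0.
have /LP[_ sl] : l (x |: S) (Some x) \in L (Some x).
  by have := lL _ (upper_chainU xS); rewrite upper_mn.
have := gP _ (upper_chainU xS); rewrite /low upper_mn // => <-.
by rewrite sub_fam linearB /= sl subr0; apply: et.
Qed.

Lemma core_cocycle g : good g -> forall x S, upper_chain x S ->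
  mdelta (low (D g) x) S = 0.
Proof.
move=> gG x S xS; apply/oppr_inj; rewrite -low_tot // oppr0 /low.
have := tot_tot rho_comp ddK rho_d g (upper_chainU xS).
by rewrite upper_mn // => ->; rewrite linear0.
Qed.

(** Adding a lift [e] of the primitive cancels the low part of [D g], thanks to the sign in
    [low_tot]. After a correction in [L], the sum is a total cocycle, hence some [D k]; on the empty
    chain nothing was changed, and there [D k] is a boundary of the top column. *)
Lemma core_inj g : good g ->
    (forall x, exists t, forall S, upper_chain x S -> low (D g) x S = mdelta t S) ->
  exists v, g set0 None = d None v.
Proof.
move=> gG gt.
have [t {}gt] : exists t : forall x, {set P} -> M x,
    forall x S, upper_chain x S -> low (D g) x S = mdelta (t x) S.
  by exists (fun x => sval (cid (gt x))) => x; apply: (svalP (cid (gt x))).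
have [e [eG e0 de et]] := lift_low t.
have mt x S : upper_chain x S -> mdelta (low e x) S = mdelta (t x) S.
  by move=> xS; apply: eq_bigr => y yS; rewrite et ?upper_chainD1.
pose w := g + e.
have [S Sc|S Sc|l [l0 lL lP]] := tot_L (e := D w).
- rewrite (linearD D); have -> : (D g + D e) S (mn S) = D g S (mn S) + D e S (mn S) by [].
  have := rpredD (gG S Sc) (tot_Gp eG Sc); case E: (mn S) => [x|] DeS.
    apply/LP; split=> //; have xS := chain_upper Sc E.
    have := low_tot xS eG; have := gt x _ xS.
    rewrite /low (chain_mnD1 Sc E) mt // => Hg He.
    by apply: (etrans (linearD (s x) _ _)); rewrite Hg He subrr.
  by rewrite (Gp0 DeS) rpred0.
- by rewrite tot_tot.
have [S Sc|k kP] := tot_exact rho_comp ddK rho_d rows_exact (e := w - l).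
  by rewrite totB lP // subrr.
exists (k set0 None); have := kP _ (chain0 P); rewrite mn0 tot_set0 sub_fam l0 subr0 => <-.
by rewrite [RHS](_ : _ = g set0 None + e set0 None) // e0 addr0.
Qed.

(** Two total boundaries can be subtracted from [g] without changing [D g]: that of [v] on the empty
    chain, then one from [tot_mod_Gp]. What remains has values in [Gp], and [low_tot] gives the
    primitive. *)
Lemma core_wd g v : good g -> g set0 None = d None v ->
  forall x, exists t, forall S, upper_chain x S -> low (D g) x S = mdelta t S.
Proof.
move=> gG gv; pose e : fam G := fun S o =>
  if (S == set0) then if o is None as o return G o then v else 0 else 0.
have De0 : D e set0 None = d None v by rewrite tot_set0 /e eqxx.
have Dge S : chain S -> D (g - D e) S (mn S) = D g S (mn S).
  by move=> Sc; rewrite totB tot_tot // subr0.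
have [S Sc||k k0 kP] := tot_mod_Gp (e := g - D e).
- by rewrite Dge //; apply: gG.
- by rewrite sub_fam De0 gv subrr.
move=> x; exists (fun S => - low (g - D e - D k) x S) => S xS.
have -> : mdelta (fun S => - low (g - D e - D k) x S) S =
    - mdelta (low (g - D e - D k) x) S.
  by rewrite -sumrN; apply: eq_bigr => y _; rewrite scalerN.
rewrite -low_tot // /low; congr (s x _); have Sc := upper_chainU xS.
have Hg := Dge _ Sc; have Hk := tot_tot rho_comp ddK rho_d k Sc.
by rewrite upper_mn // in Hg Hk; rewrite [RHS]totB Hg Hk subr0.
Qed.
End Core.

(** * Tensor products and the cohomology of the order complex *)

Section TensorProduct.
Variables (K : fieldType) (V W : lmodType K).
Implicit Types (v : V) (w : W).
Local Notation FG := {freeg (V * W) / K}.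

Let tens_rel (r : FG) : tensor_rel r -> pim (spanm (@tensor_rel K V W)) r = 0.
Proof.
move=> Rr; apply/eqP; rewrite -(linear0 (pim _)) pim_eq subr0.
by apply/asboolP => M; apply.
Qed.

Lemma tensDl v v' w : tens (v + v') w = tens v w + tens v' w.
Proof.
apply/eqP; rewrite -subr_eq0 opprD addrA -!linearB; apply/eqP/tens_rel.
by constructor 1; exists v, v', w.
Qed.

Lemma tensDr v w w' : tens v (w + w') = tens v w + tens v w'.
Proof.
apply/eqP; rewrite -subr_eq0 opprD addrA -!linearB; apply/eqP/tens_rel.
by constructor 2; exists v, w, w'.
Qed.

Lemma tensZl a v w : tens (a *: v) w = a *: tens v w.
Proof.
apply/eqP; rewrite -subr_eq0 -linearZ -linearB; apply/eqP/tens_rel.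
by constructor 3; exists a, v, w.
Qed.

Lemma tensZr a v w : tens v (a *: w) = a *: tens v w.
Proof.
apply/eqP; rewrite -subr_eq0 -linearZ -linearB; apply/eqP/tens_rel.
by constructor 4; exists a, v, w.
Qed.

Fact tensl_linear v : linear (tens v : W -> tensor V W).
Proof. by move=> a w w'; rewrite tensDr tensZr. Qed.
Fact tensr_linear w : linear (fun v => tens v w).
Proof. by move=> a v v'; rewrite tensDl tensZl. Qed.

Lemma tens0r v : tens v (0 : W) = 0. Proof. exact: (linear0 (mklin (tensl_linear v))). Qed.
Lemma tens0l w : tens (0 : V) w = 0. Proof. exact: (linear0 (mklin (tensr_linear w))). Qed.

Lemma tens_suml (I : finType) (F : I -> V) w :
  tens (\sum_i F i) w = \sum_i tens (F i) w.
Proof. exact: (linear_sum (mklin (tensr_linear w))). Qed.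

Lemma tens_sumr v (I : finType) (F : I -> W) :
  tens v (\sum_i F i) = \sum_i tens v (F i).
Proof. exact: (linear_sum (mklin (tensl_linear v))). Qed.

Lemma tensor_ind (S : submodClosed (tensor V W)) :
  (forall v w, tens v w \in S) -> forall q, q \in S.
Proof.
move=> St q; rewrite -[q]reprmK -[reprm q]freeg_sumE linear_sum.
apply: rpred_sum => -[v w] _.
suff -> : << coeff (v, w) (reprm q) *g (v, w) >> =
    coeff (v, w) (reprm q) *: << (v, w) >> :> FG by rewrite linearZ rpredZ // St.
apply/eqP/freeg_eqP => z; rewrite coeffZ !coeffU mul1r.
by [].
Qed.

Lemma tensor_lift (U : lmodType K) (b : V -> W -> U) :
    (forall v, linear (b v)) -> (forall w, linear (fun v => b v w)) ->
  exists f : {linear tensor V W -> U}, forall v w, f (tens v w) = b v w.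
Proof.
move=> blin1 blin2; pose f0 (q : FG) : U := fglift (fun vw => b vw.1 vw.2) q.
pose fa : {additive FG -> U} := HB.pack f0 (GRing.isAdditive.Build FG U f0
  (lift_is_additive (fun vw : V * W => b vw.1 vw.2))).
have f0D q q' : f0 (q + q') = f0 q + f0 q' by exact: (raddfD fa).
have f0S (r : seq (V * W)) (F : V * W -> FG) :
    f0 (\sum_(x <- r) F x) = \sum_(x <- r) f0 (F x) by exact: (raddf_sum fa).
have f0U a v w : f0 << a *g (v, w) >> = a *: b v w by rewrite /f0 liftU.
have f0Z a q : f0 (a *: q) = a *: f0 q.
  rewrite -{2}[q]freeg_sumE [a *: q]/(fgscale a q) /fgscale.
  rewrite !f0S scaler_sumr.
  by apply: eq_bigr => -[v w] _; rewrite !f0U scalerA.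
have f0lin : linear f0 by move=> a q q'; rewrite f0D f0Z.
pose f1 := mklin f0lin.
have rel0 r : tensor_rel r -> r \in kerm f1.
  move=> Rr; apply/in_submod; rewrite /f1 /=.
  have bD1 v v' w : b (v + v') w = b v w + b v' w by have := blin2 w 1 v v'; rewrite !scale1r.
  have bD2 v w w' : b v (w + w') = b v w + b v w' by have := blin1 v 1 w w'; rewrite !scale1r.
  have bZ1 a v w : b (a *: v) w = a *: b v w.
    exact: (linearZ_LR (mklin (blin2 w))).
  have bZ2 a v w : b v (a *: w) = a *: b v w.
    exact: (linearZ_LR (mklin (blin1 v))).
  have f0B q q' : f0 (q - q') = f0 q - f0 q' by exact: (linearB f1).
  case: Rr => [[v [v' [w ->]]]|[v [w [w' ->]]]|[a [v [w ->]]]|[a [v [w ->]]]];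
    rewrite !f0B ?f0Z !f0U !scale1r.
  - by rewrite bD1 addrAC addrK subrr.
  - by rewrite bD2 addrAC addrK subrr.
  - by rewrite bZ1 subrr.
  - by rewrite bZ2 subrr.
have f1E r r' : r - r' \in spanm (@tensor_rel K V W) -> f0 r = f0 r'.
  move=> /asboolP /(_ (kerm f1)) H; apply/eqP; rewrite -subr_eq0; apply/eqP.
  have /in_submod := H (fun r => @rel0 r).
  by rewrite (linearB f1).
have f_lin : linear (fun q : tensor V W => f0 (reprm q)).
  move=> a q q'; rewrite -f0Z -f0D; apply: f1E.
  by rewrite -pim_eq linearP /= !reprmK.
exists (mklin f_lin) => v w /=.
transitivity (f0 << (v, w) >>); last by rewrite f0U scale1r.
by apply: f1E; rewrite -pim_eq reprmK.
Qed.
End TensorProduct.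

Section TensorMap.
Variables (K : fieldType) (V W W' : lmodType K) (f : {linear W -> W'}).

Fact tensor_map_ex : exists g : {linear tensor V W -> tensor V W'},
  forall v w, g (tens v w) = tens v (f w).
Proof.
apply: tensor_lift => [v|w] a u u'; first by rewrite linearP tensl_linear.
exact: tensr_linear.
Qed.
Definition tensor_map : {linear tensor V W -> tensor V W'} := sval (cid tensor_map_ex).
Lemma tensor_map_tens v w : tensor_map (tens v w) = tens v (f w).
Proof. exact: (svalP (cid tensor_map_ex)). Qed.
End TensorMap.

(** * Cohomology of the order complex with coefficients *)

Section Kuenneth.
Variables (disp : Order.disp_t) (P : finPOrderType disp) (K : fieldType) (Q : {set P}).
Local Notation C n := (fcochain K Q n).
Local Notation d n := (cdiff (aug_cochain K Q) n).

Definition face_basis n (S : face Q n) : C n := [ffun S' => (S' == S)%:R].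

Let ebE n (c : C n) : c = \sum_S c S *: face_basis S.
Proof.
apply/ffunP => S; rewrite sum_ffunE (bigD1 S) //= big1 ?addr0.
  by rewrite !ffunE eqxx [RHS]mulr1.
by move=> S' neq; rewrite !ffunE eq_sym (negPf neq) [LHS]mulr0.
Qed.

Let fvalE n (c : C n) (S : face Q n) : fval c (val S) = c S.
Proof. by rewrite /fval valK. Qed.

Let fval_lin n a (f g : C n) S : fval (a *: f + g) S = a * fval f S + fval g S.
Proof. by rewrite /fval; case: insub => [F|] /=; rewrite ?ffunE ?mulr0 ?addr0. Qed.

Let fvalZ n a (f : C n) S : fval (a *: f) S = a * fval f S.
Proof.
have := fval_lin a f 0 S; rewrite addr0 /fval => ->.
by case: insub => [F|] /=; rewrite ?ffunE ?addr0.
Qed.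

Let fvalD n (f g : C n) S : fval (f + g) S = fval f S + fval g S.
Proof. by have := fval_lin 1 f g S; rewrite scale1r mul1r. Qed.

Let fval_sum n (I : finType) (F : I -> C n) S :
  fval (\sum_i F i) S = \sum_i fval (F i) S.
Proof.
apply: (big_morph (fun f : C n => fval f S)) => [f g|]; first exact: fvalD.
by rewrite /fval; case: insub => [F'|] //=; rewrite ffunE.
Qed.

Let mdelta_cochain n (c : C n) (M : lmodType K) (m : M) S : is_face Q n.+1 S ->
  mdelta (fun S => fval c S *: m) S = fval (d n c) S *: m.
Proof.
move=> FS; rewrite fval_diff // scaler_suml; apply: eq_bigr => y _.
by rewrite scalerA.
Qed.

Section Coefficients.
Variable M : lmodType K.
Implicit Types (t : {set P} -> M).

(* The action of [A (x) 1] on [C n (x) M]. *)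
Definition coef_act n m (A : C n -> C m) t (S : {set P}) : M :=
  \sum_(S' : face Q n) fval (A (face_basis S')) S *: t (val S').

Lemma coef_act_id n t (S : face Q n) : coef_act (fun c : C n => c) t (val S) = t (val S).
Proof.
rewrite /coef_act (bigD1 S) //= big1 ?addr0; first by rewrite fvalE ffunE eqxx scale1r.
by move=> S' neq; rewrite fvalE ffunE eq_sym (negPf neq) scale0r.
Qed.

Lemma coef_actB n m (A B : C n -> C m) t S :
  coef_act (fun c => A c - B c) t S = coef_act A t S - coef_act B t S.
Proof.
rewrite /coef_act -sumrB; apply: eq_bigr => S' _; rewrite fvalD -scaleN1r fvalZ.
by rewrite scalerDl mulN1r scaleNr.
Qed.

Lemma coef_act_diffl n m (A : C n -> C m) t S : is_face Q m.+1 S ->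
  coef_act (fun c => d m (A c)) t S = mdelta (coef_act A t) S.
Proof.
move=> FS; rewrite /mdelta /coef_act; under [RHS]eq_bigr do rewrite scaler_sumr.
rewrite exchange_big; apply: eq_bigr => S' _ /=.
rewrite fval_diff // scaler_suml; apply: eq_bigr => y _.
by rewrite scalerA.
Qed.

Lemma coef_act_diff n t S : is_face Q n.+1 S -> coef_act (fun c : C n => d n c) t S = mdelta t S.
Proof.
move=> FS; rewrite (coef_act_diffl (fun c => c)) //; apply: eq_bigr => y yS; congr (_ *: _).
by rewrite -(coef_act_id t (exist (is_face Q n) _ (is_faceD1 FS yS))).
Qed.

Lemma coef_act_diffr n m (A : {linear C n.+1 -> C m}) t S :
    (forall S', is_face Q n.+1 S' -> mdelta t S' = 0) ->
  coef_act (fun c => A (d n c)) t S = 0.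
Proof.
move=> dt; transitivity (\sum_(S' : face Q n.+1)
    fval (A (face_basis S')) S *: coef_act (fun c => d n c) t (val S')).
  rewrite /coef_act; under [RHS]eq_bigr do rewrite scaler_sumr.
  rewrite exchange_big; apply: eq_bigr => S' _ /=.
  rewrite {1}[fdiff _]ebE linear_sum fval_sum scaler_suml; apply: eq_bigr => S2 _.
  by rewrite linearZ fvalZ scalerA mulrC fvalE.
by apply: big1 => S' _; rewrite coef_act_diff ?dt ?(valP S') // scaler0.
Qed.

Section Degree.
Variables (n : nat) (h : {linear C n.+1 -> C n}) (pB : {linear C n -> C n}).
Hypothesis hP : forall c, d n (h (d n c)) = d n c.
Hypothesis pB_id : forall c, c \in cobound (aug_cochain K Q) n -> pB c = c.
Hypothesis pB_in : forall c, pB c \in cobound (aug_cochain K Q) n.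
Hypothesis pB_act : forall (A : C n -> C n) t, exists t', forall S, is_face Q n S ->
  coef_act (fun c => pB (A c)) t S = mdelta t' S.
Hypothesis cob_span : forall t', exists (I : finType) (c : I -> C n) (m : I -> M),
  (forall i, c i \in cobound (aug_cochain K Q) n) /\
  forall S, is_face Q n S -> mdelta t' S = \sum_i fval (c i) S *: m i.
Local Notation H := (cohom (aug_cochain K Q) (Posz n)).
Local Notation cls := (subclass (cocyc (aug_cochain K Q) n) (cobound (aug_cochain K Q) n)).

(** As [h] is a pseudo-inverse of the coboundary, this is a projection onto the cocycles. *)
Let pZ (c : C n) : C n := c - h (d n c).

Let pZ_cocyc c : pZ c \in cocyc (aug_cochain K Q) n.
Proof. by apply/in_submod; rewrite linearB hP subrr. Qed.

Let pZ_id c : c \in cocyc (aug_cochain K Q) n -> pZ c = c.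
Proof. by move=> /in_submod dc; rewrite /pZ dc linear0 subr0. Qed.

Let lam_linear : linear (fun c => cls (Subm (pZ_cocyc c)) : H).
Proof.
move=> a u v; rewrite -linearP; congr (subclass _ _ _); apply: val_inj => /=.
by rewrite /pZ (linearP (d n)) (linearP h) opprD addrACA scalerBr.
Qed.
Definition lam : {linear C n -> H} := mklin lam_linear.

(** A linear section of [lam]: [z - pB z] does not depend on the cocycle [z] in its class, since
    [pB] fixes the coboundaries. *)
Let mu (q : H) : C n := val (subrepr q) - pB (val (subrepr q)).

Let mu_cls z : mu (cls z) = val z - pB (val z).
Proof.
have /subclass_eqP/pB_id : cls (subrepr (cls z)) = cls z by rewrite /subrepr [LHS]reprmK.
rewrite linearB => E; apply/eqP.
by rewrite /mu subr_eq -addrA [- _ + _]addrC E addrC subrK.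
Qed.

Let lam_mu q : lam (mu q) = q.
Proof.
have [z ->] := subclass_surj q; rewrite mu_cls; apply/subclass_eqP => /=.
have pBz : pB (val z) \in cocyc (aug_cochain K Q) n.
  apply/in_submod; have := pB_in (val z); case: (n) (pB (val z)) => [|k] u /in_submod.
    by move->; rewrite linear0.
  by move=> [v ->]; rewrite cdiffK.
rewrite pZ_id; last by rewrite submodB // (subm_valP z).
by rewrite addrAC subrr add0r submodN.
Qed.

Let mu_linear : linear mu.
Proof.
move=> a p q; have [z ->] := subclass_surj p; have [z' ->] := subclass_surj q.
rewrite -linearP !mu_cls; have -> : val (a *: z + z') = a *: val z + val z' by [].
by rewrite (linearP pB) opprD addrACA scalerBr.
Qed.

Let mu_lam c : mu (lam c) = pZ c - pB (pZ c).
Proof. exact: mu_cls. Qed.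

(** With [M]-valued cochains seen as elements of [C n (x) M], this is [lam (x) 1]. *)
Definition tau t : tensor H M := \sum_(S : face Q n) tens (lam (face_basis S)) (t (val S)).

Lemma tau_pure (I : finType) (c : I -> C n) (m : I -> M) t :
    (forall S, is_face Q n S -> t S = \sum_i fval (c i) S *: m i) ->
  tau t = \sum_i tens (lam (c i)) (m i).
Proof.
move=> tE; transitivity (\sum_S \sum_i c i S *: tens (lam (face_basis S)) (m i)).
  apply: eq_bigr => S _; rewrite tE ?(valP S) // tens_sumr.
  by apply: eq_bigr => i _; rewrite tensZr fvalE.
rewrite exchange_big; apply: eq_bigr => i _ /=.
rewrite [RHS](congr1 (fun c' => tens (lam c') (m i)) (ebE (c i))) linear_sum tens_suml.
apply: eq_bigr => S _.
by rewrite linearZ tensZl.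
Qed.

Lemma tau_cobound t t' :
  (forall S, is_face Q n S -> t S = mdelta t' S) -> tau t = 0.
Proof.
move=> tt'; have [I [c [m [cB cE]]]] := cob_span t'.
rewrite (@tau_pure I c m) => [|S FS]; last by rewrite tt' ?cE.
apply: big1 => i _; rewrite (_ : lam (c i) = 0) ?tens0l //.
apply/subclass_eq0 => /=; rewrite pZ_id //; apply/in_submod.
have := cB i; case: (n) (c i) => [|k] u /in_submod; first by move->; rewrite linear0.
by move=> [v ->]; rewrite cdiffK.
Qed.

Lemma tau_surj q : exists2 t,
  forall S, is_face Q n.+1 S -> mdelta t S = 0 & tau t = q.
Proof.
pose reached q := exists2 t,
  forall S, is_face Q n.+1 S -> mdelta t S = 0 & tau t = q.
have reached0 : reached 0.
  exists (fun _ => 0) => [S _|]; first by apply: big1 => y _; rewrite scaler0.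
  by apply: big1 => S _; rewrite tens0r.
have reached_lin a p p' : reached p -> reached p' -> reached (a *: p + p').
  move=> [t dt <-] [t' dt' <-]; exists (fun S => a *: t S + t' S) => [S FS|].
    transitivity (a *: mdelta t S + mdelta t' S); last by rewrite dt ?dt' // scaler0 addr0.
    rewrite scaler_sumr -big_split; apply: eq_bigr => y _ /=.
    by rewrite scalerDr !scalerA mulrC.
  by rewrite scaler_sumr -big_split; apply: eq_bigr => S _; rewrite tensl_linear.
apply/(in_submod reached0 reached_lin)/tensor_ind => v m; apply/in_submod.
exists (fun S => fval (mu v) S *: m).
  move=> S FS; rewrite mdelta_cochain // (_ : d n (mu v) = 0); last first.
    have [z ->] := subclass_surj v; rewrite mu_cls.
    have /in_submod -> // : val z - pB (val z) \in cocyc (aug_cochain K Q) n.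
    rewrite submodB ?(subm_valP z) //.
    have := pB_in (val z); case: (n) (pB (val z)) => [|k] u /in_submod uE; apply/in_submod.
      by rewrite uE linear0.
    by case: uE => w ->; rewrite cdiffK.
  by rewrite /fval; case: insub => [F|] /=; rewrite ?ffunE scale0r.
rewrite (@tau_pure 'I_1 (fun _ => mu v) (fun _ => m)) => [|S _]; rewrite big_ord1 //.
by rewrite lam_mu.
Qed.

(** Applying [mu (x) 1] to [tau t = 0] shows that [pZ - pB pZ] acts on [t] as zero. On a cocycle
    [pZ] acts as the identity, so [t] is the result of the action of [pB pZ], which is a
    coboundary. *)
Lemma tau_inj t : (forall S, is_face Q n.+1 S -> mdelta t S = 0) -> tau t = 0 ->
  exists t', forall S, is_face Q n S -> t S = mdelta t' S.
Proof.
move=> dt t0; have [t' t'P] := pB_act pZ t; exists t' => S FS; rewrite -t'P //.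
have [||f fE] := @tensor_lift K H M M (fun v m => fval (mu v) S *: m).
- by move=> v a m m'; rewrite scalerDr !scalerA mulrC.
- by move=> m a v v'; rewrite mu_linear fval_lin scalerDl scalerA.
have : f (tau t) = 0 by rewrite t0 linear0.
rewrite linear_sum /=; under eq_bigr do rewrite fE mu_lam; move=> E.
have : coef_act (fun c => pZ c - pB (pZ c)) t S = 0 by [].
rewrite coef_actB => /eqP; rewrite subr_eq0 => /eqP <-.
rewrite coef_actB coef_act_diffr // subr0.
by have := coef_act_id t (exist _ S FS).
Qed.
End Degree.
End Coefficients.

(** The classes [l S] are chosen before the module [M], so that [tau] is natural in the
    coefficients; compatibility with gradings rests on this. An integer [j] is allowed because the
    shift by [d_x] can lead to negative degrees, where everything is zero. *)
Lemma kuenneth (j : int) : exists l : {set P} -> cohom (aug_cochain K Q) j,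
  forall M : lmodType K,
  let tau (t : {set P} -> M) := \sum_S tens (l S) (t S) in
  [/\ forall t t', (forall n S, n%:Z = j -> is_face Q n S -> t S = mdelta t' S) ->
        tau t = 0,
      forall q, exists2 t, forall n S, n%:Z = j -> is_face Q n.+1 S -> mdelta t S = 0
        & tau t = q
    & forall t, (forall n S, n%:Z = j -> is_face Q n.+1 S -> mdelta t S = 0) ->
        tau t = 0 ->
      exists t', forall n S, n%:Z = j -> is_face Q n S -> t S = mdelta t' S].
Proof.
case: j => [n|n]; last first.
  have l0 (v : zeromod K) : v = 0 by apply/rowP => -[].
  exists (fun _ => 0) => M tau; have tau0 t : tau t = 0.
    by apply: big1 => S _; rewrite tens0l.
  split=> [t t' _|q|t _ _]; [exact: tau0| |by exists t].
  exists (fun _ => 0) => //; rewrite tau0.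
  have /in_submod // : q \in zerom.
  by apply: tensor_ind => v m; rewrite (l0 v) tens0l rpred0.
have [h hP] := pseudo_inverse (d n).
have [pB [pB_id pB_in pB_act cob_span]] : exists pB : {linear C n -> C n},
  [/\ forall c, c \in cobound (aug_cochain K Q) n -> pB c = c,
      forall c, pB c \in cobound (aug_cochain K Q) n,
      forall (M : lmodType K) (A : C n -> C n) (t : {set P} -> M), exists t',
        forall S, is_face Q n S -> coef_act (fun c => pB (A c)) t S = mdelta t' S
    & forall (M : lmodType K) (t' : {set P} -> M),
        exists (I : finType) (c : I -> C n) (m : I -> M),
        (forall i, c i \in cobound (aug_cochain K Q) n) /\
        forall S, is_face Q n S -> mdelta t' S = \sum_i fval (c i) S *: m i].
  case: n {h hP} => [|n].
    have S0 (M : lmodType K) (t : {set P} -> M) S : is_face Q 0 S -> mdelta t S = 0.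
      by move=> /and3P[_ + _]; rewrite cards_eq0 => /eqP->; apply: big_set0.
    exists (zero_hom _ _); split=> [c /in_submod-> //|c|M A t|M t'].
    - exact: rpred0.
    - exists (fun _ => 0) => S FS; rewrite S0 //; apply: big1 => S' _ /=.
      by rewrite /fval; case: insub => [F|] /=; rewrite ?ffunE scale0r.
    exists 'I_0, (fun _ => 0), (fun _ => 0).
    by split=> [i|S FS]; [apply: rpred0 | rewrite S0 // big_ord0].
  (* With [k] a pseudo-inverse of the coboundary [d n], the composite [d n \o k] is a projection
     onto the coboundaries in degree [n + 1]. *)
  have [k kP] := pseudo_inverse (d n); exists (d n \o k); split=> [c|c|M A t|M t'].
  - by move=> /in_submod[b ->]; apply: kP.
  - by apply/in_submod; exists (k c).
  - by exists (coef_act (fun c => k (A c)) t) => S FS; rewrite -coef_act_diffl.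
  exists (face Q n), (fun S' => d n (face_basis S')), (fun S' => t' (val S')).
  split=> [S'|S FS]; first by apply/in_submod; exists (face_basis S').
  by rewrite -(coef_act_diff _ FS).
exists (fun S => if insub S is Some F then lam hP (face_basis F) else 0) => M.
have tauE t : \sum_S tens (if insub S is Some F then lam hP (face_basis F) else 0) (t S) =
    tau hP t :> tensor _ M.
  rewrite (bigID (is_face Q n)) /= [X in _ + X]big1 ?addr0 => [|S nS]; last first.
    by rewrite insubN // tens0l.
  rewrite (reindex_omap (val : face Q n -> {set P}) insub) => [|S FS]; last by rewrite insubT.
  by apply: eq_big => [F|F _]; rewrite valK ?(valP F) ?eqxx.
split=> [t t' tt'|q|t dt].
- by rewrite tauE; apply: tau_cobound (cob_span M) _ _ _ => S; apply: tt'.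
- have [t dt tq] := tau_surj hP pB_id pB_in q; exists t; last by rewrite tauE.
  by move=> n' S [->]; apply: dt.
- rewrite tauE => t0; have [t' tt'] := tau_inj pB_id (pB_act M) (fun S => dt n S erefl) t0.
  by exists t' => n' S [->]; apply: tt'.
Qed.
End Kuenneth.

(** * Resolution of a sheaf by products over chains *)

Lemma linear_extend (K : fieldType) (U V W : lmodType K) (m : {linear U -> V})
    (f : {linear U -> W}) : injective m ->
  exists g : {linear V -> W}, forall u, g (m u) = f u.
Proof.
move=> m_inj; have [k kP] := pseudo_inverse m; exists (f \o k) => u /=.
by congr (f _); apply: m_inj.
Qed.

(** * Products of skyscraper sheaves are injective *)

Section Skyscrapers.
Variables (disp : Order.disp_t) (P : finPOrderType disp) (K : fieldType).
Implicit Types (U : opens P) (x y : P).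

Lemma down_sub U x : x \in U -> down x \subset U.
Proof.
by move=> xU; apply/subsetP => y; rewrite inE => /(opensP _ (oset_lower U)); apply.
Qed.

Variables (A : Type) (pt : A -> P) (V : A -> lmodType K).

(** The product over [c] of the skyscraper sheaves with value [V c] at the point [pt c]. *)
Definition sky_sec U : lmodType K := prodm (fun c : {c : A | pt c \in U} => V (sval c)).

Definition sky_res_fun U U' (UU' : U' \subset U) (f : sky_sec U) : sky_sec U' :=
  fun c => f (exist _ (sval c) (subsetP UU' _ (svalP c))).
Fact sky_res_linear U U' (UU' : U' \subset U) : linear (sky_res_fun UU').
Proof. by []. Qed.
Definition sky_res U U' (UU' : U' \subset U) : {linear sky_sec U -> sky_sec U'} :=
  mklin (@sky_res_linear U U' UU').

Lemma sky_eq U (f : sky_sec U) c (h h' : pt c \in U) : f (exist _ c h) = f (exist _ c h').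
Proof. by rewrite (bool_irrelevance h h'). Qed.

Fact sky_res_id U (UU : U \subset U) f : sky_res UU f = f.
Proof.
apply: functional_extensionality_dep => -[c h].
by rewrite /= /sky_res_fun /=; exact: (@sky_eq _ f c).
Qed.
Fact sky_res_comp U U' U'' (UU' : U' \subset U) (U'U'' : U'' \subset U')
  (UU'' : U'' \subset U) f : sky_res U'U'' (sky_res UU' f) = sky_res UU'' f.
Proof.
apply: functional_extensionality_dep => -[c h].
by rewrite /= /sky_res_fun /=; exact: (@sky_eq _ f c).
Qed.

Definition sky_presheaf : presheaf P K := Presheaf sky_res_id sky_res_comp.

Fact sky_is_sheaf : is_sheaf sky_presheaf.
Proof.
move=> U I W WU cover s compat.
have covc (c : {c : A | pt c \in U}) : exists i, pt (sval c) \in W i.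
  exact: cover (svalP c).
pose t : sky_sec U := fun c => let i := sval (cid (covc c)) in
  s i (exist _ (sval c) (svalP (cid (covc c)))).
exists t; split=> [i|t' t'P].
  apply: functional_extensionality_dep => -[c cW]; rewrite /= /sky_res_fun /t /=.
  set c' := exist _ c _; case: (cid (covc c')) => k ck /=.
  have cI : pt c \in openI (W k) (W i) by rewrite inE ck.
  have := congr1 (fun f : sky_sec (openI (W k) (W i)) => f (exist _ c cI)) (compat k i).
  rewrite /= /sky_res_fun /= => E; apply: etrans (etrans E _).
    exact: (@sky_eq _ (s k) c).
  exact: (@sky_eq _ (s i) c).
apply: functional_extensionality_dep => -[c cU]; rewrite /t /=.
case: (cid _) => k ck /=.
by rewrite -(t'P k) /= /sky_res_fun /=; exact: (@sky_eq _ t' c).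
Qed.
Definition sky_sheaf : sheaf P K := Sheaf sky_is_sheaf.

(** A morphism into a skyscraper is determined by a linear map on the sections over the minimal
    neighbourhood of [pt c]; over a field, that map extends along injections. *)
Fact sky_injective : injective_sheaf sky_sheaf.
Proof.
move=> B C m f m_inj.
have pt_down c : pt c \in down (pt c) by rewrite inE.
pose comp c (g : sky_sec (down (pt c))) : V c := g (exist _ c (pt_down c)).
have comp_lin c : linear (comp c) by [].
have ext c : exists g : {linear C (down (pt c)) -> V c},
    forall u, g (m (down (pt c)) u) = comp c (f (down (pt c)) u).
  have [g gP] := linear_extend (mklin (comp_lin c) \o f (down (pt c))) (m_inj (down (pt c))).
  by exists g.
pose psi c := sval (cid (ext c)).
have psiP c u : psi c (m (down (pt c)) u) = comp c (f (down (pt c)) u).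
  exact: (svalP (cid (ext c))).
pose g U (b : C U) : sky_sec U :=
  fun c => psi (sval c) (res C (down_sub (svalP c)) b).
have g_lin U : linear (@g U).
  move=> a u v; apply: functional_extensionality_dep => c.
  by rewrite [LHS]/g !linearP.
have g_res U U' (UU' : U' \subset U) s :
    mklin (g_lin U') (res C UU' s) = sky_res UU' (mklin (g_lin U) s).
  apply: functional_extensionality_dep => c /=.
  rewrite /g /sky_res_fun /=; congr (psi _ _).
  exact: res_comp.
exists (@SheafHom _ P K C sky_sheaf (fun U => mklin (g_lin U)) g_res) => U s.
apply: functional_extensionality_dep => -[c cU] /=; rewrite /g /= -shom_res psiP shom_res.
by rewrite /comp /= /sky_res_fun /=; exact: (@sky_eq _ (f U s) c).
Qed.
End Skyscrapers.

(** * The chain resolution and the exactness of its global sections *)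

Section ChainResolution.
Variables (disp : Order.disp_t) (P : finPOrderType disp) (K : fieldType).
Variable F : presheaf P K.
Implicit Types (U : opens P) (x y : P) (S : {set P}) (o : option P).

(** Zero without an inclusion, so that restriction is defined for all pairs, as the maps [rho] of
    the sections on chains must be. *)
Definition sres U U' : {linear F U -> F U'} :=
  if boolP (U' \subset U) is AltTrue h then res F h else zero_hom _ _.

Lemma sresE U U' (UU' : U' \subset U) s : sres U U' s = res F UU' s.
Proof.
rewrite /sres; case: {-}_ / boolP => [h|]; last by rewrite UU'.
by rewrite (bool_irrelevance h UU').
Qed.

Lemma sres_id U s : sres U U s = s.
Proof. by rewrite (sresE (subxx _)) res_id. Qed.

Lemma sres_comp U U' U'' s : U'' \subset U' -> U' \subset U ->
  sres U' U'' (sres U U' s) = sres U U'' s.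
Proof.
move=> h h'; rewrite (sresE h') (sresE h) (sresE (subset_trans h h')).
exact: res_comp.
Qed.

Definition dn o : opens P := if o is Some x then down x else whole P.

Lemma dn_sub o o' : ole o o' -> dn o \subset dn o'.
Proof.
case: o o' => [x|] [y|] // xy; try exact: subsetT.
by apply: (@down_sub _ _ (down y)); rewrite inE.
Qed.

Definition dn_res o o' : {linear F (dn o') -> F (dn o)} := sres (dn o') (dn o).

Lemma dn_res_comp o o' o'' u : ole o o' -> ole o' o'' ->
  dn_res o o' (dn_res o' o'' u) = dn_res o o'' u.
Proof. by move=> oo' o'o''; rewrite /dn_res sres_comp ?dn_sub. Qed.

Lemma dn_res_id o u : dn_res o o u = u. Proof. exact: sres_id. Qed.

Lemma chain_top S : chain S -> S != set0 ->
  exists x, (x \in S) && [forall t in S, (t <= x)%O].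
Proof.
move=> /chainP Sc /set0Pn[z zS].
pose x := [arg max_(y > z in S) #|[set t in S | (t < y)%O]|]%N.
have [xS xmax] : x \in S /\ {in S, forall y,
    (#|[set t in S | (t < y)%O]| <= #|[set t in S | (t < x)%O]|)%N}.
  by rewrite /x; case: arg_maxnP.
exists x; rewrite xS; apply/forall_inP => t tS.
have /orP[xt|//] := Sc _ _ xS tS; rewrite le_eqVlt -implyNb; apply/implyP => tx.
have {}xt : (x < t)%O by rewrite lt_neqAle eq_sym tx.
suff : (#|[set u in S | (u < x)%O]| < #|[set u in S | (u < t)%O]|)%N.
  by rewrite ltnNge xmax.
apply/proper_card/properP; split.
  by apply/subsetP => u; rewrite !inE => /andP[-> /lt_trans]; apply.
by exists x; rewrite !inE ?xS ?xt ?ltxx ?andbF.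
Qed.

Definition schain k := {S : {set P} | chain S && (#|S| == k.+1)}.

Fact schain_top k (c : schain k) :
  exists x, (x \in sval c) && [forall t in sval c, (t <= x)%O].
Proof.
case: c => S /= /andP[Sc Sk]; apply: chain_top => //.
by rewrite -card_gt0 (eqP Sk).
Qed.
Definition top k (c : schain k) : P := xchoose (schain_top c).

Lemma top_in k (c : schain k) U : (top c \in U) = (sval c \subset U).
Proof.
have /andP[cS /forall_inP ctop] := xchooseP (schain_top c).
apply/idP/idP => [cU|/subsetP]; last exact.
by apply/subsetP => t /ctop; apply: (opensP _ (oset_lower U)).
Qed.

(** A chain contributes the sections at its minimum, as a skyscraper at its maximum: opens are lower
    sets, so a chain lies in [U] exactly when its maximum does. *)
Definition chain_sheaf k : sheaf P K :=
  sky_sheaf (@top k) (fun c => F (dn (mn (sval c)))).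

Definition ext_sec k U (f : chain_sheaf k U) S : F (dn (mn S)) :=
  if boolP (chain S && (#|S| == k.+1)) is AltTrue h then
    if boolP (top (exist _ S h : schain k) \in U) is AltTrue h' then
      f (exist _ (exist _ S h) h') else 0 else 0.

Definition sec_fam k U (f : chain_sheaf k U) : fam (fun o => F (dn o)) :=
  fun S o => dn_res o (mn S) (ext_sec f S).

Lemma sec_famE k U (f : chain_sheaf k U) c :
  sec_fam f (sval (sval c)) (mn (sval (sval c))) = f c.
Proof.
rewrite /sec_fam dn_res_id /ext_sec; case: c => -[S h] h' /=.
case: {-}_ / boolP => [h1|]; last by rewrite h.
rewrite (bool_irrelevance h1 h); case: {-}_ / boolP => [h2|]; last by rewrite h'.
by rewrite (bool_irrelevance h2 h').
Qed.

Fact sec_fam_linear k U : linear (@sec_fam k U).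
Proof.
move=> a f g; apply: functional_extensionality_dep => S.
apply: functional_extensionality_dep => o.
have -> : (a *: sec_fam f + sec_fam g) S o = a *: sec_fam f S o + sec_fam g S o by [].
rewrite /sec_fam -linearP; congr (dn_res _ _ _); rewrite /ext_sec.
case: {-}_ / boolP => [h1|h1]; last by rewrite scaler0 addr0.
by case: {-}_ / boolP => [h2|h2] //; rewrite scaler0 addr0.
Qed.

Lemma sec_fam_res k U U' (UU' : U' \subset U) (f : chain_sheaf k U) S o :
  S \subset U' -> sec_fam (res (chain_sheaf k) UU' f) S o = sec_fam f S o.
Proof.
move=> SU'; congr (dn_res _ _ _); rewrite /ext_sec.
case: {-}_ / boolP => [h1|//].
have h2 : top (exist _ S h1 : schain k) \in U' by rewrite top_in.
have h3 : top (exist _ S h1 : schain k) \in U by rewrite top_in (subset_trans SU').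
case: {-}_ / boolP => [h2'|]; last by rewrite h2.
case: {-}_ / boolP => [h3'|]; last by rewrite h3.
by rewrite /= /sky_res_fun /=; exact: (@sky_eq _ _ _ _ _ _ _ f (exist _ S h1)).
Qed.

Definition chain_diff_fun k U (f : chain_sheaf k U) : chain_sheaf k.+1 U :=
  fun c => delta dn_res (sec_fam f) (sval (sval c)) (mn (sval (sval c))).
Fact chain_diff_linear k U : linear (@chain_diff_fun k U).
Proof.
move=> a f g; apply: functional_extensionality_dep => c.
by rewrite /chain_diff_fun sec_fam_linear delta_linear.
Qed.
Fact chain_diff_res k U U' (UU' : U' \subset U) f :
  mklin (@chain_diff_linear k U') (res (chain_sheaf k) UU' f) =
  res (chain_sheaf k.+1) UU' (mklin (@chain_diff_linear k U) f).
Proof.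
apply: functional_extensionality_dep => -[c cU] /=.
rewrite /chain_diff_fun /sky_res_fun /=; apply: eq_bigr => s sS.
rewrite sec_fam_res // (subset_trans (subD1set _ _)) // -top_in //.
Qed.
Definition chain_diff k : sheaf_hom (chain_sheaf k) (chain_sheaf k.+1) :=
  SheafHom (@chain_diff_res k).

Lemma sec_fam_diff k U (f : chain_sheaf k U) S :
    chain S -> #|S| = k.+2 -> S \subset U ->
  sec_fam (chain_diff k U f) S (mn S) = delta dn_res (sec_fam f) S (mn S).
Proof.
move=> Sc Sk SU; have h : chain S && (#|S| == k.+2) by rewrite Sc Sk eqxx.
have h' : top (exist _ S h : schain k.+1) \in U by rewrite top_in.
exact: (sec_famE (chain_diff k U f) (exist _ (exist _ S h : schain k.+1) h')).
Qed.

Fact chain_diffK k U (f : chain_sheaf k U) : chain_diff k.+1 U (chain_diff k U f) = 0.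
Proof.
apply: functional_extensionality_dep => -[[S h] h'] /=.
have [Sc /eqP Sk] := andP h; have SU : S \subset U by move: (h'); rewrite top_in.
rewrite [LHS]/chain_diff_fun /=.
rewrite -[RHS](delta_delta dn_res_comp (sec_fam f) Sc).
apply: delta_ext => // s sS; rewrite sec_fam_diff ?chainD1 //.
  by move: Sk; rewrite (cardsD1 s) sS add1n => -[].
exact: subset_trans (subD1set _ _) SU.
Qed.

Definition chain_aug_fun U (s : F U) : chain_sheaf 0 U :=
  fun c => sres U (dn (mn (sval (sval c)))) s.
Fact chain_aug_linear U : linear (@chain_aug_fun U).
Proof.
move=> a u v; apply: functional_extensionality_dep => c.
exact: linearP.
Qed.

Lemma schain0 (c : schain 0) : sval c = [set top c].
Proof.
have /andP[] := xchooseP (schain_top c); rewrite -/(top c).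
have /andP[_ /cards1P[x ->]] := svalP c.
by rewrite inE => /eqP->.
Qed.

Fact chain_aug_res U U' (UU' : U' \subset U) s :
  mklin (@chain_aug_linear U') (res F UU' s) =
  res (chain_sheaf 0) UU' (mklin (@chain_aug_linear U) s).
Proof.
apply: functional_extensionality_dep => -[c cU] /=.
rewrite /chain_aug_fun /sky_res_fun /= -(sresE UU') sres_comp //.
by rewrite schain0 mn1 /= down_sub.
Qed.
Definition chain_aug : sheaf_hom F (chain_sheaf 0) := SheafHom chain_aug_res.

Lemma sec_fam_aug U (s : F U) x o : x \in U -> ole o (Some x) ->
  sec_fam (chain_aug U s) [set x] o = sres U (dn o) s.
Proof.
move=> xU ox; have h : chain [set x] && (#|[set x]| == 1%N) by rewrite chain1 cards1.
have h' : top (exist _ [set x] h : schain 0) \in U by rewrite top_in /= sub1set.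
have := sec_famE (chain_aug U s) (exist _ (exist _ [set x] h : schain 0) h').
rewrite /= /sec_fam dn_res_id => ->; rewrite /chain_aug_fun /= mn1.
by rewrite /dn_res sres_comp ?dn_sub //= down_sub.
Qed.

Lemma fpos1 x : fpos [set x] x = 0%N.
Proof.
apply: eq_card0 => t; rewrite !inE; apply/negbTE/negP => /andP[/eqP->].
by rewrite ltxx.
Qed.

Lemma fpos_pair x y : (x < y)%O ->
  fpos [set x; y] x = 0%N /\ fpos [set x; y] y = 1%N.
Proof.
move=> xy; split.
  apply: eq_card0 => t; rewrite !inE; apply/negbTE/negP => /andP[/orP[]/eqP->].
    by rewrite ltxx.
  by move/(lt_trans xy); rewrite ltxx.
rewrite -(cards1 x); apply: eq_card => t; rewrite !inE.
case: (eqVneq t x) => [->|tx] //=; case: (eqVneq t y) => [->|//].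
by rewrite ltxx.
Qed.

Lemma pairD1 x y : x != y -> [set x; y] :\ x = [set y] /\ [set x; y] :\ y = [set x].
Proof.
move=> xy; split; last by rewrite setUC setU1K // inE eq_sym.
by rewrite setU1K // inE.
Qed.

Lemma delta_pair (e : fam (fun o => F (dn o))) x y : (x < y)%O ->
  delta dn_res e [set x; y] (Some x) =
  dn_res (Some x) (Some y) (e [set y] (Some y)) - e [set x] (Some x).
Proof.
move=> xy; have xNy : x != y by rewrite lt_eqF.
rewrite /delta big_setU1 ?inE //= big_set1; have [-> ->] := fpos_pair xy.
have [-> ->] := pairD1 xNy.
by rewrite !mn1 dn_res_id expr0 expr1 scale1r scaleN1r.
Qed.

Lemma chain_pair x y : (x <= y)%O -> chain [set x; y] /\ mn [set x; y] = Some x.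
Proof.
move=> xy; split; last first.
  by apply: mn_eq => [|t]; rewrite !inE ?eqxx // => /orP[]/eqP->.
by apply/chainP => s t; rewrite !inE => /orP[]/eqP-> /orP[]/eqP->; rewrite ?lexx ?xy ?orbT.
Qed.

Lemma pair_chain S : chain S -> #|S| = 2 -> exists x y, (x < y)%O /\ S = [set x; y].
Proof.
move=> /chainP Sc /eqP/cards2P[x [y [xy Sxy]]].
have := Sc x y; rewrite Sxy !inE !eqxx orbT /= => /(_ isT isT) /orP[le_xy|le_yx].
  by exists x, y; rewrite lt_neqAle xy.
by exists y, x; rewrite lt_neqAle eq_sym xy setUC.
Qed.

Fact chain_augK U s : chain_diff 0 U (chain_aug U s) = 0.
Proof.
apply: functional_extensionality_dep => -[[S h] h'] /=.
have [Sc /eqP Sk] := andP h; have SU : S \subset U by move: (h'); rewrite top_in.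
suff : delta dn_res (sec_fam (chain_aug U s)) S (mn S) = 0 by [].
have [x [y [xy Sxy]]] := pair_chain Sc Sk.
move: SU; rewrite Sxy subUset !sub1set => /andP[xU yU].
have [_ ->] := chain_pair (ltW xy); rewrite delta_pair //.
rewrite !sec_fam_aug ?ole_refl // /dn_res sres_comp ?subrr //.
  by rewrite (dn_sub (o := Some x) (o' := Some y)) //= ltW.
exact: down_sub.
Qed.

Fact chain_aug_inj x : injective (chain_aug (down x)).
Proof.
move=> s t st; have xx : x \in down x by rewrite inE.
have := congr1 (fun f => sec_fam f [set x] (Some x)) st.
by rewrite !sec_fam_aug ?ole_refl // !sres_id.
Qed.

(* Contraction of the chains in [down x] onto the top element [x]. *)
Lemma cone_exact x n (e : fam (fun o => F (dn o))) :
    (forall S, chain S -> #|S| = n.+3 -> S \subset down x ->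
      delta dn_res e S (mn S) = 0) ->
  exists g : fam (fun o => F (dn o)), forall S, chain S -> #|S| = n.+2 ->
    S \subset down x -> e S (mn S) = delta dn_res g S (mn S).
Proof.
(* The contraction joins [x] to the chain. As the largest vertex of [x |: S], it has position [|S|],
   whence the sign. The chains to be treated have at least two elements, so that joining [x], before
   or after a deletion, does not change the minimum. *)
move=> de; exists (fun S o => if x \in S then 0 else (-1) ^+ #|S| *:
  dn_res o (mn (x |: S)) (e (x |: S) (mn (x |: S)))) => S Sc Sn Sx.
have Sle t : t \in S -> (t <= x)%O by move/(subsetP Sx); rewrite inE.
have mnx S' : S' \subset S -> S' != set0 -> mn (x |: S') = mn S'.
  move=> S'S S'0; have [y Ey] := mn_chain (chainS S'S Sc) S'0.
  have [yS yle] : y \in S' /\ {in S', forall t, (y <= t)%O} by apply/mnP/eqP.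
  rewrite Ey; apply: mn_eq; first by rewrite inE yS orbT.
  by move=> t /setU1P[->|/yle//]; rewrite Sle // (subsetP S'S).
have D1n0 s : s \in S -> S :\ s != set0.
  by move=> sS; rewrite -card_gt0; move: Sn; rewrite (cardsD1 s) sS add1n => -[->].
have fx S' : S' \subset S -> x \notin S' -> fpos (x |: S') x = #|S'|.
  move=> S'S xS'; apply: eq_card => t; rewrite !inE lt_neqAle.
  case: (eqVneq t x) => [->|tx] /=; rewrite ?(negPf xS') //.
  by case: (boolP (t \in S')) => //= /(subsetP S'S)/Sle ->.
rewrite /delta; case: (boolP (x \in S)) => xS.
  rewrite (bigD1 x) //= big1 ?addr0 => [|s /andP[sS sx]]; last first.
    by rewrite !inE eq_sym sx xS linear0 scaler0.
  have E : mn (S :\ x) = mn S by rewrite -mnx ?D1n0 ?subD1set // setD1K.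
  rewrite setD11 setD1K // E linearZ /= !dn_res_id.
  rewrite -[in fpos _ _](setD1K xS) fx ?subD1set ?setD11 //.
  by rewrite signrZK.
have xSc : chain (x |: S).
  apply/chainP => u v; have /chainP {}Sc := Sc.
  by move=> /setU1P[->|uS] /setU1P[->|vS]; rewrite ?lexx ?Sle ?orbT //; apply: Sc.
have := de _ xSc; rewrite cardsU1 xS Sn => /(_ erefl).
have xx : x \in down x by rewrite inE lexx.
rewrite subUset sub1set xx Sx => /(_ isT) dexS.
have S0 : S != set0 by rewrite -card_gt0 Sn.
move: dexS; rewrite /delta big_setU1 //= setU1K // fx // mnx // dn_res_id.
move/eqP; rewrite addr_eq0 => /eqP E; apply: (can_inj (signrZK #|S|)).
rewrite E -sumrN scaler_sumr; apply: eq_bigr => s sS.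
have xs : x != s by apply: contraNneq xS => ->.
have -> : (x |: S) :\ s = x |: S :\ s.
  by apply/setP => u; rewrite !inE; case: (eqVneq u x) => [->|//]; rewrite xs.
rewrite !inE (negPf xS) andbF mnx ?D1n0 ?subD1set // dn_res_id.
have -> : fpos (x |: S) s = fpos S s.
  rewrite -(fpos_D1 (x |: S) (t := x)) ?setU1K // lt_neqAle eq_sym xs Sle //.
rewrite [in RHS](cardsD1 s S) sS add1n exprS mulN1r scaleNr.
congr (- _); rewrite [dn_res _ _ (_ *: _)]linearZ /= !scalerA.
by rewrite mulrAC -expr2 sqrr_sign mul1r.
Qed.

Definition fam_sec k U (g : fam (fun o => F (dn o))) : chain_sheaf k U :=
  fun c => g (sval (sval c)) (mn (sval (sval c))).
Arguments fam_sec : clear implicits.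

Lemma fam_secE k U g S : chain S -> #|S| = k.+1 -> S \subset U ->
  sec_fam (fam_sec k U g) S (mn S) = g S (mn S).
Proof.
move=> Sc Sk SU; have h : chain S && (#|S| == k.+1) by rewrite Sc Sk eqxx.
have h' : top (exist _ S h : schain k) \in U by rewrite top_in.
exact: (sec_famE (fam_sec k U g) (exist _ (exist _ S h : schain k) h')).
Qed.

Lemma chain_diff_fam_sec k U g (f : chain_sheaf k.+1 U) :
    (forall S, chain S -> #|S| = k.+2 -> S \subset U ->
      sec_fam f S (mn S) = delta dn_res g S (mn S)) ->
  f = chain_diff k U (fam_sec k U g).
Proof.
move=> fg; apply: functional_extensionality_dep => -[[S h] h'].
have [Sc /eqP Sk] := andP h; have SU : S \subset U by move: (h'); rewrite top_in.
apply: etrans (esym (sec_famE f _)) _; rewrite /= fg //.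
apply: delta_ext => // s sS; rewrite fam_secE ?chainD1 //.
  by move: Sk; rewrite (cardsD1 s) sS add1n => -[].
exact: subset_trans (subD1set _ _) SU.
Qed.

Lemma chain_diff_eq0 k U (f : chain_sheaf k U) : chain_diff k U f = 0 <->
  forall S, chain S -> #|S| = k.+2 -> S \subset U -> delta dn_res (sec_fam f) S (mn S) = 0.
Proof.
split=> [f0 S Sc Sk SU|f0].
  rewrite -sec_fam_diff // f0.
  exact: (congr1 (fun e : fam _ => e S (mn S)) (linear0 (mklin (@sec_fam_linear k.+1 U)))).
apply: functional_extensionality_dep => -[[S h] h'].
have [Sc /eqP Sk] := andP h; have SU : S \subset U by move: (h'); rewrite top_in.
exact: f0.
Qed.

(** The component at the chain [[set x]] is the required section: the cocycle condition on the pairs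
    [y < x] says that the other components are its restrictions. *)
Fact chain_aug_exact x s : chain_diff 0 (down x) s = 0 ->
  exists t, s = chain_aug (down x) t.
Proof.
move/chain_diff_eq0 => s0; exists (sec_fam s [set x] (Some x)).
apply: functional_extensionality_dep => -[c h]; rewrite -sec_famE /=.
rewrite /chain_aug_fun /= schain0 mn1.
have yx : (top c <= x)%O by move: (h); rewrite inE.
move: (top c) yx => y; rewrite le_eqVlt => /predU1P[->|yx]; first by rewrite sres_id.
have [Sc Sm] := chain_pair (ltW yx); have := s0 _ Sc; rewrite Sm delta_pair //.
rewrite cards2 lt_eqF // => /(_ erefl) E.
apply/esym/eqP; rewrite -subr_eq0; apply/eqP/E.
by rewrite subUset !sub1set !inE (ltW yx) lexx.
Qed.

Fact chain_diff_exact k x s : chain_diff k.+1 (down x) s = 0 ->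
  exists t, s = chain_diff k (down x) t.
Proof.
move/chain_diff_eq0 => s0; have [g gP] := cone_exact s0.
by exists (fam_sec k (down x) g); apply: chain_diff_fam_sec.
Qed.

Definition chain_res : inj_res F :=
  @InjRes _ P K F chain_sheaf chain_aug chain_diff (fun k => sky_injective (V := _))
    chain_augK chain_diffK chain_aug_inj chain_aug_exact chain_diff_exact.

Hypothesis F_sheaf : is_sheaf F.
Hypothesis F_acyclic : forall (J : inj_res F) (i : int), 0 < i ->
  trivial_mod (sheaf_cohom J i).

Lemma section_eq0 U (s : F U) : (forall x, x \in U -> sres U (down x) s = 0) -> s = 0.
Proof.
move=> s0; pose W (x : {x | x \in U}) := down (sval x).
have WU j : W j \subset U by apply: down_sub (svalP j).
have cover x : x \in U -> exists j, x \in W j.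
  by move=> xU; exists (exist (fun x => x \in U) x xU); rewrite inE.
have [|t [_ t_uniq]] := @F_sheaf U _ W WU cover (fun=> 0).
  by move=> j k; rewrite !linear0.
rewrite -(t_uniq s) => [|x]; first by apply: t_uniq => x; rewrite linear0.
by rewrite -sresE s0 ?(svalP x).
Qed.

(** For [n = 0] and [n = 1] this is separation and gluing for the cover by minimal neighbourhoods.
    For larger [n] it is the vanishing of [H^(n - 1)], computed with [chain_res], a chain of [n]
    elements being a simplex of dimension [n - 1]. *)
Lemma rows_exact n (e : fam (fun o => F (dn o))) :
    (forall S, chain S -> #|S| = n.+1 -> delta dn_res e S (mn S) = 0) ->
  exists g, forall S, chain S -> #|S| = n -> e S (mn S) = delta dn_res g S (mn S).
Proof.
case: n => [|[|n]] de.
- exists 0 => S Sc /cards0_eq->; rewrite mn0 delta0; apply: section_eq0 => x _.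
  have := de _ (chain1 x); rewrite cards1 mn1 => /(_ erefl).
  by rewrite /delta big_set1 setDv mn0 fpos1 expr0 scale1r.
- pose W (x : P) := down x; pose s x : F (W x) := e [set x] (Some x).
  have sE x y : (x <= y)%O -> sres (W y) (W x) (s y) = s x.
    rewrite le_eqVlt => /predU1P[->|xy]; first exact: sres_id.
    have [Sc Sm] := chain_pair (ltW xy); have := de _ Sc.
    rewrite Sm cards2 lt_eqF // delta_pair // => /(_ erefl)/eqP.
    by rewrite subr_eq0 => /eqP.
  have cover x : x \in whole P -> exists j, x \in W j by exists x; rewrite inE.
  have [|t [tP _]] := @F_sheaf (whole P) _ W (fun x => subsetT _) cover s.
    move=> x y; apply/eqP; rewrite -subr_eq0; apply/eqP/section_eq0 => z.
    rewrite !inE => /andP[zx zy]; rewrite linearB -!sresE.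
    have zI : down z \subset openI (W x) (W y) by apply: down_sub; rewrite !inE zx.
    by rewrite !sres_comp ?subsetIl ?subsetIr // !sE ?subrr.
  exists (fun S o => if o is None as o return F (dn o) then t else 0) => S Sc /eqP/cards1P[x ->].
  rewrite mn1 /delta big_set1 setDv mn0 /dn_res sresE ?subsetT // => h.
  rewrite fpos1 expr0 scale1r (bool_irrelevance h (subsetT (W x))).
  exact/esym/tP.
pose f := fam_sec n.+1 (whole P) e.
have f0 : chain_diff n.+1 (whole P) f = 0.
  apply/chain_diff_eq0 => S Sc Sn _; rewrite -[RHS](de S Sc Sn).
  apply: delta_ext => // s sS; rewrite fam_secE ?chainD1 ?subsetT //.
  by move: Sn; rewrite (cardsD1 s) sS add1n => -[].
have /subclass_eq0/in_submod[g fg] := F_acyclic (J := chain_res) (i := Posz n.+1) isT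
  (subclass _ _ (Subm (introT (in_submod _ _ _) f0))).
exists (sec_fam g) => S Sc Sn; rewrite -sec_fam_diff ?subsetT //.
by rewrite -[RHS](congr1 (fun f => sec_fam f S (mn S)) fg) fam_secE ?subsetT.
Qed.
End ChainResolution.

(** * Exactness of Hom from projectives and of colimits *)

Section ScalarRestriction.
Variables (K : fieldType) (A : kalg K).

Fact kmap_linear (U V : lmodType A) (f : {linear U -> V}) :
  linear (f : kmod U -> kmod V).
Proof. by move=> a u v; rewrite [LHS]linearP. Qed.
Definition kmap (U V : lmodType A) (f : {linear U -> V}) : {linear kmod U -> kmod V} :=
  mklin (kmap_linear f).

Lemma kmod_sign (M : lmodType A) n (u : M) :
  ((-1) ^+ n *: (u : kmod M)) = (-1) ^+ n *: u.
Proof. by rewrite [LHS](_ : _ = kstr A ((-1) ^+ n) *: u) // rmorph_sign. Qed.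

Lemma delta_kmod disp (P : finPOrderType disp) (M : option P -> lmodType A)
    (rho : forall o o', {linear M o' -> M o}) (e : fam M) S o :
  delta (G := fun o => kmod (M o)) (fun o o' => kmap (rho o o')) e S o = delta rho e S o.
Proof. by apply: eq_bigr => s _; rewrite kmod_sign. Qed.
End ScalarRestriction.

Lemma prodm_sum (R : pzRingType) (J : Type) (V : J -> lmodType R) (I : finType)
    (Q : pred I) (F : I -> prodm V) j : (\sum_(i | Q i) F i) j = \sum_(i | Q i) F i j.
Proof. by apply: (big_morph (fun f : prodm V => f j)). Qed.

Section HomRows.
Variables (disp : Order.disp_t) (P : finPOrderType disp) (R : comPzRingType).
Variables (M : option P -> lmodType R) (rho : forall o o', {linear M o' -> M o}).
Hypothesis rows : forall n (e : fam M),
  (forall S, chain S -> #|S| = n.+1 -> delta rho e S (mn S) = 0) ->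
  exists g, forall S, chain S -> #|S| = n -> e S (mn S) = delta rho g S (mn S).
Variable X : lmodType R.

Fact postcomp_linear o o' :
  linear (fun f : {linear X -> M o'} => (rho o o' \o f : {linear X -> M o})).
Proof. by move=> a f g; apply: hom_ext => u /=; rewrite linearP. Qed.
Definition postcomp o o' : {linear {linear X -> M o'} -> {linear X -> M o}} :=
  mklin (@postcomp_linear o o').

Lemma delta_hom (e : fam (fun o => {linear X -> M o})) S o u :
  delta postcomp e S o u = delta rho (fun S o => e S o u) S o.
Proof.
rewrite /delta; apply: (big_morph (fun f : {linear X -> M o} => f u)) => //.
Qed.

Hypothesis X_proj : projective X.

(** All chains are treated at once: the family is a single map from [X] to the submodule [V] of
    coboundaries, and projectivity lifts it through [delta]. *)
Lemma hom_rows n (e : fam (fun o => {linear X -> M o})) :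
    (forall S, chain S -> #|S| = n.+1 -> delta postcomp e S (mn S) = 0) ->
  exists g, forall S, chain S -> #|S| = n -> e S (mn S) = delta postcomp g S (mn S).
Proof.
(* Exactness of the row concerns only the components [(S, mn S)] with [S] a chain of [n] elements.
   The others are replaced by zero, so that the map really takes its values in the image. *)
move=> de; pose valid S (o : option P) := [&& chain S, #|S| == n & o == mn S].
pose ev u : fam M := fun S o => if valid S o then e S o u else 0.
have ev_lin : linear ev.
  move=> a u v; apply: functional_extensionality_dep => S.
  apply: functional_extensionality_dep => o.
  have -> : (a *: ev u + ev v) S o = a *: ev u S o + ev v S o by [].
  by rewrite /ev; case: ifP => _; rewrite ?linearP ?scaler0 ?addr0.
pose dv g : fam M := fun S o => if valid S o then delta rho g S o else 0.
have dv_lin : linear dv.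
  move=> a u v; apply: functional_extensionality_dep => S.
  apply: functional_extensionality_dep => o.
  have -> : (a *: dv u + dv v) S o = a *: dv u S o + dv v S o by [].
  by rewrite /dv; case: ifP => _; rewrite ?delta_linear ?scaler0 ?addr0.
pose V := imm (mklin dv_lin).
have evV u : ev u \in V.
  have [|g gP] := rows (n := n) (e := fun S o => e S o u).
    by move=> S Sc Sn; rewrite -delta_hom de.
  apply/in_submod; exists g; apply: functional_extensionality_dep => S.
  apply: functional_extensionality_dep => o; rewrite /= /ev /dv.
  by case: ifP => // /and3P[Sc /eqP Sn /eqP->]; apply: gP.
have dvV g : dv g \in V by apply/in_submod; exists g.
have ev'_lin : linear (fun u => Subm (evV u)).
  by move=> a u v; apply: val_inj; rewrite /= ev_lin.
have dv'_lin : linear (fun g => Subm (dvV g)).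
  by move=> a u v; apply: val_inj; rewrite /= dv_lin.
have [|g gP] := X_proj (p := mklin dv'_lin) (mklin ev'_lin).
  by move=> [v vV]; have /in_submod[g E] := vV; exists g; apply: val_inj.
have g_lin S o : linear (fun u => g u S o) by move=> a u v; rewrite linearP.
exists (fun S o => mklin (g_lin S o)) => S Sc Sn; apply: hom_ext => u.
have vS : valid S (mn S) by rewrite /valid Sc Sn !eqxx.
have := congr1 (fun v : subm V => val v S (mn S)) (gP u).
by rewrite /= /dv /ev vS delta_hom => <-.
Qed.
End HomRows.

Section ColimRows.
Variables (disp : Order.disp_t) (P : finPOrderType disp) (K : fieldType).
Variables (E : option P -> nat -> lmodType K).
Variable t : forall o N, {linear E o N -> E o N.+1}.
Variable rho : forall N o o', {linear E o' N -> E o N}.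
Hypothesis rho_t : forall N o o' u, rho N.+1 o o' (t o' N u) = t o N (rho N o o' u).
Hypothesis rows : forall N n (e : fam (E^~ N)),
  (forall S, chain S -> #|S| = n.+1 -> delta (rho N) e S (mn S) = 0) ->
  exists g, forall S, chain S -> #|S| = n -> e S (mn S) = delta (rho N) g S (mn S).

Definition colim_rho o o' : {linear colim (t o') -> colim (t o)} :=
  colim_map (fun N u => @rho_t N o o' u).

Lemma delta_cin N (e : fam (E^~ N)) S o :
  delta colim_rho (fun S o => cin (t o) N (e S o)) S o = cin (t o) N (delta (rho N) e S o).
Proof.
rewrite linear_sum; apply: eq_bigr => s _.
by rewrite linearZ /= colim_map_cin.
Qed.

Lemma delta_raise N m (e : fam (E^~ N)) S o : (N <= m)%N ->
  delta (rho m) (fun S o => raise (t o) N m (e S o)) S o = raise (t o) N m (delta (rho N) e S o).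
Proof.
move=> Nm; rewrite linear_sum; apply: eq_bigr => s _.
by rewrite linearZ /= (raise_map (fun N u => @rho_t N _ _ u)).
Qed.

(** There are only finitely many chains, hence a common stage where all components of [e] live, and
    a later one where all their coboundaries vanish. There the row is exact. *)
Lemma colim_rows n (e : fam (fun o => colim (t o))) :
    (forall S, chain S -> #|S| = n.+1 -> delta colim_rho e S (mn S) = 0) ->
  exists g, forall S, chain S -> #|S| = n -> e S (mn S) = delta colim_rho g S (mn S).
Proof.
move=> de.
have [||N NP] := @fin_stage ({set P} * option P)%type
    (fun So N => exists u, e So.1 So.2 = cin (t So.2) N u).
- move=> [S o] N m /= [u ->] Nm; exists (raise (t o) N m u); apply/esym; exact: cin_raise.
- by move=> [S o]; apply: colim_cin.
have [e1 e1P] : exists e1 : fam (E^~ N), forall S o, e S o = cin (t o) N (e1 S o).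
  exists (fun S o => sval (cid (NP (S, o)))) => S o.
  exact: (svalP (cid (NP (S, o)))).
have eE : e = fun S o => cin (t o) N (e1 S o).
  apply: functional_extensionality_dep => S.
  by apply: functional_extensionality_dep => o; apply: e1P.
have [||m mP] := @fin_stage {set P} (fun S m => (N <= m)%N /\ (chain S -> #|S| = n.+1 ->
    forall k, (m <= k)%N -> raise (t (mn S)) N k (delta (rho N) e1 S (mn S)) = 0)).
- move=> S m m' [Nm H] mm'; split; first exact: leq_trans mm'.
  by move=> Sc Sn k m'k; apply: H => //; apply: leq_trans m'k.
- move=> S; have [/andP[Sc /eqP Sn]|nS] := boolP (chain S && (#|S| == n.+1)).
    have := de S Sc Sn; rewrite eE delta_cin => /cin_eq0[m [Nm mP]].
    by exists m.
  by exists N; split=> // Sc Sn; move: nS; rewrite Sc Sn eqxx.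
have Nm : (N <= m)%N by have [] := mP set0.
have [S Sc Sn|g gP] := rows (N := m) (n := n) (e := fun S o => raise (t o) N m (e1 S o)).
  by rewrite delta_raise //; have [_] := mP S; apply.
exists (fun S o => cin (t o) m (g S o)) => S Sc Sn.
by rewrite delta_cin -gP // cin_raise.
Qed.
End ColimRows.

Section ProjSystemColim.
Variables (K : fieldType) (D : eqType) (E : nat -> lmodType K).
Variable t : forall n, {linear E n -> E n.+1}.
Variable p : D -> forall n, {linear E n -> E n}.
Hypothesis pt : forall a n u, p a n.+1 (t n u) = t n (p a n u).
Hypothesis pE : forall n, proj_system (p^~ n).

Definition colim_proj a : {linear colim t -> colim t} := colim_map (pt a).

Lemma proj_system_colim : proj_system colim_proj.
Proof.
split=> [a b c|S c Sc].
  have [n [u ->]] := colim_cin c; rewrite !colim_map_cin (pE n).1.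
  by case: eqP => // _; rewrite linear0.
have [n [u cu]] := colim_cin c; subst c.
suff /in_submod : u \in preimm (cin t n) S by [].
by apply: (pE n).2 => a; apply/in_submod; have := Sc a; rewrite colim_map_cin.
Qed.
End ProjSystemColim.

(** * The complex of local cohomology *)

Section LocalCohomologyComplex.
Variables (K : fieldType) (A : kalg K) (I : ideal A) (F : ext_tower I).
Variable M : lmodType A.

(* [lcx q] is the degree [q] part of a complex of [K]-modules computing the
   local cohomology of [M]. *)
Definition homs q N : lmodType K := kmod {linear F N q -> M}.
Definition homs_lift q N : {linear homs q N -> homs q N.+1} := kmap (precomp (tlift F N q)).
Definition lcx q : lmodType K := colim (homs_lift q).
Definition homs_diff q N : {linear homs q N -> homs q.+1 N} := kmap (precomp (pdiff (F N) q)).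

Fact homs_diff_lift q N u :
  homs_diff q N.+1 (homs_lift q N u) = homs_lift q.+1 N (homs_diff q N u).
Proof. by apply: hom_ext => v /=; rewrite tlift_diff. Qed.

Definition lcx_diff q : {linear lcx q -> lcx q.+1} := colim_map (@homs_diff_lift q).

Lemma lcx_diffK q u : lcx_diff q.+1 (lcx_diff q u) = 0.
Proof.
have [N [v ->]] := colim_cin u; rewrite !colim_map_cin -[RHS](linear0 (cin _ N)).
congr (cin _ N _); exact: (@Hom_diffK _ _ (F N) M q v).
Qed.

Local Notation HC N := (Hom_cochain (F N) M).
Definition exts q N : lmodType A := Ext (F N) M (Posz q).
Definition exts_lift q N : {linear exts q N -> exts q N.+1} :=
  Ext_map M (@tlift_diff _ I F N) (Posz q).
Local Notation H q := (kmod (loc_cohom F M (Posz q))).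
Local Notation cls N q := (subclass (cocyc (HC N) q) (cobound (HC N) q) : _ -> exts q N).

(** [loc_cohom] is a colimit of cohomology modules, while [lcx] is a colimit of complexes. A cocycle
    of [lcx] and a class are related when one cocycle at a finite stage gives both. The lemmas below
    identify the cohomology of [lcx] with local cohomology over [K]. *)
Definition rep q (z : lcx q) (c : H q) := exists N (f : subm (cocyc (HC N) q)),
  z = cin (homs_lift q) N (val f) /\ c = cin (exts_lift q) N (cls N q f).

Definition bounds q : lcx q -> Prop :=
  if q is q'.+1 then fun z => exists w, z = lcx_diff q' w else fun z => z = 0.

Lemma raise_class q N m (f : subm (cocyc (HC N) q)) : (N <= m)%N ->
  exists2 f' : subm (cocyc (HC m) q), val f' = raise (homs_lift q) N m (val f)
    & raise (exts_lift q) N m (cls N q f) = cls m q f'.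
Proof.
elim: m => [|m IHm].
  by rewrite leqn0 => /eqP N0; subst N; exists f; rewrite raise_id.
rewrite leq_eqVlt => /predU1P[E|Nm].
  by subst N; exists f; rewrite raise_id.
have [f' f'E clsE] := IHm Nm; rewrite (raiseS (exts_lift q)) // clsE [exts_lift q _ _]subquot_mapE.
by eexists; last reflexivity; rewrite (raiseS (homs_lift q)) // -f'E.
Qed.

Lemma rep_lin q k z c z' c' : rep z c -> rep z' c' ->
  @rep q (k *: z + z') (k *: c + c').
Proof.
move=> [N [f [-> ->]]] [N' [f' [-> ->]]]; pose m := maxn N N'.
have [f1 f1E cls1] := raise_class f (leq_maxl N N').
have [f2 f2E cls2] := raise_class f' (leq_maxr N N').
exists m, (kstr A k *: f1 + f2); split.
  have -> : val (kstr A k *: f1 + f2) = k *: (val f1 : homs q m) + val f2 :> homs q m by [].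
  by rewrite f1E f2E linearP !cin_raise ?leq_maxl ?leq_maxr.
rewrite [k *: _](_ : _ = kstr A k *: (cin (exts_lift q) N (cls N q f))) //.
rewrite -(cin_raise (exts_lift q) (cls N q f) (leq_maxl N N')) cls1.
rewrite -(cin_raise (exts_lift q) (cls N' q f') (leq_maxr N N')) cls2.
by rewrite (linearP (cls m q)) (linearP (cin (exts_lift q) m)).
Qed.

Lemma rep_cocycle q z c : rep z c -> lcx_diff q z = 0.
Proof.
move=> [N [f [-> _]]]; rewrite colim_map_cin -[RHS](linear0 (cin _ N)); congr (cin _ N _).
by have /in_submod := subm_valP f.
Qed.

Lemma rep_total q z : lcx_diff q z = 0 -> exists c, rep z c.
Proof.
have [N [u ->]] := colim_cin z; rewrite colim_map_cin => /cin_eq0[m [Nm mP]].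
have du : raise (homs_lift q) N m u \in cocyc (HC m) q.
  apply/asboolP; have := mP m (leqnn m).
  rewrite -(raise_map (@homs_diff_lift q)) // => E; exact: E.
exists (cin (exts_lift q) m (cls m q (Subm du))), m, (Subm du); split=> //.
by rewrite cin_raise.
Qed.

Lemma rep_surj q c : exists z, @rep q z c.
Proof.
have [N [e ->]] := colim_cin c; have [f ->] := subclass_surj e.
by exists (cin (homs_lift q) N (val f)), N, f.
Qed.

Lemma bounds_cin q N u : u \in cobound (HC N) q -> bounds (cin (homs_lift q) N u).
Proof.
case: q u => [|q] u /in_submod; first by move->; exact: (linear0 (cin (homs_lift 0) N)).
by move=> [w ->]; exists (cin (homs_lift q) N w); rewrite colim_map_cin.
Qed.

Lemma rep0 q z : @rep q z 0 -> bounds z.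
Proof.
move=> [N [f [-> /esym/cin_eq0[m [Nm /(_ m (leqnn m))]]]]].
have [f' f'E ->] := raise_class f Nm => /subclass_eq0; rewrite f'E => /bounds_cin.
by rewrite cin_raise.
Qed.

(** An equation [z = d w] in the colimit already holds at some finite stage, where the class of the
    representing cocycle therefore vanishes. *)
Lemma rep_bounds q z c : @rep q z c -> bounds z -> c = 0.
Proof.
move=> [N [f [-> ->]]] {z c} zB.
suff [m Nm mB] : exists2 m, (N <= m)%N &
    raise (homs_lift q) N m (val f) \in cobound (HC m) q.
  rewrite -(cin_raise (exts_lift q) _ Nm); have [f' f'E ->] := raise_class f Nm.
  have -> : cls m q f' = 0 by apply/subclass_eq0; rewrite f'E.
  exact: linear0.
case: q f zB => [|q] f.
  by rewrite /bounds => /cin_eq0[m [Nm mP]]; exists m => //; rewrite (mP m) //;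
     exact: (rpred0 (cobound (HC m) 0)).
move=> [w]; have [N' [v ->]] := colim_cin w; rewrite colim_map_cin.
rewrite -(cin_raise (homs_lift q.+1) (val f) (leq_maxl N N')).
rewrite -(cin_raise (homs_lift q.+1) (homs_diff q N' v) (leq_maxr N N')).
move/eqP; rewrite -subr_eq0 -linearB => /eqP/cin_eq0[m [Nm /(_ m (leqnn m)) E]].
exists m; first exact: leq_trans (leq_maxl N N') Nm.
apply/asboolP; exists (raise (homs_lift q) N' m v).
move: E; rewrite (linearB (raise (homs_lift q.+1) _ m)) !raise_trans ?leq_maxl ?leq_maxr // => /eqP.
rewrite subr_eq0 => /eqP E'; apply: (etrans E'); apply: esym.
apply: (raise_map (@homs_diff_lift q)).
exact: leq_trans (leq_maxr N N') Nm.
Qed.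

Section Projections.
Variables (D : eqType) (p : D -> forall q N, {linear homs q N -> homs q N}).
Hypothesis p_lift : forall a q N u, p a q N.+1 (homs_lift q N u) = homs_lift q N (p a q N u).
Hypothesis p_diff : forall a q N u, p a q.+1 N (homs_diff q N u) = homs_diff q N (p a q N u).

Definition lcx_proj a q : {linear lcx q -> lcx q} := colim_map (@p_lift a q).

Lemma lcx_proj_diff a q u : lcx_proj a q.+1 (lcx_diff q u) = lcx_diff q (lcx_proj a q u).
Proof. by have [N [v ->]] := colim_cin u; rewrite !colim_map_cin p_diff. Qed.

Lemma bounds_proj a q z : bounds z -> bounds (lcx_proj a q z).
Proof.
case: q z => [|q] z; first by move->; exact: (linear0 (lcx_proj a 0)).
by move=> [w ->]; exists (lcx_proj a q w); rewrite lcx_proj_diff.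
Qed.

Fact coh_proj_ex a q : exists f : {linear H q -> H q},
  forall z c, rep z c -> rep (lcx_proj a q z) (f c).
Proof.
pose r (c c' : H q) := exists2 z, rep z c & rep (lcx_proj a q z) c'.
have r_lin k v w v' w' : r v w -> r v' w' -> r (k *: v + v') (k *: w + w').
  move=> [z zv zw] [z' zv' zw']; exists (k *: z + z'); first exact: rep_lin.
  by rewrite linearP; apply: rep_lin.
have r_total v : exists w, r v w.
  have [z zv] := rep_surj v.
  have [|w zw] := @rep_total q (lcx_proj a q z); last by exists w, z.
  by rewrite -lcx_proj_diff (rep_cocycle zv) linear0.
have r_fun0 w : r 0 w -> w = 0.
  by move=> [z /rep0/(bounds_proj a) zB zw]; apply: rep_bounds zw zB.
have [f fP] := fun_of_linrel r_lin r_total r_fun0; exists f => z c zc.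
have [|w zw] := @rep_total q (lcx_proj a q z).
  by rewrite -lcx_proj_diff (rep_cocycle zc) linear0.
suff -> : f c = w by [].
by apply: (linrel_fun r_lin r_fun0 (fP c)); exists z.
Qed.
Definition coh_proj a q : {linear H q -> H q} := sval (cid (coh_proj_ex a q)).
Lemma coh_projP a q z c : rep z c -> rep (lcx_proj a q z) (coh_proj a q c).
Proof. exact: (svalP (cid (coh_proj_ex a q))). Qed.
End Projections.
End LocalCohomologyComplex.

(** * The splitting *)

Lemma fin_ltS (q : nat) (e : \bar int) :
  ((q.+1%:Z)%:E <= e)%O -> ((q%:Z)%:E < e)%O.
Proof. by case: e => [r| |] //; rewrite lee_fin lte_fin; apply: lt_le_trans; rewrite ltz_nat. Qed.

Lemma fin_leS (q : nat) (e : \bar int) :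
  ((q%:Z)%:E < e)%O -> ((q.+1%:Z)%:E < e)%O \/ (q.+1%:Z)%:E = e.
Proof.
case: e => [r| |] //; last by left; rewrite ltry.
rewrite lte_fin => qr; case: (ltgtP q.+1%:Z r) => [qr'|rq|->]; [by left| |by right].
by move: rq; rewrite ltNge -addn1 PoszD lezD1 qr.
Qed.

Section Splitting.
Variables (disp : Order.disp_t) (P : finPOrderType disp) (K : fieldType) (D : eqType).
Variables (G : option P -> nat -> lmodType K).
Variable d : forall o q, {linear G o q -> G o q.+1}.
Variable rho : forall q o o', {linear G o' q -> G o q}.
Variable p : D -> forall o q, {linear G o q -> G o q}.
Hypothesis rho_id : forall q o u, rho q o o u = u.
Hypothesis rho_comp : forall q o o' o'' u, ole o o' -> ole o' o'' ->
  rho q o o' (rho q o' o'' u) = rho q o o'' u.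
Hypothesis ddK : forall o q u, d o q.+1 (d o q u) = 0.
Hypothesis rho_d : forall q o o' u, ole o o' -> rho q.+1 o o' (d o' q u) = d o q (rho q o o' u).
Hypothesis rows : forall q n (e : fam (G^~ q)),
  (forall S, chain S -> #|S| = n.+1 -> delta (rho q) e S (mn S) = 0) ->
  exists g, forall S, chain S -> #|S| = n -> e S (mn S) = delta (rho q) g S (mn S).
Hypothesis p_sys : forall o q, proj_system (fun a => p a o q).
Hypothesis p_d : forall a o q u, p a o q.+1 (d o q u) = d o q (p a o q u).
Hypothesis p_rho : forall a q o o' u, ole o o' ->
  p a o q (rho q o o' u) = rho q o o' (p a o' q u).

(* [H o] is the cohomology of the complex [G o], given through the relation
   between the cocycles and the classes that they represent. *)
Variable H : option P -> int -> lmodType K.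
Variable pH : D -> forall o r, {linear H o r -> H o r}.
Variable rep : forall o q, G o q -> H o (Posz q) -> Prop.

Let bnd o q : G o q -> Prop :=
  if q is q'.+1 then fun z => exists w, z = d o q' w else fun z => z = 0.

Hypothesis H_neg : forall o n (c : H o (Negz n)), c = 0.
Hypothesis rep_lin : forall o q k z c z' c', rep z c -> rep z' c' ->
  @rep o q (k *: z + z') (k *: c + c').
Hypothesis rep_cocycle : forall o q z c, @rep o q z c -> d o q z = 0.
Hypothesis rep_total : forall o q z, d o q z = 0 -> exists c, @rep o q z c.
Hypothesis rep_surj : forall o q c, exists z, @rep o q z c.
Hypothesis rep0 : forall o q z, @rep o q z 0 -> bnd z.
Hypothesis rep_bnd : forall o q z c, @rep o q z c -> bnd z -> c = 0.
Hypothesis rep_p : forall a o q z c, rep z c -> @rep o q (p a o q z) (pH a o q c).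

Variable dim : P -> \bar int.
Hypothesis dim_mono : forall x y : P, (x < y)%O -> (dim x < dim y)%O.
Hypothesis H_dim : forall x r, (r%:E)%E != dim x -> forall c : H (Some x) r, c = 0.

(** All degrees of a column together, as required by [tot]; the total degree is recovered below by
    the truncations [theta]. *)
Let G' o : lmodType K := prodm (G o).

Let dt_fun o (u : G' o) : G' o := fun q => if q is q'.+1 then d o q' (u q') else 0.
Let dt_lin o : linear (@dt_fun o).
Proof.
move=> a u v; apply: functional_extensionality_dep => -[|q].
  by rewrite [RHS](_ : _ = a *: 0 + 0) // scaler0 addr0.
exact: (linearP (d o q)).
Qed.
Let dt o : {linear G' o -> G' o} := mklin (@dt_lin o).

Let rt_fun o o' (u : G' o') : G' o := fun q => rho q o o' (u q).
Let rt_lin o o' : linear (@rt_fun o o').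
Proof.
by move=> a u v; apply: functional_extensionality_dep => q; apply: (linearP (rho q o o')).
Qed.
Let rt o o' : {linear G' o' -> G' o} := mklin (@rt_lin o o').

Let pt_fun a o (u : G' o) : G' o := fun q => p a o q (u q).
Let pt_lin a o : linear (@pt_fun a o).
Proof.
by move=> k u v; apply: functional_extensionality_dep => q; apply: (linearP (p a o q)).
Qed.
Let pt a o : {linear G' o -> G' o} := mklin (@pt_lin a o).

Let rt_id o u : rt o o u = u.
Proof. by apply: functional_extensionality_dep => q; apply: rho_id. Qed.
Let rt_comp o o' o'' u : ole o o' -> ole o' o'' -> rt o o' (rt o' o'' u) = rt o o'' u.
Proof. by move=> h h'; apply: functional_extensionality_dep => q; apply: rho_comp. Qed.
Let dtK o u : dt o (dt o u) = 0.
Proof.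
apply: functional_extensionality_dep => -[|[|q]] //=; last exact: ddK.
exact: linear0.
Qed.
Let rt_d o o' u : ole o o' -> rt o o' (dt o' u) = dt o (rt o o' u).
Proof.
move=> h; apply: functional_extensionality_dep => -[|q]; last exact: rho_d.
exact: (linear0 (rho 0 o o')).
Qed.

Let delta_rt (e : fam G') S o q :
  delta rt e S o q = delta (rho q) (fun S o => e S o q) S o.
Proof. by rewrite /delta (prodm_sum (V := G o)). Qed.

Let rt_rows n (e : fam G') :
  (forall S, chain S -> #|S| = n.+1 -> delta rt e S (mn S) = 0) ->
  exists g, forall S, chain S -> #|S| = n -> e S (mn S) = delta rt g S (mn S).
Proof.
move=> de; have gP q : exists g : fam (G^~ q), forall S, chain S -> #|S| = n ->
    e S (mn S) q = delta (rho q) g S (mn S).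
  have [S Sc Sn|g gP] := rows (q := q) (n := n) (e := fun S o => e S o q).
    by rewrite -delta_rt de.
  by exists g.
exists (fun S o q => sval (cid (gP q)) S o) => S Sc Sn.
apply: functional_extensionality_dep => q; rewrite delta_rt.
exact: (svalP (cid (gP q))).
Qed.

(** Equivariant pseudo-inverses, chosen degree by degree. The last property expresses that [h] has
    degree -1 and allows identities to be checked in one degree at a time. *)
Let ht_ex o : exists h : {linear G' o -> G' o},
  [/\ forall u, dt o (h (dt o u)) = dt o u,
      forall a u, h (pt a o u) = pt a o (h u)
    & forall u v q, u q.+1 = v q.+1 -> h u q = h v q].
Proof.
have hq q := equiv_pseudo_inverse (p_sys o q) (p_sys o q.+1) (fun a u => esym (p_d a u)).
pose k q := sval (cid (hq q)).
have kP q := svalP (cid (hq q)).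
pose h (u : G' o) : G' o := fun q => k q (u q.+1).
have h_lin : linear h.
  by move=> a u v; apply: functional_extensionality_dep => q; apply: (linearP (k q)).
exists (mklin h_lin); split=> [u|a u|u v q] /=.
- by apply: functional_extensionality_dep => -[//|q]; apply: (kP q).1.
- by apply: functional_extensionality_dep => q; apply: (kP q).2.
- by rewrite /h => ->.
Qed.
Let ht o : {linear G' o -> G' o} := sval (cid (ht_ex o)).
Let ht_d o u : dt o (ht o (dt o u)) = dt o u.
Proof. by have [E _ _] := svalP (cid (ht_ex o)); apply: E. Qed.
Let ht_p a o u : ht o (pt a o u) = pt a o (ht o u).
Proof. by have [_ E _] := svalP (cid (ht_ex o)); apply: E. Qed.
Let ht_loc o u v q : u q.+1 = v q.+1 -> ht o u q = ht o v q.
Proof. by have [_ _ E] := svalP (cid (ht_ex o)); apply: E. Qed.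

Let dt_loc o (u v : G' o) q : u q = v q -> dt o u q.+1 = dt o v q.+1.
Proof. by move=> uv; rewrite /= /dt_fun uv. Qed.
Let dh_loc o (u v : G' o) q : u q = v q -> dt o (ht o u) q = dt o (ht o v) q.
Proof. by case: q => [//|q] uv; apply/dt_loc/ht_loc. Qed.
Let hd_loc o (u v : G' o) q : u q = v q -> ht o (dt o u) q = ht o (dt o v) q.
Proof. by move=> uv; apply/ht_loc/dt_loc. Qed.
Let dh0 o (u : G' o) q : u q = 0 -> dt o (ht o u) q = 0.
Proof. by move=> u0; rewrite (dh_loc (v := 0)) // !linear0. Qed.
Let hd0 o (u : G' o) q : u q = 0 -> ht o (dt o u) q = 0.
Proof. by move=> u0; rewrite (hd_loc (v := 0)) // !linear0. Qed.

Let dh_proj o u : dt o (ht o (u - dt o (ht o u))) = 0.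
Proof. by rewrite (linearB (ht o)) (linearB (dt o)) ht_d subrr. Qed.

Let subG o (u v : G' o) q : (u - v) q = u q - v q. Proof. by []. Qed.

Let bnd_dh o (u : G' o) q : bnd (u q) -> dt o (ht o u) q = u q.
Proof.
case: q => [|q] /=; first by move->.
move=> [w uw]; pose v : G' o := fun k => if k =P q is ReflectT E
  then ecast i (G o i) (esym E) w else 0.
have vq : v q = w by rewrite /v; case: eqP => // E; rewrite (eq_axiomK E).
have uE : u q.+1 = dt o v q.+1 by rewrite uw /= /dt_fun vq.
by apply: etrans (dh_loc uE) _; rewrite ht_d.
Qed.

Let bnd_of_dt o (v : G' o) q : bnd (dt o v q).
Proof. by case: q => [//|q]; exists (v q). Qed.

Let acyclic x (u : G' (Some x)) q : (q%:Z)%:E != dim x -> d _ q (u q) = 0 -> bnd (u q).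
Proof.
move=> qx /rep_total[c uc]; apply: rep0; move: (uc); rewrite (H_dim qx c) //.
Qed.

(* [ht] is a pseudo-inverse of [dt], so that [u - dt (ht u)] is a projection onto
   a complement of the coboundaries. The complex [Gp x] is zero below degree
   [dim x], equal to such a complement in degree [dim x] and to [G' x] above;
   its inclusion is a quasi-isomorphism by [H_dim]. As [dim] is strictly
   increasing, [rt] preserves these subcomplexes and, for [x < y], it kills the
   degree [dim x], hence the class extracted by [s]. *)
Definition in_Gp x (u : G' (Some x)) := forall q : nat,
  (((q%:Z)%:E < dim x)%O -> u q = 0) /\
  ((q%:Z)%:E = dim x -> dt (Some x) (ht (Some x) u) q = 0).

Let in_Gp0 x : in_Gp (0 : G' (Some x)).
Proof. by move=> q; split=> // _; rewrite !linear0. Qed.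
Let in_Gp_lin x a u v : in_Gp u -> in_Gp v -> in_Gp (a *: u + v : G' (Some x)).
Proof.
move=> uG vG q; have [u1 u2] := uG q; have [v1 v2] := vG q; split=> qx.
  by rewrite [LHS](_ : _ = a *: u q + v q) // u1 // v1 // scaler0 addr0.
rewrite !linearP [LHS](_ : _ = a *: dt _ (ht _ u) q + dt _ (ht _ v) q) //.
by rewrite u2 // v2 // scaler0 addr0.
Qed.
Let Gp o : submodClosed (G' o) :=
  if o is Some x then submod_of (@in_Gp0 x) (@in_Gp_lin x) else zerom.
Let GpP x u : reflect (in_Gp u) (u \in Gp (Some x)). Proof. exact: in_submod. Qed.

Let Gp_None u : u \in Gp None -> u = 0. Proof. by move=> /in_submod. Qed.

Let Gp_d o u : u \in Gp o -> dt o u \in Gp o.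
Proof.
case: o u => [x|] u; last by move=> /Gp_None->; rewrite linear0 rpred0.
move=> /GpP uG; apply/GpP => -[|q]; first by split=> // _; rewrite dh0.
split=> [qx|qx]; first by rewrite /= /dt_fun (uG q).1 ?linear0 ?fin_ltS // ltW.
by rewrite ht_d /= /dt_fun (uG q).1 ?linear0 ?fin_ltS // qx.
Qed.

Let Gp_rho x y u : (x < y)%O -> u \in Gp (Some y) -> rt (Some x) (Some y) u \in Gp (Some x).
Proof.
move=> xy /GpP uG; apply/GpP => q; split=> qx.
  by rewrite /= /rt_fun (uG q).1 ?linear0 // (lt_trans qx) ?dim_mono.
by rewrite dh0 //= /rt_fun (uG q).1 ?linear0 // qx dim_mono.
Qed.

Let Gp_qis x u : dt (Some x) u \in Gp (Some x) -> exists v, u - dt _ v \in Gp (Some x).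
Proof.
move=> /GpP duG; exists (ht _ u); apply/GpP => q; split=> qx; last first.
  by rewrite dh_proj.
rewrite subG bnd_dh ?subrr //; apply: acyclic; first by rewrite lt_eqF.
(* In the degree just below [dim x], [dt u] is a boundary lying in the complement of the boundaries,
   hence zero by [ht_d]. *)
case: (fin_leS qx) => [/(duG q.+1).1 //|/(duG q.+1).2].
by rewrite ht_d.
Qed.

(** The dimension is an argument [e], so that a case analysis on it does not meet types depending on
    [dim x]. *)
Definition coh_at x (e : \bar int) : lmodType K :=
  if e is r%:E then H (Some x) r else zeromod K.
Definition coh_at_proj a x e : {linear coh_at x e -> coh_at x e} :=
  if e is r%:E as e return {linear coh_at x e -> coh_at x e}
  then pH a (Some x) r else idfun.

Let zeromod0 (v : zeromod K) : v = 0. Proof. by apply/rowP => -[]. Qed.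

Let bnd0 o q : @bnd o q 0.
Proof. by case: q => [//|q]; exists 0; rewrite linear0. Qed.

(** [s u] is the class of [u - ht (dt u)] in degree [e]. This is a projection onto the cocycles, so
    [s] is defined on all of [G' (Some x)]. *)
Let s_ex x e : exists s : {linear G' (Some x) -> coh_at x e},
  [/\ forall u, (forall q, (q%:Z)%:E = e -> bnd (u q - ht _ (dt _ u) q)) -> s u = 0,
      forall u, s u = 0 -> forall q, (q%:Z)%:E = e -> bnd (u q - ht _ (dt _ u) q),
      forall m, exists u : G' (Some x), [/\ forall q, (q%:Z)%:E != e -> u q = 0,
        forall q, d _ q (u q) = 0 & s u = m]
    & forall a u, s (pt a _ u) = coh_at_proj a x e (s u)].
Proof.
(* If [e] is infinite or negative, there is no degree to read and the target is zero. *)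
have triv (V : lmodType K) (pV : D -> {linear V -> V}) : (forall v : V, v = 0) ->
  (forall q, (q%:Z)%:E != e) -> exists s : {linear G' (Some x) -> V},
  [/\ forall u, (forall q, (q%:Z)%:E = e -> bnd (u q - ht _ (dt _ u) q)) -> s u = 0,
      forall u, s u = 0 -> forall q, (q%:Z)%:E = e -> bnd (u q - ht _ (dt _ u) q),
      forall m, exists u : G' (Some x), [/\ forall q, (q%:Z)%:E != e -> u q = 0,
        forall q, d _ q (u q) = 0 & s u = m]
    & forall a u, s (pt a _ u) = pV a (s u)].
  move=> V0 qe; exists (zero_hom _ _); split=> [//|u _ q /eqP|m|a u].
  - by rewrite (negPf (qe q)).
  - by exists (0 : G' (Some x)); split=> // *; first [exact: linear0 | rewrite [RHS]V0].
  - by rewrite [RHS]V0.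
case: e triv => [[q|n]| |] triv.
- pose cz (u : G' (Some x)) := u q - ht _ (dt _ u) q.
  have czD k u v : cz (k *: u + v) = k *: cz u + cz v.
    rewrite /cz (linearP (dt _)) (linearP (ht _)).
    have -> : (k *: u + v) q = k *: u q + v q by [].
    have -> : (k *: ht _ (dt _ u) + ht _ (dt _ v)) q =
      k *: ht _ (dt _ u) q + ht _ (dt _ v) q by [].
    by rewrite opprD addrACA scalerBr.
  have cz_cocycle u : d _ q (cz u) = 0.
    apply/eqP; rewrite linearB subr_eq0; apply/eqP.
    by have /(congr1 (fun v : G' _ => v q.+1)) := ht_d u.
  have [||c c0|s sP] := @fun_of_linrel K _ _ (fun u c => @rep (Some x) q (cz u) c).
  + by move=> k u c u' c' uc uc'; rewrite czD; apply: rep_lin.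
  + by move=> u; apply: rep_total.
  + apply: rep_bnd c0 _; rewrite /cz (linear0 (dt _)) (linear0 (ht _)) subrr.
    exact: bnd0.
  exists s; split=> [u|u su q' [qq]|m|a u].
  + by move=> /(_ q erefl); apply: rep_bnd (sP u).
  + by subst q'; have := sP u; rewrite su => /rep0.
  + have [z zm] := rep_surj m.
    pose u : G' (Some x) := fun k => if k =P q is ReflectT E
      then ecast i (G (Some x) i) (esym E) z else 0.
    have uq : u q = z by rewrite /u; case: eqP => // E; rewrite (eq_axiomK E).
    have u0 k : k != q -> u k = 0 by rewrite /u; case: eqP.
    have du k : d _ k (u k) = 0.
      have [->|/u0->] := eqVneq k q; last exact: linear0.
      by rewrite uq (rep_cocycle zm).
    exists u; split=> //.
    have czu : cz u = z.
      rewrite /cz uq -[RHS]subr0; congr (_ - _).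
      rewrite (ht_loc (v := (0 : G' (Some x)))) ?linear0 //=; exact: du.
    apply/eqP; rewrite -subr_eq0; apply/eqP; apply: (rep_bnd (z := 0)).
      have := rep_lin (-1) zm (sP u); rewrite czu !scaleN1r addNr addrC; exact.
    exact: bnd0.
  + apply/eqP; rewrite -subr_eq0; apply/eqP; apply: (rep_bnd (z := 0)).
      have := rep_lin (-1) (rep_p a (sP u)) (sP (pt a _ u)); rewrite !scaleN1r addrC.
      have -> : cz (pt a _ u) = p a _ q (cz u).
        rewrite /cz linearB; congr (_ - _).
        have -> : dt _ (pt a _ u) = pt a _ (dt _ u).
          apply: functional_extensionality_dep => -[|k].
            exact: (esym (linear0 (p a _ 0))).
          exact: (esym (p_d a (u k))).
        by rewrite ht_p.
      by rewrite subrr addrC.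
    exact: bnd0.
- by apply: (triv _ (fun a => pH a (Some x) (Negz n))) => //; apply: H_neg.
- exact: (triv _ (fun a => idfun) zeromod0).
- exact: (triv _ (fun a => idfun) zeromod0).
Qed.
Let s x : {linear G' (Some x) -> coh_at x (dim x)} := sval (cid (s_ex x (dim x))).
Let s_zero x u : (forall q, (q%:Z)%:E = dim x -> bnd (u q - ht _ (dt _ u) q)) -> s x u = 0.
Proof. by have [E _ _ _] := svalP (cid (s_ex x (dim x))); apply: E. Qed.
Let s_bnd x u : s x u = 0 -> forall q, (q%:Z)%:E = dim x -> bnd (u q - ht _ (dt _ u) q).
Proof. by have [_ E _ _] := svalP (cid (s_ex x (dim x))); apply: E. Qed.
Let s_lift x m : exists u : G' (Some x), [/\ forall q, (q%:Z)%:E != dim x -> u q = 0,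
  forall q, d _ q (u q) = 0 & s x u = m].
Proof. by have [_ _ E _] := svalP (cid (s_ex x (dim x))); apply: E. Qed.
Let s_p a x u : s x (pt a _ u) = coh_at_proj a x (dim x) (s x u).
Proof. by have [_ _ _ E] := svalP (cid (s_ex x (dim x))); apply: E. Qed.

Let s_loc0 x u : (forall q, (q%:Z)%:E = dim x -> u q = 0) -> s x u = 0.
Proof. by move=> u0; apply: s_zero => q qx; rewrite u0 // hd0 ?u0 // subrr. Qed.

Let s_d x u : u \in Gp (Some x) -> s x (dt _ u) = 0.
Proof. by move=> _; apply: s_zero => q _; rewrite dtK linear0 subr0; apply: bnd_of_dt. Qed.

Let s_rho x y u : (x < y)%O -> u \in Gp (Some y) -> s x (rt (Some x) (Some y) u) = 0.
Proof.
move=> xy /GpP uG; apply: s_loc0 => q qx.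
by rewrite /= /rt_fun (uG q).1 ?linear0 // qx dim_mono.
Qed.

(** The cocycle [u] is a boundary in degree [dim x] because [s u = 0], and in the other degrees by
    [H_dim]. Its primitive [ht u] is moved into [Gp] by subtracting a boundary. *)
Let s_inj x u : u \in Gp (Some x) -> dt _ u = 0 -> s x u = 0 ->
  exists2 v, v \in Gp (Some x) & u = dt _ v.
Proof.
move=> /GpP uG du su; pose v := ht _ u - dt _ (ht _ (ht _ u)).
have dv : dt _ v = dt _ (ht _ u) by rewrite (linearB (dt _)) dtK subr0.
have uE : u = dt _ (ht _ u).
  apply: functional_extensionality_dep => q; rewrite bnd_dh //.
  have [qx|qx] := eqVneq (q%:Z)%:E (dim x); last first.
    by apply: acyclic => //; have /(congr1 (fun w : G' _ => w q.+1)) := du.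
  by have := s_bnd su qx; rewrite du linear0 subr0.
exists v; last by rewrite dv.
apply/GpP => q; split=> qx; last first.
  by rewrite dh_proj.
(* If [q + 1 = dim x], then [u] is in that degree both a boundary and in the complement of the
   boundaries. *)
have u0 : u q.+1 = 0.
  case: (fin_leS qx) => [/(uG q.+1).1 //|/(uG q.+1).2].
  by rewrite -uE.
have hu0 : ht _ u q = 0 by rewrite (ht_loc (v := (0 : G' (Some x)))) ?linear0.
by rewrite /v subG hu0 dh0 // subr0.
Qed.

Let s_surj x m : exists z, [/\ z \in Gp (Some x), dt _ z = 0 & s x z = m].
Proof.
have [u [u0 du <-]] := s_lift m; exists (u - dt _ (ht _ u)).
have dtu : dt _ u = 0.
  by apply: functional_extensionality_dep => -[//|q]; apply: du.
split.
- apply/GpP => q; split=> qx; last first.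
    by rewrite dh_proj.
  have uq : u q = 0 by rewrite u0 // lt_eqF.
  by rewrite subG uq dh0 // subr0.
- by rewrite (linearB (dt _)) dtK subr0.
rewrite linearB [X in _ - X](_ : _ = 0) ?subr0 //; apply: s_zero => q _.
by rewrite dtK linear0 subr0; apply: bnd_of_dt.
Qed.

(** [n] counts the vertices above [x]; the corresponding simplices have dimension [i - r - 1]. *)
Definition valid (i : int) (e : \bar int) (n : nat) := exists2 r, e = r%:E%E & n%:Z = i - r.

Definition summ x (i : int) (e : \bar int) : lmodType K :=
  if e is r%:E then tensor (red_cohom K (above x) (i - r - 1)) (H (Some x) r) else zeromod K.
Definition summ_proj a x i e : {linear summ x i e -> summ x i e} :=
  if e is r%:E as e return {linear summ x i e -> summ x i e}
  then tensor_map (red_cohom K (above x) (i - r - 1)) (pH a (Some x) r) else idfun.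

Let tau_spec x i e (tau : ({set P} -> coh_at x e) -> summ x i e) :=
  [/\ forall k t t', tau (fun S => k *: t S + t' S) = k *: tau t + tau t',
      forall t t', (forall n S, valid i e n -> is_face (above x) n S -> t S = mdelta t' S) ->
        tau t = 0,
      forall q, exists2 t,
        forall n S, valid i e n -> is_face (above x) n.+1 S -> mdelta t S = 0 & tau t = q,
      forall t, (forall n S, valid i e n -> is_face (above x) n.+1 S -> mdelta t S = 0) ->
        tau t = 0 ->
        exists t', forall n S, valid i e n -> is_face (above x) n S -> t S = mdelta t' S
    & forall a t, tau (fun S => coh_at_proj a x e (t S)) = summ_proj a x i e (tau t)].

Let tau_ex x i e : exists tau, @tau_spec x i e tau.
Proof.
have infinite : (forall r, e <> r%:E%E) -> (forall w : summ x i e, w = 0) ->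
    exists tau, @tau_spec x i e tau.
  move=> e_inf w0; exists (fun=> 0); split=> [k t t'|//|q|t _ _|a t].
  - by rewrite [RHS]w0.
  - by exists (fun=> 0) => [n S [r /e_inf]//|]; rewrite [RHS]w0.
  - by exists t => n S [r /e_inf].
  - by rewrite [RHS]w0.
case: e infinite => [r _|H0|H0]; try exact: H0.
have [l lP] := kuenneth K (above x) (i - r - 1 + 1).
have [l1 l2 l3] := lP (H (Some x) r).
have validE n : n%:Z = i - r - 1 + 1 <-> valid i r%:E n.
  rewrite subrK; split=> [nr|[r' [<-] //]]; by exists r.
exists (fun t => \sum_S tens (l S) (t S)); split.
- move=> k t t'; rewrite scaler_sumr -big_split /=; apply: eq_bigr => S _.
  exact: tensl_linear.
- by move=> t t' tt'; apply: l1 => n S /validE; apply: tt'.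
- move=> q; have [t dt0 tq] := l2 q; exists t => // n S /validE; exact: dt0.
- move=> t dt0 t0; have [|t' tt'] := l3 t _ t0.
    by move=> n S /validE; apply: dt0.
  by exists t' => n S /validE; apply: tt'.
- by move=> a t; rewrite /= linear_sum; apply: eq_bigr => S _; rewrite tensor_map_tens.
Qed.

Let upper_face (x : P) n S : is_face (above x) n S = upper_chain x S && (#|S| == n).
Proof.
rewrite /is_face /upper_chain /chain.
by case: (S \subset _); case: (#|S| == n); rewrite ?andbT ?andbF.
Qed.

Section Degree.
Variable i : nat.

Let tau x := sval (cid (tau_ex x (Posz i) (dim x))).
Let tau_lin x k t t' : tau (x := x) (fun S => k *: t S + t' S) = k *: tau t + tau t'.
Proof. by have [E _ _ _ _] := svalP (cid (tau_ex x (Posz i) (dim x))); apply: E. Qed.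
Let tau_zero x t t' : (forall n S, valid i (dim x) n -> is_face (above x) n S ->
  t S = mdelta t' S) -> tau (x := x) t = 0.
Proof. by have [_ E _ _ _] := svalP (cid (tau_ex x (Posz i) (dim x))); apply: E. Qed.
Let tau_surj x q : exists2 t, forall n S, valid i (dim x) n -> is_face (above x) n.+1 S ->
  mdelta t S = 0 & tau (x := x) t = q.
Proof. by have [_ _ E _ _] := svalP (cid (tau_ex x (Posz i) (dim x))); apply: E. Qed.
Let tau_inj x t : (forall n S, valid i (dim x) n -> is_face (above x) n.+1 S -> mdelta t S = 0) ->
  tau (x := x) t = 0 -> exists t', forall n S, valid i (dim x) n -> is_face (above x) n S ->
  t S = mdelta t' S.
Proof. by have [_ _ _ E _] := svalP (cid (tau_ex x (Posz i) (dim x))); apply: E. Qed.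
Let tau_p a x t : tau (x := x) (fun S => coh_at_proj a x (dim x) (t S)) =
  summ_proj a x i (dim x) (tau t).
Proof. by have [_ _ _ _ E] := svalP (cid (tau_ex x (Posz i) (dim x))); apply: E. Qed.

Let mdelta0 (V : lmodType K) S : mdelta (fun _ : {set P} => 0 : V) S = 0.
Proof. by apply: big1 => y _; rewrite scaler0. Qed.

Let tau_ext x t t' : (forall n S, valid i (dim x) n -> is_face (above x) n S -> t S = t' S) ->
  tau (x := x) t = tau t'.
Proof.
move=> tt'; apply/eqP; rewrite -subr_eq0; apply/eqP.
have := tau_lin (-1) t' t; rewrite scaleN1r addrC => <-.
apply: (@tau_zero x _ (fun=> 0)) => n S nx FS.
by rewrite mdelta0 (tt' n) // scaleN1r addNr.
Qed.

Let T := tot rt dt.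
Let lw (g : fam G') x := low s (T g) x.

Let T_lin k g g' : T (k *: g + g') = k *: T g + T g'.
Proof. exact: (linearP (tot rt dt)). Qed.

Let TE (g : fam G') S o q : T g S o q =
  (-1) ^+ #|S| *: dt o (g S o) q + delta (rho q) (fun S o => g S o q) S o.
Proof. by rewrite -delta_rt. Qed.

(** The part of total degree [k]. A good family may have components in all total degrees; [T] raises
    the total degree by one, so its homogeneous parts are again good. *)
Let theta k (g : fam G') : fam G' := fun S o q => if (q + #|S| == k)%N then g S o q else 0.

Let T_theta k g S o q : T (theta k g) S o q = theta k.+1 (T g) S o q.
Proof.
rewrite {2}/theta !TE; have -> : delta (rho q) (fun S o => theta k g S o q) S o =
    if (q + #|S| == k.+1)%N then delta (rho q) (fun S o => g S o q) S o else 0.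
  rewrite /delta; case: ifP => qS; last first.
    apply: big1 => y yS; rewrite /theta ifN ?linear0 ?scaler0 //.
    by apply: contraFneq qS => <-; rewrite [in X in X == _](cardsD1 y) yS add1n addnS.
  apply: eq_bigr => y yS; rewrite /theta ifT //.
  by move: qS; rewrite (cardsD1 y) yS add1n addnS eqSS.
case: q => [|q]; first by rewrite /= scaler0 !add0r.
rewrite /= /dt_fun /theta addSn eqSS; case: ifP => // _.
by rewrite linear0 scaler0 addr0.
Qed.

Let Gp_trunc o (u : G' o) (b : pred nat) : u \in Gp o ->
  ((fun q => if b q then u q else 0) : G' o) \in Gp o.
Proof.
case: o u => [x|] u; last first.
  move=> /Gp_None->; have E : ((fun q => if b q then (0 : G' None) q else 0) : G' None) = 0.
    by apply: functional_extensionality_dep => q; case: ifP.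
  exact: (eq_ind_r (fun v => v \in Gp None) (rpred0 _) E).
move=> /GpP uG; apply/GpP => q; have [u1 u2] := uG q; split=> qx.
  by rewrite u1 // if_same.
case bq: (b q); last by rewrite dh0 ?bq.
by rewrite (dh_loc (v := u)) ?bq ?u2.
Qed.

Let good_theta k g : good rt dt Gp g -> good rt dt Gp (theta k g).
Proof.
move=> gG S Sc; rewrite [X in X \in _](_ : _ =
    (fun q => if (q + #|S| == k.+1)%N then T g S (mn S) q else 0)).
  by apply: Gp_trunc; apply: gG.
by apply: functional_extensionality_dep => q; apply: T_theta.
Qed.

Let s_loc x (u v : G' (Some x)) : (forall q, (q%:Z)%:E%E = dim x -> u q = v q) -> s x u = s x v.
Proof.
move=> uv; apply/eqP; rewrite -subr_eq0 -linearB; apply/eqP/s_loc0 => q qx.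
by rewrite subG uv ?subrr.
Qed.

Let low_theta g x S : upper_chain x S ->
  lw (theta i g) x S = if `[< valid i (dim x) #|S| >] then lw g x S else 0.
Proof.
move=> xS; have cardxS : #|x |: S| = #|S|.+1 by rewrite cardsU1 (upper_notin xS).
have validE q : (q%:Z)%:E%E = dim x -> (q + #|S| == i)%N = `[< valid i (dim x) #|S| >].
  move=> qx; apply/eqP/asboolP => [<-|[r]].
    by exists q%:Z; rewrite // PoszD addrAC subrr add0r.
  by rewrite -qx => -[<-] /eqP; rewrite eq_sym subr_eq -PoszD eqz_nat addnC => /eqP.
case: asboolP => [vx|nvx]; last first.
  apply: s_loc0 => q qx; rewrite T_theta /theta cardxS addnS eqSS validE //.
  by case: asboolP.
apply: s_loc => q qx; rewrite T_theta /theta cardxS addnS eqSS validE //.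
by case: asboolP.
Qed.

Let lw_lin k g g' x S : lw (k *: g + g') x S = k *: lw g x S + lw g' x S.
Proof.
rewrite /lw /low T_lin.
exact: (linearP (s x) k (T g (x |: S) (Some x)) (T g' (x |: S) (Some x))).
Qed.

Let lw_cocycle g : good rt dt Gp g -> forall x S, upper_chain x S -> mdelta (lw g x) S = 0.
Proof.
move=> gG x S xS; exact: (core_cocycle rt_id rt_comp dtK rt_d Gp_None s_d s_rho gG xS).
Qed.

(** The graph of the connecting map: [c] is represented by [g] on the empty chain, and [w] collects
    the classes of the low parts of [T g]. *)
Let r (c : H None i) (w : prodm (fun x => summ x i (dim x))) := exists g : fam G',
  [/\ good rt dt Gp g, rep (g set0 None i) c & forall x, w x = tau (lw g x)].

Let r_lin k c w c' w' : r c w -> r c' w' -> r (k *: c + c') (k *: w + w').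
Proof.
move=> [g [gG gc gw]] [g' [gG' gc' gw']]; exists (k *: g + g'); split.
- by move=> S Sc; rewrite -/T T_lin; apply: rpredD; [apply/rpredZ/gG | apply: gG'].
- exact: rep_lin.
move=> x; rewrite [LHS](_ : _ = k *: w x + w' x) // gw gw' -tau_lin.
by apply: tau_ext => n S _ _; rewrite lw_lin.
Qed.

Let at_i (z : G None i) : exists2 u : G' None, u i = z & forall q, q != i -> u q = 0.
Proof.
exists (fun k => if k =P i is ReflectT E then ecast j (G None j) (esym E) z else 0).
  by case: eqP => // E; rewrite (eq_axiomK E).
by move=> q; case: eqP.
Qed.

Let r_total c : exists w, r c w.
Proof.
have [z zc] := rep_surj c; have [u ui u0] := at_i z.
have du : dt None u = 0.
  apply: functional_extensionality_dep => -[//|q]; rewrite /= /dt_fun.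
  have [E|/u0->] := eqVneq q i; last exact: linear0.
  by subst q; rewrite ui (rep_cocycle zc).
have [g gG gu] := core_total rt_id rt_comp dtK rt_d Gp_None Gp_d Gp_rho Gp_qis du.
exists (fun x => tau (lw g x)), g; split=> //.
by rewrite gu ui.
Qed.

Let good_rep g : good rt dt Gp g -> exists c, rep (g set0 None i) c.
Proof.
move=> gG; apply: rep_total.
have := gG _ (chain0 P); rewrite mn0 => /Gp_None; rewrite tot_set0.
by move/(congr1 (fun u : G' None => u i.+1)).
Qed.

Let r_surj w : exists c, r c w.
Proof.
have tP x := tau_surj (w x).
pose t x : {set P} -> coh_at x (dim x) := s2val (cid2 (tP x)).
have dt0 x n S : valid i (dim x) n -> is_face (above x) n.+1 S -> mdelta (t x) S = 0.
  exact: (s2valP (cid2 (tP x))).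
have tw x : tau (t x) = w x by exact: (s2valP' (cid2 (tP x))).
(* [core_surj] asks for a cocycle on upper chains of every size, while [tau_surj] controls only one
   size; extension by zero bridges this. *)
pose t' x (S : {set P}) := if `[< valid i (dim x) #|S| >] then t x S else 0.
have [x S xS|g gG gt] := core_surj rt_id rt_comp dtK rt_d rt_rows Gp_None Gp_d Gp_rho
    s_d s_rho s_inj s_surj (t := t').
  case: (set_0Vmem S) => [->|[y yS]]; first exact: big_set0.
  have cS z : z \in S -> #|S :\ z| = #|S|.-1 by move=> zS; rewrite (cardsD1 z S) zS.
  case: (pselect (valid i (dim x) #|S|.-1)) => vx.
    rewrite -[RHS](dt0 x _ S vx); last first.
      rewrite upper_face xS prednK ?eqxx //.
      by apply/card_gt0P; exists y.
    by apply: eq_bigr => z zS; rewrite /t' cS //; case: asboolP.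
  apply: big1 => z zS; rewrite /t' cS //.
  by case: asboolP => // _; rewrite scaler0.
have [c gc] := good_rep gG; exists c, g; split=> // x.
rewrite -tw; apply: tau_ext => n S vx; rewrite upper_face => /andP[xS /eqP Sn].
by rewrite /lw gt // /t' Sn; case: asboolP.
Qed.

Let theta_set0 g q : theta i g set0 None q = if q == i then g set0 None q else 0.
Proof. by rewrite /theta cards0 addn0. Qed.

Let tau_theta g x : tau (lw (theta i g) x) = tau (lw g x).
Proof.
apply: tau_ext => n S vx; rewrite upper_face => /andP[xS /eqP Sn].
by rewrite low_theta // Sn; case: asboolP.
Qed.

Let r_fun0 w : r 0 w -> w = 0.
Proof.
move=> [g [gG /rep0 gB gw]]; apply: functional_extensionality_dep => x.
(* Only the component of degree [i] on the empty chain is known to be a boundary, so the others are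
   removed by truncation. *)
have gv : theta i g set0 None = dt None (ht None (theta i g set0 None)).
  apply: functional_extensionality_dep => q; rewrite bnd_dh //.
  by rewrite theta_set0; case: eqP => [->|_]; [apply: gB | apply: bnd0].
have [t tP] := core_wd rt_id rt_comp dtK rt_d Gp_None Gp_d Gp_rho Gp_qis s_d s_rho
  (good_theta i gG) gv x.
rewrite gw -tau_theta; apply: (tau_zero (t' := t)) => n S _.
by rewrite upper_face => /andP[xS _]; apply: tP.
Qed.

Let r_inj c : r c 0 -> c = 0.
Proof.
move=> [g [gG gc gw]]; apply: rep_bnd gc _.
have tP x : exists t, forall S, upper_chain x S -> lw (theta i g) x S = mdelta t S.
  have [|t tP] := tau_inj (x := x) (t := lw g x) _ (esym (gw x)).
    by move=> n S _; rewrite upper_face => /andP[xS _]; apply: lw_cocycle.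
  (* The primitive is kept only on chains with one vertex less than the size that matters, so that
     its coboundary vanishes in the other sizes, as the low part of [theta i g] does. *)
  exists (fun S : {set P} => if `[< valid i (dim x) #|S|.+1 >] then t S else 0) => S xS.
  rewrite low_theta //; case: (set_0Vmem S) => [S0|[y yS]].
    rewrite /mdelta S0 big_set0; case: asboolP => // vx.
    rewrite (tP _ _ vx); first by rewrite /mdelta big_set0.
    by rewrite upper_face -S0 xS eqxx.
  have cS z : z \in S -> #|S :\ z|.+1 = #|S| by move=> zS; rewrite (cardsD1 z S) zS.
  case: asboolP => vx.
    rewrite (tP _ _ vx) ?upper_face ?xS ?eqxx //.
    by apply: eq_bigr => z zS; rewrite cS //; case: asboolP.
  apply/esym/big1 => z zS; rewrite cS //.
  by case: asboolP => // _; rewrite scaler0.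
have [v gv] := core_inj rt_id rt_comp dtK rt_d rt_rows Gp_None Gp_d Gp_rho s_d s_rho s_inj s_surj
  (good_theta i gG) tP.
have := congr1 (fun u : G' None => u i) gv; rewrite theta_set0 eqxx => ->.
exact: bnd_of_dt.
Qed.

(** The projection is applied to the witness [g]. It preserves [Gp] because [ht], which defines the
    complements, was chosen equivariant. *)
Let r_proj a c w : r c w ->
  r (pH a None i c) (fun x => summ_proj a x i (dim x) (w x)).
Proof.
move=> [g [gG gc gw]]; pose g' : fam G' := fun S o => pt a o (g S o).
have Tg' S : chain S -> T g' S (mn S) = pt a (mn S) (T g S (mn S)).
  move=> Sc; rewrite /T /tot linearD; congr (_ + _).
    rewrite linearZ; congr (_ *: _); apply: functional_extensionality_dep => -[|q].
      exact: (esym (linear0 (p a _ 0))).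
    exact: (esym (p_d a (g S (mn S) q))).
  rewrite /delta linear_sum; apply: eq_bigr => y yS; rewrite linearZ; congr (_ *: _).
  apply: functional_extensionality_dep => q; apply: esym; apply: p_rho.
  by rewrite ole_mn ?subD1set.
have Gp_p o u : u \in Gp o -> pt a o u \in Gp o.
  case: o u => [x|] u; last by move=> /Gp_None->; rewrite linear0 rpred0.
  move=> /GpP uG; apply/GpP => q; have [u1 u2] := uG q; split=> qx.
    by rewrite /= /pt_fun u1 ?linear0.
  rewrite ht_p; have -> : dt _ (pt a _ (ht _ u)) = pt a _ (dt _ (ht _ u)).
    apply: functional_extensionality_dep => -[|k].
      exact: (esym (linear0 (p a _ 0))).
    exact: (esym (p_d a (ht _ u k))).
  exact: (etrans (congr1 (p a (Some x) q) (u2 qx)) (linear0 _)).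
exists g'; split.
- by move=> S Sc; rewrite -/T Tg' //; apply/Gp_p/gG.
- exact: rep_p.
move=> x; rewrite gw -tau_p; apply: tau_ext => n S _.
rewrite upper_face => /andP[xS _]; rewrite /lw /low.
have := Tg' _ (upper_chainU xS); rewrite upper_mn // => ->.
by rewrite s_p.
Qed.

Lemma splitting_pos : exists phi : {linear H None i -> prodm (fun x => summ x i (dim x))},
  bijective phi /\
  forall a c x, phi (pH a None i c) x = summ_proj a x i (dim x) (phi c x).
Proof.
have [phi phi_bij phiP] := bij_of_linrel r_lin r_total r_fun0 r_surj r_inj.
exists phi; split=> // a c x.
have := linrel_fun r_lin r_fun0 (phiP (pH a None i c)) (r_proj a (phiP c)).
by move/(congr1 (fun w : prodm _ => w x)).
Qed.
End Degree.

Theorem splitting (i : int) :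
  exists phi : {linear H None i -> prodm (fun x => summ x i (dim x))},
  bijective phi /\
  forall a c x, phi (pH a None i c) x = summ_proj a x i (dim x) (phi c x).
Proof.
case: i => [i|n]; first exact: splitting_pos.
have w0 x e (w : summ x (Negz n) e) : w = 0.
  have [tau [_ tau0 tau_surj _ _]] := tau_ex x (Negz n) e.
  have [t _ <-] := tau_surj w; apply: (tau0 _ (fun=> 0)) => m S [r er mr] _.
  have -> : mdelta (fun=> 0) S = 0 :> coh_at x e by apply: big1 => y _; rewrite scaler0.
  (* For [i < 0] and [m >= 0], the equation [m = i - r] forces [r < 0], where the coefficients
     vanish. *)
  case: r er mr => [r|r] er mr; last by move: (t S); rewrite er => u; apply: H_neg.
  move: mr; rewrite NegzE -opprD -PoszD => /eqP.
  by case: (n.+1 + r)%N (addSn n r) => // k _; rewrite -NegzE.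
exists (zero_hom _ _); split=> [|a c x].
  apply: bijP => [c c' _|w]; first by rewrite [c]H_neg [c']H_neg.
  by exists 0; apply: functional_extensionality_dep => x; rewrite [RHS]w0 [LHS]w0.
by rewrite [RHS]w0 [LHS]w0.
Qed.
End Splitting.

(** * Local cohomology of a diagram of modules with exact rows *)

Section LocalCohomologySplitting.
Variables (disp : Order.disp_t) (P : finPOrderType disp) (K : fieldType) (A : kalg K).
Variables (I : ideal A) (F : ext_tower I).
Variables (M : option P -> lmodType A) (rho : forall o o', {linear M o' -> M o}).
Hypothesis rho_id : forall o u, rho o o u = u.
Hypothesis rho_comp : forall o o' o'' u, ole o o' -> ole o' o'' ->
  rho o o' (rho o' o'' u) = rho o o'' u.
Hypothesis rows : forall n (e : fam M),
  (forall S, chain S -> #|S| = n.+1 -> delta rho e S (mn S) = 0) ->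
  exists g, forall S, chain S -> #|S| = n -> e S (mn S) = delta rho g S (mn S).
Variables (D : eqType) (p : D -> forall o q N, {linear homs F (M o) q N -> homs F (M o) q N}).
Let post q N o o' : {linear homs F (M o') q N -> homs F (M o) q N} :=
  kmap (postcomp rho (F N q) o o').
Hypothesis p_sys : forall o q N, proj_system (fun a => p a o q N).
Hypothesis p_lift : forall a o q N u,
  p a o q N.+1 (homs_lift F (M o) q N u) = homs_lift F (M o) q N (p a o q N u).
Hypothesis p_diff : forall a o q N u,
  p a o q.+1 N (homs_diff F (M o) q N u) = homs_diff F (M o) q N (p a o q N u).
Hypothesis p_post : forall a o o' q N u, ole o o' ->
  p a o q N (post q N o o' u) = post q N o o' (p a o' q N u).
Variable dim : P -> \bar int.
Hypothesis dim_mono : forall x y : P, (x < y)%O -> (dim x < dim y)%O.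
Hypothesis loc_cohom_dim : forall x r, (r%:E)%E != dim x ->
  trivial_mod (loc_cohom F (M (Some x)) r).

Let post_lift q N o o' u :
  post q N.+1 o o' (homs_lift F (M o') q N u) = homs_lift F (M o) q N (post q N o o' u).
Proof. exact: hom_ext. Qed.

Let post_diff q N o o' u :
  post q.+1 N o o' (homs_diff F (M o') q N u) = homs_diff F (M o) q N (post q N o o' u).
Proof. exact: hom_ext. Qed.

Let G o q := lcx F (M o) q.
Let rG q o o' : {linear G o' q -> G o q} := colim_rho (@post_lift q) o o'.
Let pG a o q : {linear G o q -> G o q} := 
  lcx_proj (p := fun a => p a o) (fun a q N u => @p_lift a o q N u) a q.
Let H o r : lmodType K := kmod (loc_cohom F (M o) r).

Definition lc_proj a o r : {linear H o r -> H o r} :=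
  if r is Posz q as r return {linear H o r -> H o r}
  then coh_proj (p := fun a => p a o) (fun a q N u => @p_lift a o q N u)
    (fun a q N u => @p_diff a o q N u) a q else idfun.

Let G_cin o q (z : G o q) : exists N v, z = cin (homs_lift F (M o) q) N v.
Proof. exact: colim_cin. Qed.

Let rG_cin q o o' N v : rG q o o' (cin (homs_lift F (M o') q) N v) =
  cin (homs_lift F (M o) q) N (post q N o o' v).
Proof. exact: colim_map_cin. Qed.

Let dG_cin o q N v : lcx_diff F (M o) q (cin (homs_lift F (M o) q) N v) =
  cin (homs_lift F (M o) q.+1) N (homs_diff F (M o) q N v).
Proof. exact: colim_map_cin. Qed.

Let pG_cin a o q N v : pG a o q (cin (homs_lift F (M o) q) N v) =
  cin (homs_lift F (M o) q) N (p a o q N v).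
Proof. exact: colim_map_cin. Qed.

Theorem local_splitting (i : int) :
  exists phi : {linear H None i -> prodm (fun x => summ H x i (dim x))},
  bijective phi /\
  forall a c x, phi (lc_proj a None i c) x = summ_proj lc_proj a x i (dim x) (phi c x).
Proof.
apply: (@splitting _ P K D G (fun o q => lcx_diff F (M o) q) rG pG _ _ _ _ _ _ _ _
  H lc_proj (fun o q => @rep K A I F (M o) q)).
- move=> q o z; have [N [v ->]] := G_cin z; rewrite rG_cin; congr (cin _ N _).
  by apply: hom_ext => u; apply: rho_id.
- move=> q o o' o'' z h h'; have [N [v ->]] := G_cin z; rewrite !rG_cin; congr (cin _ N _).
  by apply: hom_ext => u; apply: rho_comp.
- by move=> o q z; apply: lcx_diffK.
- move=> q o o' z _; have [N [v ->]] := G_cin z.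
  by rewrite dG_cin !rG_cin dG_cin post_diff.
- move=> q n e de; apply: (@colim_rows _ P K (fun o N => homs F (M o) q N)
    (fun o N => homs_lift F (M o) q N) (fun N => post q N) (@post_lift q) _ n e de) => N k e' de'.
  have [S Sc Sk|g gP] := @hom_rows _ _ _ _ _ rows (F N q) (@pobj_proj _ _ (F N) q) k e'.
    by rewrite -delta_kmod; apply: de'.
  by exists g => S Sc Sk; rewrite delta_kmod gP.
- by move=> o q; apply: proj_system_colim => N; apply: p_sys.
- by move=> a o q z; apply: lcx_proj_diff => *; apply: p_diff.
- move=> a q o o' z h; have [N [v ->]] := G_cin z.
  by rewrite pG_cin !rG_cin pG_cin p_post.
- move=> o n c.
  have [N [e ->]] := colim_cin c; rewrite (_ : e = 0) ?linear0 //.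
  by apply/rowP => -[].
- by move=> o q k z c z' c'; apply: rep_lin.
- by move=> o q z c; apply: rep_cocycle.
- by move=> o q z; apply: rep_total.
- by move=> o q c; apply: rep_surj.
- by move=> o [|q] z; apply: rep0.
- by move=> o [|q] z c; apply: rep_bounds.
- by move=> a o q z c; apply: coh_projP.
- exact: dim_mono.
- by move=> x r xr c; apply: loc_cohom_dim.
Qed.
End LocalCohomologySplitting.

(** * The diagram of global sections and stalks *)

Section SectionModules.
Variables (disp : Order.disp_t) (P : finPOrderType disp) (K : fieldType).
Variable T : alg_sheaf P K.
Local Notation A := (T (whole P)).

Definition sec_mod (o : option P) : lmodType A :=
  if o is Some x then stalk_mod T x else (A : pzRingType)^o.

(** The identity on elements, but [sec_mod o] and [T (dn o)] agree only once [o] is known. [cv] and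
    [vc] move between the [A]-module and the ring of sections. *)
Let cv o : sec_mod o -> T (dn o) :=
  match o return sec_mod o -> T (dn o) with Some x => fun u => u | None => fun u => u end.
Let vc o : T (dn o) -> sec_mod o :=
  match o return T (dn o) -> sec_mod o with Some x => fun u => u | None => fun u => u end.
Let cvK o u : vc (@cv o u) = u. Proof. by case: o u. Qed.
Let vcK o u : cv (@vc o u) = u. Proof. by case: o u. Qed.
Let cvD o u v : cv (u + v) = @cv o u + cv v. Proof. by case: o u v. Qed.
Let cvZ o r u : cv (r *: u) = ares T (subsetT (dn o) : dn o \subset whole P) r * @cv o u.
Proof. by case: o u => [x|] u //=; rewrite ares_id. Qed.

Let res_mul o o' (r : A) (u : T (dn o')) :
  dn_res (mod_presheaf T) o o' (ares T (subsetT (dn o') : dn o' \subset whole P) r * u) =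
  ares T (subsetT (dn o) : dn o \subset whole P) r * dn_res (mod_presheaf T) o o' u.
Proof.
rewrite /dn_res /sres; case: {-}_ / boolP => [h|_]; last by rewrite /= mulr0.
by rewrite /= rmorphM; congr (_ * _); apply: ares_comp.
Qed.

Let sec_res_fun o o' (u : sec_mod o') : sec_mod o :=
  vc (dn_res (mod_presheaf T) o o' (cv u)).
Let sec_res_linear o o' : linear (@sec_res_fun o o').
Proof.
move=> r u v; apply: (can_inj (@cvK o)).
rewrite cvD cvZ !vcK cvD cvZ -res_mul; exact: linearD.
Qed.
Definition sec_res o o' : {linear sec_mod o' -> sec_mod o} := mklin (@sec_res_linear o o').

Lemma sec_res_id o u : sec_res o o u = u.
Proof. by rewrite /= /sec_res_fun [dn_res _ _ _ _]dn_res_id cvK. Qed.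

Lemma sec_res_comp o o' o'' u : ole o o' -> ole o' o'' ->
  sec_res o o' (sec_res o' o'' u) = sec_res o o'' u.
Proof. by move=> h h'; rewrite /= /sec_res_fun vcK dn_res_comp. Qed.

Definition on_sec_mod (Q : forall U, T U -> Prop) o : sec_mod o -> Prop :=
  if o is Some x as o return sec_mod o -> Prop then Q (down x) else Q (whole P).

Lemma sec_res_stable (Q : forall U, T U -> Prop) :
    (forall (U V : opens P) (VU : V \subset U) s, Q U s -> Q V (ares T VU s)) ->
  forall o o' u, ole o o' -> on_sec_mod Q u -> on_sec_mod Q (sec_res o o' u).
Proof.
move=> Qres o o' u oo' Qu; have sub := dn_sub oo'.
have {}Qu : Q (dn o') (cv u) by case: o' u Qu {oo' sub}.
have -> : on_sec_mod Q (sec_res o o' u) = Q (dn o) (cv (sec_res o o' u)) by case: (o).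
by rewrite /= /sec_res_fun vcK /dn_res (sresE sub); apply: Qres.
Qed.

Hypothesis T_acyclic : forall (J : inj_res (mod_presheaf T)) (i : int), 0 < i ->
  trivial_mod (sheaf_cohom J i).

Let cv_delta (e : fam sec_mod) S o : cv (delta sec_res e S o) =
  delta (dn_res (mod_presheaf T)) (fun S o => cv (e S o)) S o.
Proof.
rewrite /delta (big_morph (@cv o) (@cvD o) (id1 := 0)); last by case: (o).
apply: eq_bigr => s _; rewrite cvZ vcK rmorph_sign.
have scaleE k (w : usec T (dn o)) : k *: w = kstr (T (dn o)) k * (w : T (dn o)) by [].
by apply: esym; apply: etrans (scaleE _ _) _; rewrite rmorph_sign.
Qed.

Lemma sec_rows n (e : fam sec_mod) :
    (forall S, chain S -> #|S| = n.+1 -> delta sec_res e S (mn S) = 0) ->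
  exists g, forall S, chain S -> #|S| = n -> e S (mn S) = delta sec_res g S (mn S).
Proof.
move=> de; have [S Sc Sn|g gP] := @rows_exact _ P K (mod_presheaf T) (@alg_sheafP _ _ _ T)
    T_acyclic n (fun S o => cv (e S o)).
  by rewrite -cv_delta de //; case: (mn S).
exists (fun S o => vc (g S o)) => S Sc Sn; apply: (can_inj (@cvK (mn S))).
by rewrite cv_delta gP //; apply: eq_bigr => s _; rewrite vcK.
Qed.
End SectionModules.

(** * Gradings *)

Section GradingComponents.
Variables (d : nat) (V : zmodType) (GV : grading d V).
Implicit Types (a b : 'rV[int]_d) (s : seq 'rV[int]_d) (v : V).

Lemma gradN a v : GV a v -> GV a (- v).
Proof. by move=> av; rewrite -sub0r; apply: gradB => //; apply: grad0. Qed.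
Lemma gradD a u v : GV a u -> GV a v -> GV a (u + v).
Proof. by move=> au av; rewrite -[v]opprK; apply: gradB => //; apply: gradN. Qed.
Lemma gradMn a v n : GV a v -> GV a (v *+ n).
Proof.
move=> av; elim: n => [|n IHn]; first by rewrite mulr0n; apply: grad0.
by rewrite mulrS; apply: gradD.
Qed.

Lemma big_support (c : 'rV[int]_d -> V) s t : uniq s -> uniq t -> {subset s <= t} ->
  (forall a, a \notin s -> c a = 0) -> \sum_(a <- t) c a = \sum_(a <- s) c a.
Proof.
move=> us ut st c0; rewrite (bigID (mem s)) /= [X in _ + X]big1 ?addr0 //.
rewrite -big_filter; apply: perm_big; apply: uniq_perm => //; first exact: filter_uniq.
by move=> a; rewrite mem_filter andb_idr //; apply: st.
Qed.

Definition components v (c : 'rV[int]_d -> V) := (forall a, GV a (c a)) /\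
  exists s, [/\ uniq s, forall a, a \notin s -> c a = 0 & v = \sum_(a <- s) c a].

Lemma components_ex v : exists c, components v c.
Proof.
have [s [c [ca ->]]] := grad_sum GV v.
(* The list given by [grad_sum] may repeat a degree, whose component is then counted with
   multiplicity. *)
exists (fun a => c a *+ count_mem a s); split=> [a|]; first exact: gradMn.
exists (undup s); split; first exact: undup_uniq.
  by move=> a; rewrite mem_undup => /count_memPn->.
elim: s => [|a s IHs]; first by rewrite !big_nil.
rewrite big_cons IHs.
rewrite -(@big_support (fun b => c b *+ count_mem b s) (undup s) (undup (a :: s)))
  ?undup_uniq //; last 2 first.
- by move=> b; rewrite !mem_undup inE => ->; rewrite orbT.
- by move=> b; rewrite mem_undup => /count_memPn->.
have ain : a \in undup (a :: s) by rewrite mem_undup mem_head.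
rewrite [RHS](bigD1_seq a ain (undup_uniq _)) [in LHS](bigD1_seq a ain (undup_uniq _)) /=.
rewrite eqxx mulrS -addrA; congr (_ + (_ + _)); apply: eq_bigr => b ba.
by rewrite eq_sym (negPf ba).
Qed.

Lemma components_uniq v c c' : components v c -> components v c' -> c =1 c'.
Proof.
move=> [ca [s [us cs vE]]] [ca' [s' [us' cs' vE']]] a.
pose t := undup (s ++ s').
have st : {subset s <= t} by move=> b bs; rewrite mem_undup mem_cat bs.
have st' : {subset s' <= t} by move=> b bs; rewrite mem_undup mem_cat bs orbT.
have sum0 : \sum_(b <- t) (c b - c' b) = 0.
  rewrite sumrB (big_support us) ?undup_uniq // (big_support us') ?undup_uniq //.
  by rewrite -vE -vE' subrr.
have [at_|at_] := boolP (a \in t).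
  apply/eqP; rewrite -subr_eq0; apply/eqP.
  by apply: (grad_indep (undup_uniq _) _ sum0) at_ => b; apply: gradB.
by rewrite (cs _ (contra (@st a) at_)) (cs' _ (contra (@st' a) at_)).
Qed.

Definition comp v : 'rV[int]_d -> V := sval (cid (components_ex v)).
Lemma compP v : components v (comp v). Proof. exact: (svalP (cid (components_ex v))). Qed.
Lemma comp_grad v a : GV a (comp v a). Proof. by case: (compP v). Qed.
Lemma comp_eq v c : components v c -> comp v =1 c.
Proof. exact/components_uniq/compP. Qed.

Lemma comp_supp v : exists s, [/\ uniq s, forall a, a \notin s -> comp v a = 0
  & v = \sum_(a <- s) comp v a].
Proof. by case: (compP v). Qed.

Lemma comp_hom a v b : GV a v -> comp v b = if a == b then v else 0.
Proof.
move=> av; apply: (@comp_eq v (fun b => if a == b then v else 0)); split=> [c|].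
  by case: eqP => [<-//|_]; apply: grad0.
exists [:: a]; split=> // [c|]; last by rewrite big_seq1 eqxx.
by rewrite inE eq_sym => /negPf->.
Qed.

Lemma grading_ind (Q : V -> Prop) : Q 0 -> (forall u v, Q u -> Q v -> Q (u + v)) ->
  (forall a v, GV a v -> Q v) -> forall v, Q v.
Proof.
move=> Q0 QD Qhom v; have [s [_ _ ->]] := comp_supp v.
by apply: big_ind => // a _; apply: (Qhom a); apply: comp_grad.
Qed.
End GradingComponents.

Lemma comp_shift d (V V' : zmodType) (GV : grading d V) (GV' : grading d V')
    (f : {additive V -> V'}) (b : 'rV[int]_d) :
    (forall a v, GV a v -> GV' (b + a) (f v)) ->
  forall v a, comp GV' (f v) (b + a) = f (comp GV v a).
Proof.
move=> fG v a; rewrite -[in RHS](addKr b a) [- b + _]addrC.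
apply: (@comp_eq _ _ GV' (f v) (fun c => f (comp GV v (c - b)))); split=> [c|].
  by rewrite -{1}(subrK b c) addrC; apply/fG/comp_grad.
have [s [us s0 vE]] := comp_supp GV v; exists [seq b + c | c <- s]; split.
- by rewrite map_inj_uniq //; apply: addrI.
- move=> c cs; rewrite s0 ?raddf0 //; apply: contra cs => cs.
  by apply/mapP; exists (c - b); rewrite // addrC subrK.
- rewrite {1}vE raddf_sum big_map; apply: eq_bigr => c _.
  by rewrite [b + c]addrC addrK.
Qed.

Lemma compD d (V : zmodType) (GV : grading d V) u v a :
  comp GV (u + v) a = comp GV u a + comp GV v a.
Proof.
have [s [us s0 uE]] := comp_supp GV u; have [t [ut t0 vE]] := comp_supp GV v.
apply: (@comp_eq _ _ GV (u + v) (fun a => comp GV u a + comp GV v a)); split=> [c|].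
  by apply: gradD; apply: comp_grad.
exists (undup (s ++ t)); split; first exact: undup_uniq.
  by move=> c; rewrite mem_undup mem_cat => /norP[/s0-> /t0->]; rewrite addr0.
have ss : {subset s <= undup (s ++ t)} by move=> c cs; rewrite mem_undup mem_cat cs.
have st : {subset t <= undup (s ++ t)} by move=> c ct; rewrite mem_undup mem_cat ct orbT.
rewrite big_split /= (big_support us (undup_uniq _) ss s0).
by rewrite (big_support ut (undup_uniq _) st t0) -uE -vE.
Qed.

Lemma comp0 d (V : zmodType) (GV : grading d V) a : comp GV 0 a = 0.
Proof. by rewrite (comp_hom _ (grad0 GV a)) eqxx. Qed.

(** * Homogeneous components of module homomorphisms *)

Section HomGrading.
Variables (d : nat) (K : fieldType) (A : kalg K) (GA : grading d A).
Local Notation deg := 'rV[int]_d.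
Variables (X M : lmodType A) (GX : grading d X) (GM : grading d M).
Hypothesis GX_scale : forall a b (r : A) u, GA a r -> GX b u -> GX (a + b) (r *: u).
Hypothesis GM_scale : forall a b (r : A) u, GA a r -> GM b u -> GM (a + b) (r *: u).
Hypothesis GM_str : forall a k u, GM a u -> GM a (kstr A k *: u).
Implicit Types (a b : deg) (f g : {linear X -> M}).

Lemma hom_homog_ext f g : (forall b u, GX b u -> f u = g u) -> f = g.
Proof.
move=> fg; apply: hom_ext.
apply: (grading_ind (GV := GX) (Q := fun u => f u = g u)) => [|u v fu fv|b u]; last exact: fg.
  by rewrite !linear0.
by rewrite !linearD fu fv.
Qed.

(** The component of degree [a] of [f]: from the image of the part of [u] in degree [b], only degree
    [a + b] is kept. By [hp_funE] any list of degrees containing the support of [u] may be used. *)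
Let hp_fun a f u : M := \sum_(b <- sval (cid (comp_supp GX u))) comp GM (f (comp GX u b)) (a + b).

Let hp_funE a f u s : uniq s -> (forall b, b \notin s -> comp GX u b = 0) ->
  hp_fun a f u = \sum_(b <- s) comp GM (f (comp GX u b)) (a + b).
Proof.
move=> us s0; rewrite /hp_fun; case: (cid _) => t [ut t0 _] /=.
pose c b := comp GM (f (comp GX u b)) (a + b).
have c0 b : comp GX u b = 0 -> c b = 0 by rewrite /c => ->; rewrite linear0 comp0.
have ss : {subset s <= undup (s ++ t)} by move=> e es; rewrite mem_undup mem_cat es.
have st : {subset t <= undup (s ++ t)} by move=> e et; rewrite mem_undup mem_cat et orbT.
have cs e : e \notin s -> c e = 0 by move=> /s0/c0.
have ct e : e \notin t -> c e = 0 by move=> /t0/c0.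
by rewrite -(big_support ut (undup_uniq _) st ct) (big_support us (undup_uniq _) ss cs).
Qed.

Let hp_hom a f b u : GX b u -> hp_fun a f u = comp GM (f u) (a + b).
Proof.
move=> bu; rewrite (@hp_funE a f u [:: b]) // => [|c].
  by rewrite big_seq1 (comp_hom _ bu) eqxx.
by rewrite inE (comp_hom _ bu) eq_sym => /negPf->.
Qed.

Let hp_add a f u v : hp_fun a f (u + v) = hp_fun a f u + hp_fun a f v.
Proof.
have [s [us s0 _]] := comp_supp GX u; have [t [ut t0 _]] := comp_supp GX v.
have st0 w : (forall b, b \notin undup (s ++ t) -> comp GX w b = 0) ->
    hp_fun a f w = \sum_(b <- undup (s ++ t)) comp GM (f (comp GX w b)) (a + b).
  by apply: hp_funE; apply: undup_uniq.
have z0 b : b \notin undup (s ++ t) -> comp GX u b = 0 /\ comp GX v b = 0.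
  by rewrite mem_undup mem_cat => /norP[/s0 us0 /t0 vt0].
rewrite !st0 => [|b /z0[]|b /z0[]|b /z0[ub vb]] //; last by rewrite compD ub vb addr0.
by rewrite -big_split; apply: eq_bigr => b _; rewrite compD linearD compD.
Qed.

Let hp_scale a f (r : A) u : hp_fun a f (r *: u) = r *: hp_fun a f u.
Proof.
have hp0 : hp_fun a f 0 = 0 by apply: (addrI (hp_fun a f 0)); rewrite -hp_add !addr0.
move: r; apply: (grading_ind (GV := GA) (Q := fun r => hp_fun a f (r *: u) = r *: hp_fun a f u))
  => [|r r' IHr IHr'|c r rc].
- by rewrite !scale0r.
- by rewrite !scalerDl hp_add IHr IHr'.
move: u; apply: (grading_ind (GV := GX) (Q := fun u => hp_fun a f (r *: u) = r *: hp_fun a f u))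
  => [|u v IHu IHv|b u bu].
- by rewrite !scaler0 hp0 scaler0.
- by rewrite scalerDr !hp_add IHu IHv scalerDr.
rewrite (hp_hom _ _ (GX_scale rc bu)) (hp_hom _ _ bu) linearZ addrCA.
apply: (comp_shift (f := GRing.scale r : {additive M -> M})) => e v ev.
exact: GM_scale.
Qed.

Let hp_linear a f : linear (hp_fun a f).
Proof. by move=> r u v; rewrite hp_add hp_scale. Qed.
Definition hom_part a f : {linear X -> M} := mklin (hp_linear a f).

Lemma hom_partE a f b u : GX b u -> hom_part a f u = comp GM (f u) (a + b).
Proof. exact: hp_hom. Qed.

Let comp_str (k : K) (w : M) a : comp GM (kstr A k *: w) a = kstr A k *: comp GM w a.
Proof.
rewrite -{1}[a]add0r.
by apply: (comp_shift (f := GRing.scale (kstr A k) : {additive M -> M})) => e v ev;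
   rewrite add0r; apply: GM_str.
Qed.

Local Notation HXM := (kmod {linear X -> M}).

Fact hom_part_linear a : linear (hom_part a : HXM -> HXM).
Proof.
move=> k f g; apply: hom_homog_ext => b u bu; rewrite (hom_partE _ _ bu).
rewrite [RHS](_ : _ = kstr A k *: hom_part a f u + hom_part a g u) //.
by rewrite !(hom_partE _ _ bu) -comp_str -compD.
Qed.
Definition hom_proj a : {linear HXM -> HXM} := mklin (@hom_part_linear a).

Lemma hom_projE a f b u : GX b u -> (hom_proj a f : {linear X -> M}) u = comp GM (f u) (a + b).
Proof. exact: hom_partE. Qed.

Definition homog a f := forall b u, GX b u -> GM (a + b) (f u).

Lemma hom_proj_homog a f : homog a (hom_proj a f).
Proof. by move=> b u bu; rewrite (hom_projE _ _ bu); apply: comp_grad. Qed.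

Lemma hom_proj_fix a f : homog a f -> hom_proj a f = f.
Proof.
move=> fa; apply: hom_homog_ext => b u bu.
by rewrite (hom_projE _ _ bu) (comp_hom _ (fa _ _ bu)) eqxx.
Qed.

Hypothesis X_fg : exists s : seq X, forall u, u \in spanm (fun v => v \in s).

(** On each of the finitely many generators only finitely many components of [f] are nonzero, and a
    component that vanishes on the generators is zero. This makes [f] a finite sum of its
    components. *)
Lemma hom_part_fin f : exists s : seq deg, uniq s /\ forall a, a \notin s -> hom_part a f = 0.
Proof.
have [gs gsP] := X_fg.
have fin u : exists t : seq deg, forall a, a \notin t -> hom_part a f u = 0.
  move: u; apply: (grading_ind (GV := GX)
    (Q := fun u => exists t : seq deg, forall a, a \notin t -> hom_part a f u = 0))
    => [|u v [t tP] [t' tP']|b u bu].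
  - by exists [::] => a _; rewrite linear0.
  - exists (t ++ t') => a; rewrite mem_cat => /norP[at_ at'].
    by rewrite linearD tP // tP' // addr0.
  have [t [_ t0 _]] := comp_supp GM (f u); exists [seq c - b | c <- t] => a at_.
  rewrite (hom_partE _ _ bu) t0 //; apply: contra at_ => at_.
  by apply/mapP; exists (a + b); rewrite // addrK.
have [s sP] : exists s : seq deg, forall x, x \in gs -> forall a, a \notin s -> hom_part a f x = 0.
  elim: gs {gsP} => [|x gs [s sP]]; first by exists [::].
  have [t tP] := fin x; exists (t ++ s) => y; rewrite inE => /predU1P[->|ys] a.
    by rewrite mem_cat => /norP[/tP].
  by rewrite mem_cat => /norP[_]; apply: sP.
exists (undup s); split=> [|a]; first exact: undup_uniq.
rewrite mem_undup => as_; apply: hom_ext => u.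
have /asboolP/(_ (kerm (hom_part a f))) H := gsP u.
by have /asboolP := H (fun x xs => introT (asboolP _) (sP x xs a as_)).
Qed.

Lemma hom_part_sum f (s : seq deg) : uniq s -> (forall a, a \notin s -> hom_part a f = 0) ->
  f = \sum_(a <- s) hom_part a f.
Proof.
move=> us s0; apply: hom_homog_ext => b u bu.
have -> : (\sum_(a <- s) hom_part a f) u = \sum_(a <- s) hom_part a f u.
  by apply: (big_morph (fun g : {linear X -> M} => g u)).
have [t [ut t0 fuE]] := comp_supp GM (f u).
pose t' := [seq c - b | c <- t].
have ut' : uniq t' by rewrite map_inj_uniq //; apply: addIr.
have t'0 a : a \notin t' -> hom_part a f u = 0.
  move=> at_; rewrite (hom_partE _ _ bu) t0 //; apply: contra at_ => at_.
  by apply/mapP; exists (a + b); rewrite // addrK.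
have s0' a : a \notin s -> hom_part a f u = 0.
  by move=> /s0/(congr1 (fun g : {linear X -> M} => g u)).
have ss : {subset s <= undup (s ++ t')} by move=> e es; rewrite mem_undup mem_cat es.
have st : {subset t' <= undup (s ++ t')} by move=> e et; rewrite mem_undup mem_cat et orbT.
rewrite -(big_support us (undup_uniq _) ss s0') (big_support ut' (undup_uniq _) st t'0).
rewrite {1}fuE big_map; apply: eq_bigr => c _.
by rewrite (hom_partE _ _ bu) subrK.
Qed.

Lemma hom_proj_system : proj_system hom_proj.
Proof.
split=> [a b f | S f fS].
  apply: hom_homog_ext => c u cu; rewrite (hom_projE _ _ cu) (hom_projE _ _ cu).
  rewrite (comp_hom _ (comp_grad GM (f u) (a + c))) (inj_eq (addIr c)).
  by case: eqP => // _; rewrite (hom_projE _ _ cu).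
have [s [us s0]] := hom_part_fin f.
rewrite [f](hom_part_sum us s0); suff : \sum_(a <- s) hom_proj a f \in S by [].
by apply: rpred_sum => a _; apply: fS.
Qed.
End HomGrading.

Section HomGradingMaps.
Variables (d : nat) (K : fieldType) (A : kalg K) (GA : grading d A).
Variables (X M X' M' : lmodType A).
Variables (GX : grading d X) (GM : grading d M) (GX' : grading d X') (GM' : grading d M').
Hypothesis GX_scale : forall a b (r : A) u, GA a r -> GX b u -> GX (a + b) (r *: u).
Hypothesis GX'_scale : forall a b (r : A) u, GA a r -> GX' b u -> GX' (a + b) (r *: u).
Hypothesis GM_scale : forall a b (r : A) u, GA a r -> GM b u -> GM (a + b) (r *: u).
Hypothesis GM'_scale : forall a b (r : A) u, GA a r -> GM' b u -> GM' (a + b) (r *: u).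
Hypothesis GM_str : forall a k u, GM a u -> GM a (kstr A k *: u).
Hypothesis GM'_str : forall a k u, GM' a u -> GM' a (kstr A k *: u).

Lemma hom_proj_precomp (g : {linear X' -> X}) a (f : {linear X -> M}) :
    (forall b u, GX' b u -> GX b (g u)) ->
  hom_proj GX'_scale GM_scale GM_str a (kmap (precomp g) f) =
  kmap (precomp g) (hom_proj GX_scale GM_scale GM_str a f).
Proof.
move=> gdeg; apply: (@hom_homog_ext _ _ _ _ _ GX') => b u bu.
rewrite (hom_projE _ _ _ _ _ bu).
exact: (esym (hom_projE GX_scale GM_scale GM_str a f (gdeg b u bu))).
Qed.

Lemma hom_proj_postcomp (h : {linear M -> M'}) (f f' : {linear X -> M'}) a
    (g : {linear X -> M}) :
    (forall b v, GM b v -> GM' b (h v)) -> (forall u, f u = h (g u)) ->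
    (forall u, f' u = h ((hom_proj GX_scale GM_scale GM_str a g : {linear X -> M}) u)) ->
  hom_proj GX_scale GM'_scale GM'_str a f = f'.
Proof.
move=> hdeg fE f'E; apply: (@hom_homog_ext _ _ _ _ _ GX) => b u bu.
rewrite (hom_projE _ _ _ _ _ bu) f'E (hom_projE _ _ _ _ _ bu) fE -{1}[a + b]add0r.
by apply: comp_shift => c v cv; rewrite add0r; apply: hdeg.
Qed.
End HomGradingMaps.

(** * Homogeneous classes as fixed points of projections *)

Section GradedLocalCohomology.
Variables (d : nat) (K : fieldType) (A : kalg K) (GA : grading d A).
Variables (I : ideal A) (F : ext_tower I) (GF : tower_grading GA F).
Variables (M : lmodType A) (GM : grading d M).
Hypothesis GM_scale : forall a b (r : A) u, GA a r -> GM b u -> GM (a + b) (r *: u).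
Hypothesis GM_str : forall a k u, GM a u -> GM a (kstr A k *: u).

Definition homs_proj a q N : {linear homs F M q N -> homs F M q N} :=
  hom_proj (@tower_gradZ _ _ _ _ _ GF N q) GM_scale GM_str a.

Lemma homs_proj_system q N : proj_system (fun a => homs_proj a q N).
Proof. exact: hom_proj_system (tower_fg GF N q). Qed.

Lemma homs_proj_lift a q N u :
  homs_proj a q N.+1 (homs_lift F M q N u) = homs_lift F M q N (homs_proj a q N u).
Proof. by apply: hom_proj_precomp => b v; apply: tower_grad_lift. Qed.

Lemma homs_proj_diff a q N u :
  homs_proj a q.+1 N (homs_diff F M q N u) = homs_diff F M q N (homs_proj a q N u).
Proof. by apply: hom_proj_precomp => b v; apply: tower_grad_diff. Qed.

Let rep_fun q z c c' : @rep _ _ _ F M q z c -> rep z c' -> c = c'.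
Proof.
apply: linrel_fun => [k v w v' w'|w zw]; first exact: rep_lin.
apply: rep_bounds zw _; case: q {z c c' w} => [//|q].
by exists 0; rewrite linear0.
Qed.

Local Notation LH q := (kmod (loc_cohom F M (Posz q))).

(** Beyond the stage where the sequence becomes compatible, one of its terms represents the class by
    a homogeneous cocycle, and the projection fixes that cocycle. *)
Lemma loc_cohom_deg_fix a q (c : LH q) : loc_cohom_deg GF GM a (i := Posz q) c ->
  coh_proj homs_proj_lift homs_proj_diff a q c = c.
Proof.
case=> e eE eh.
have [m em] : exists m, forall n, (m <= n)%N -> val e n.+1 = exts_lift F M q n (val e n).
  by have /asboolP := subm_valP e.
have [z zE zh] := eh m.
have cE : c = cin (exts_lift F M q) m (subclass _ _ z).
  rewrite -eE. rewrite [in RHS]zE. apply: (cin_tail em (leqnn m)).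
have zc : rep (cin (homs_lift F M q) m (val z)) c by exists m, z.
have := coh_projP homs_proj_lift homs_proj_diff a zc.
rewrite [lcx_proj _ _ _ _]colim_map_cin.
have -> : homs_proj a q m (val z) = val z by apply: hom_proj_fix.
by move/rep_fun; apply.
Qed.

(** Projecting a cocycle that represents [c] gives a homogeneous one for the same class. Its images
    at later stages are again fixed by the projection, hence homogeneous, and earlier stages are
    filled with zero. *)
Lemma fix_loc_cohom_deg a q (c : LH q) :
  coh_proj homs_proj_lift homs_proj_diff a q c = c ->
  loc_cohom_deg GF GM a (i := Posz q) c.
Proof.
move=> pc; have [z zc] := rep_surj c; have zc' := zc; case: zc => [N [f [zE cE]]].
have := coh_projP homs_proj_lift homs_proj_diff a zc'.
rewrite zE [lcx_proj _ _ _ _]colim_map_cin pc => pzc.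
have df' : homs_proj a q N (val f) \in cocyc (Hom_cochain (F N) M) q.
  have dE : homs_diff F M q N (homs_proj a q N (val f)) = 0; last by apply/asboolP; exact: dE.
  rewrite -homs_proj_diff -[RHS](linear0 (homs_proj a q.+1 N)).
  by have /asboolP df := subm_valP f; congr (homs_proj a q.+1 N _); exact: df.
pose f' : subm (cocyc (Hom_cochain (F N) M) q) := Subm df'.
have c'E : c = cin (exts_lift F M q) N (subclass _ _ f').
  by apply: (rep_fun pzc); exists N, f'.
pose e := Subm (raise_compat (exts_lift F M q) (n := N) (subclass _ _ f')).
have eE : subclass _ _ e = c by rewrite c'E.
refine (ex_intro2 _ _ e eE _) => m.
have [Nm|mN] := leqP N m; last first.
  exists 0; last by move=> b u _; apply: grad0.
  rewrite linear0; apply: esym; exact: (raise_gt (exts_lift F M q) _ mN).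
have [f'' f''E clsE] := raise_class f' Nm; exists f''; first exact: esym clsE.
have -> : val f'' = homs_proj a q m (val f'').
  rewrite f''E; apply: esym; apply: etrans (raise_map (@homs_proj_lift a q) _ Nm) _.
  congr (raise _ N m _); have := (homs_proj_system q N).1 a a (val f).
  by rewrite eqxx; apply.
exact: hom_proj_homog.
Qed.

Lemma coh_proj_deg a q (c : LH q) :
  loc_cohom_deg GF GM a (i := Posz q) (coh_proj homs_proj_lift homs_proj_diff a q c).
Proof.
have [z zc] := rep_surj c; apply: fix_loc_cohom_deg.
have pzc := coh_projP homs_proj_lift homs_proj_diff a zc.
apply: rep_fun (coh_projP homs_proj_lift homs_proj_diff a pzc) _.
have [N [v zE]] := colim_cin z; move: pzc.
rewrite zE [lcx_proj _ _ _ _]colim_map_cin [lcx_proj _ _ _ _]colim_map_cin.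
by rewrite (homs_proj_system q N).1 eqxx.
Qed.
End GradedLocalCohomology.

Section GradedSections.
Variables (disp : Order.disp_t) (P : finPOrderType disp) (K : fieldType).
Variables (T : alg_sheaf P K) (d : nat) (G : sheaf_grading d T).
Local Notation A := (T (whole P)).

Definition sec_grading (o : option P) : grading d (sec_mod T o) :=
  match o return grading d (sec_mod T o) with
  | Some x => alg_grad (G (down x)) | None => alg_grad (G (whole P)) end.

Lemma sec_grading_scale o a b (r : A) (u : sec_mod T o) :
  G (whole P) a r -> sec_grading o b u -> sec_grading o (a + b) (r *: u).
Proof.
case: o u => [x|] u ra ub; last exact: alg_gradM.
by apply: alg_gradM => //; apply: sheaf_grad_res.
Qed.

Lemma sec_grading_str o a k (u : sec_mod T o) :
  sec_grading o a u -> sec_grading o a (kstr A k *: u).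
Proof.
case: o u => [x|] u ua; last exact: alg_gradZ.
have -> : kstr A k *: u = (kstr (T (down x)) k * u : T (down x)).
  by rewrite -(ares_str T (subsetT (down x) : down x \subset whole P) k).
exact: alg_gradZ.
Qed.

Lemma sec_grading_res o o' a (u : sec_mod T o') : ole o o' ->
  sec_grading o' a u -> sec_grading o a (sec_res T o o' u).
Proof.
have E o1 (v : sec_mod T o1) : on_sec_mod (fun U => G U a) v = sec_grading o1 a v.
  by case: o1 v.
move=> oo'; rewrite -!E; apply: sec_res_stable oo'.
by move=> U V VU s; apply: sheaf_grad_res.
Qed.

Variables (I : ideal A) (F : ext_tower I) (GF : tower_grading (G (whole P)) F).

Definition sec_proj a o q N : {linear homs F (sec_mod T o) q N -> homs F (sec_mod T o) q N} :=
  homs_proj GF (@sec_grading_scale o) (@sec_grading_str o) a q N.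

Lemma sec_proj_system o q N : proj_system (fun a => sec_proj a o q N).
Proof. exact: homs_proj_system. Qed.

(** Kept transparent, like [sec_proj_diff]: these proofs are arguments of [coh_proj], and
    [sec_loc_projP] compares such projections up to conversion. *)
Lemma sec_proj_lift a o q N u :
  sec_proj a o q N.+1 (homs_lift F (sec_mod T o) q N u) =
  homs_lift F (sec_mod T o) q N (sec_proj a o q N u).
Proof. exact: homs_proj_lift. Defined.

Lemma sec_proj_diff a o q N u :
  sec_proj a o q.+1 N (homs_diff F (sec_mod T o) q N u) =
  homs_diff F (sec_mod T o) q N (sec_proj a o q N u).
Proof. exact: homs_proj_diff. Defined.

Lemma sec_proj_post a o o' q N u : ole o o' ->
  sec_proj a o q N (kmap (postcomp (@sec_res _ P K T) (F N q) o o') u) =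
  kmap (postcomp (@sec_res _ P K T) (F N q) o o') (sec_proj a o' q N u).
Proof.
move=> oo'; apply: (@hom_proj_postcomp _ _ _ _ _ _ _ _ (sec_grading o') _ _
  (@sec_grading_scale o') _ (@sec_grading_str o') _ (sec_res T o o') _ _ a u) => // b v.
exact: sec_grading_res.
Qed.

Definition sec_loc_proj a o r : {linear kmod (loc_cohom F (sec_mod T o) r) -> _} :=
  lc_proj (p := sec_proj) sec_proj_lift sec_proj_diff a o r.

Lemma sec_loc_projP a o r (c : kmod (loc_cohom F (sec_mod T o) r)) :
  loc_cohom_deg GF (sec_grading o) a c <-> sec_loc_proj a o r c = c.
Proof.
case: r c => [q|n] c; first split.
- exact: (@loc_cohom_deg_fix _ _ _ _ _ _ GF _ _ (@sec_grading_scale o) (@sec_grading_str o) a q c).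
- exact: (@fix_loc_cohom_deg _ _ _ _ _ _ GF _ _ (@sec_grading_scale o) (@sec_grading_str o) a q c).
- split=> // _; have [e eE] := subclass_surj c; exists e; first exact: esym eE.
by [].
Qed.

Lemma sec_loc_proj_deg a o r (c : kmod (loc_cohom F (sec_mod T o) r)) :
  loc_cohom_deg GF (sec_grading o) a (sec_loc_proj a o r c).
Proof.
case: r c => [q|n] c; last by apply/sec_loc_projP.
exact: (@coh_proj_deg _ _ _ _ _ _ GF _ _ (@sec_grading_scale o) (@sec_grading_str o) a q c).
Qed.

(** On the tensor product the projection is [1 (x) p]. It fixes every [tens v w] with [w]
    homogeneous; conversely a fixed [u] is its own projection, and projections of pure tensors lie
    in the span of these elements. *)
Lemma summand_degP a x i e (u : summand F x i e) :
  summand_deg GF a u <-> summ_proj sec_loc_proj a x i e u = u.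
Proof.
case: e u => [r| |] u; try by split.
pose p := summ_proj sec_loc_proj a x i r%:E.
have fix0 : p 0 = 0 by rewrite linear0.
have fix_lin k v w : p v = v -> p w = w -> p (k *: v + w) = k *: v + w.
  by move=> pv pw; rewrite linearP pv pw.
split=> [/asboolP/(_ (submod_of fix0 fix_lin)) uspan|pu].
  suff /asboolP : u \in submod_of fix0 fix_lin by [].
  apply: uspan => _ [v [w [wa ->]]]; apply/asboolP.
  have E : sec_loc_proj a (Some x) r w = w := iffLR (@sec_loc_projP a (Some x) r w) wa.
  by rewrite [LHS]tensor_map_tens E.
rewrite -pu /summand_deg; set S := spanm _.
suff : u \in preimm p S by move/asboolP.
apply: tensor_ind => v w; apply/asboolP; rewrite [p _]tensor_map_tens.
apply/asboolP => S' S'P; apply: S'P; exists v, (sec_loc_proj a (Some x) r w).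
by split=> //; apply: (sec_loc_proj_deg a (o := Some x)).
Qed.
End GradedSections.

(** * The decomposition and its compatibility with gradings *)

Theorem theorem1p1 (disp : Order.disp_t) (P : finPOrderType disp) (K : fieldType)
    (T : alg_sheaf P K) (I : ideal (T (whole P))) (F : ext_tower I)
    (dim : P -> \bar int)
    (hdim : forall x, is_krull_dim (T (down x)) (dim x))
    (hnoeth : noetherian (T (whole P)))
    (hcoh : forall (J : inj_res (mod_presheaf T)) (i : int), 0 < i ->
      trivial_mod (sheaf_cohom J i))
    (hlc : forall (x : P) (i : int), (i%:E)%E != dim x ->
      trivial_mod (loc_cohom F (stalk_mod T x) i))
    (hmono : forall x y : P, (x < y)%O -> (dim x < dim y)%O)
    (i : int) :
  (exists phi : {linear kmod (loc_cohom F (T (whole P) : pzRingType)^o i) ->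
                        prodm (fun x : P => summand F x i (dim x))},
     bijective phi)
  /\
  (forall (d : nat) (G : sheaf_grading d T) (GF : tower_grading (G (whole P)) F),
     graded_ideal (G (whole P)) I ->
     exists phi : {linear kmod (loc_cohom F (T (whole P) : pzRingType)^o i) ->
                          prodm (fun x : P => summand F x i (dim x))},
       bijective phi /\
       forall (a : 'rV[int]_d) (u : kmod (loc_cohom F (T (whole P) : pzRingType)^o i)),
         @loc_cohom_deg d _ (G (whole P)) I F GF (T (whole P) : pzRingType)^o
           (G (whole P)) a i u
         <-> forall x : P, summand_deg GF a (phi u x)).
Proof.
pose split_by D := @local_splitting _ P K (T (whole P)) I F (sec_mod T) (@sec_res _ P K T)
  (@sec_res_id _ P K T) (@sec_res_comp _ P K T) (sec_rows hcoh) D.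
split.
  have [phi [phi_bij _]] := split_by unit (fun a o q N => idfun)
    (fun o q N => proj_system_id _) (fun a o q N u => erefl) (fun a o q N u => erefl)
    (fun a o o' q N u _ => erefl) dim hmono hlc i.
  by exists phi.
move=> d G GF _.
have [phi [phi_bij phiP]] := split_by _ (sec_proj GF) (sec_proj_system GF) (sec_proj_lift GF)
  (sec_proj_diff GF) (sec_proj_post GF) dim hmono hlc i.
exists phi; split=> // a u; split=> [ua x|phi_deg].
  apply/summand_degP; apply: etrans (esym (phiP a u x)) _.
  by rewrite (iffLR (@sec_loc_projP _ _ _ _ _ G I F GF a None i u) ua).
suff E : sec_loc_proj GF a None i u = u.
  exact: (iffRL (@sec_loc_projP _ _ _ _ _ G I F GF a None i u) E).
(* As [phi] is injective and commutes with the projections, [u] is fixed as soon as all components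
   of its image are. *)
apply: (bij_inj phi_bij); apply: functional_extensionality_dep => x.
apply: etrans (phiP a u x) _.
exact: (iffLR (@summand_degP _ _ _ _ _ G I F GF a x i (dim x) (phi u x)) (phi_deg x)).
Qed.
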